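(* For each prime $p$ let $A_p=\mathbb{F}_p\langle s,t\rangle$, and let $A=\mathbb{Z}\langle s,t\rangle$ (non-commutative polynomial rings). Let $\mathcal{B}_{\mathrm{uc}}$ be the class of all uniformly convex Banach spaces. (1) Let $p$ be a prime. If $\mathrm{E}(2,A_p)\ltimes A_p^2\trianglerighteq A_p^2$ has relative property $(\mathrm{T}_{\mathcal{B}_{\mathrm{uc}}})$ with respect to the standard finite subset, then $\mathrm{E}(n,A_p)$ has property $(\mathrm{F}_{\mathcal{B}_{\mathrm{uc}}})$ for all $n\geq 4$. In particular, then, the sequence $(\mathrm{SL}(n,\mathbb{F}_p))_{n\geq 4}$ can form super-expanders. (2) If $\mathrm{E}(2,A)\ltimes A^2\trianglerighteq A^2$ has relative property $(\mathrm{T}_{\mathcal{B}_{\mathrm{uc}}})$ with respect to the standard finite subset, then $\mathrm{E}(n,A)$ has property $(\mathrm{F}_{\mathcal{B}_{\mathrm{uc}}})$ for all $n\geq 4$. In particular, then, for every sequence of primes $(p_n)_{n\geq 4}$, the sequence $(\mathrm{SL}(n,\mathbb{F}_{p_n}))_{n\geq 4}$ can form super-expanders.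
   Context: For a unital associative ring $R$ and $n\geq 2$, the elementary group $\mathrm{E}(n,R)\leqslant\mathrm{GL}(n,R)$ is generated by the elementary matrices $e_{i,j}(r)$ ($i\ne j$, $r\in R$), where $e_{i,j}(r)$ has $1$'s on the diagonal, $r$ in position $(i,j)$ and $0$ elsewhere. $\mathrm{E}(m,R)\ltimes R^m$ is the semidirect product for the natural action on column vectors. Standard finite subset: for $R=\mathbb{F}_p\langle t_1,\ldots,t_k\rangle$ or $\mathbb{Z}\langle t_1,\ldots,t_k\rangle$ and $m\ge2$, with $t_0:=1$, the standard finite subset of $\mathrm{E}(m,R)\ltimes R^m$ is the union of $\{e_{i,j}(\pm t_a): i\neq j,\ 0\le a\le k\}\subseteq\mathrm{E}(m,R)$ and $\{(0,\ldots,0,\pm t_a,0,\ldots,0):0\le a\le k\}\subseteq R^m$ (with the nonzero entry in any of the $m$ positions). Here $(t_1,t_2)=(s,t)$ and $m=2$. A Banach space $E$ is uniformly convex if there is $\delta\colon(0,2]\to\mathbb{R}_{>0}$ with $1-\|\xi+\eta\|/2\geq\delta(\|\xi-\eta\|)$ for all $\xi\neq\eta$ with $\|\xi\|=\|\eta\|=1$. Relative property $(\mathrm{T}_{\mathcal{E}})$: let $\mathcal{E}$ be a class of Banach spaces, $\Lambda$ a countable group, $M\trianglelefteq\Lambda$, and $K\subseteq\Lambda$ a finite subset. $\Lambda\trianglerighteq M$ has relative property $(\mathrm{T}_{\mathcal{E}})$ with respect to $K$ if for every $E\in\mathcal{E}$ and every linear isometric representation $\rho\colon\Lambda\to O(E)$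 ($O(E)$ the group of surjective linear isometries of $E$) there is $\epsilon>0$ such that $\max_{s\in K}\|\rho(s)\zeta-\zeta\|\geq\epsilon\|\overline{\zeta}\|_{\overline{E}}$ for all $\zeta\in E$, where $\overline{E}=E/E^{\rho(M)}$ with the quotient norm, $E^{\rho(M)}$ is the subspace of $\rho(M)$-fixed vectors, and $\overline{\zeta}$ is the image of $\zeta$. A finitely generated group $G$ has property $(\mathrm{F}_{\mathcal{E}})$ if every action of $G$ by isometries on every $E\in\mathcal{E}$ has a global fixed point. Super-expanders: for a finite graph $\Gamma=(V(\Gamma),E(\Gamma))$ with oriented edges $e=(e^-,e^+)$ and a metric space $X$, let $$\lambda(\Gamma,X)=\frac12\inf_{f\colon V(\Gamma)\to X}\frac{|V(\Gamma)|^2\sum_{e\in E(\Gamma)}d(f(e^+),f(e^-))^2}{|E(\Gamma)|\sum_{(v,w)\in V(\Gamma)^2}d(f(v),f(w))^2},$$ the infimum over non-constant maps. A sequence of finite graphs $(\Gamma_n)_n$ with uniformly bounded degree and $|V(\Gamma_n)|\to\infty$ is a sequence of super-expanders if $\inf_n\lambda(\Gamma_n,X)>0$ for every $X\in\mathcal{B}_{\mathrm{uc}}$. A sequence of finite groups $(G_n)_n$ ''can form super-expanders'' if there are finite generating sets $S_n$ of $G_n$ such that the Cayley graphs $\mathrm{Cay}(G_n,S_n)$ (vertices $G_n$, edges $\{(h,ht):h\in G_n,t\in S_n\}$) form a sequence of super-expanders. *)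

(* Defs.v *)
From HB Require Import structures.
From mathcomp Require Import all_boot all_order all_algebra all_fingroup.
From mathcomp Require Import all_classical all_reals all_analysis.
(* The notations of finmap and monalg clash with those of mathcomp-analysis. *)
From mathcomp Require Import -(notations) finmap monalg.

Set Implicit Arguments.
Unset Strict Implicit.
Unset Printing Implicit Defensive.

Import Order.TTheory GRing.Theory Num.Theory.
Import numFieldNormedType.Exports.

Local Open Scope classical_set_scope.
Local Open Scope ring_scope.

Section Subgroups.
Variable G : groupType.

Definition is_subgroup (H : set G) : Prop :=
  H 1%g /\ forall x y : G, H x -> H y -> H (x * y^-1)%g.

Definition normal_subgroup (H : set G) : Prop :=
  is_subgroup H /\ forall x y : G, H y -> H (x * y * x^-1)%g.

Definition finitely_generated : Prop :=
  exists K : seq G, smallest is_subgroup [set` K] = setT.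

Variable S : set G.

Definition generated_pred : {pred G} := [pred g | `[< smallest is_subgroup S g >]].

Lemma generated_group_closed : group_closed generated_pred.
Proof.
split; first by apply/asboolP => H [[H1 _] _].
move=> x y /asboolP xS /asboolP yS; apply/asboolP => H HS.
by case: (HS) => -[_ HV] _; apply: HV; [exact: xS | exact: yS].
Qed.

Lemma sub_generated (g : G) : S g -> g \in generated_pred.
Proof. by move=> Sg; apply/asboolP => H [_]; apply. Qed.

Record generated_group :=
  GeneratedGroup { generated_val : G; _ : generated_val \in generated_pred }.

HB.instance Definition _ := [isSub for generated_val].
HB.instance Definition _ := [Choice of generated_group by <:].
HB.instance Definition _ :=
  SubChoice_isSubGroup.Build G generated_pred generated_group
    generated_group_closed.

End Subgroups.

Section GeneralLinear.
Variables (R : nzRingType) (n : nat).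

(* An element is a matrix packed with its (unique) two-sided inverse: the
   library only provides inverses of matrices over commutative rings. *)
Definition mx_inverse_pair : pred ('M[R]_n * 'M[R]_n) :=
  [pred AB | (AB.1 *m AB.2 == 1%:M) && (AB.2 *m AB.1 == 1%:M)].

Record GL := MkGL { GL_pair : 'M[R]_n * 'M[R]_n; _ : mx_inverse_pair GL_pair }.

HB.instance Definition _ := [isSub for GL_pair].
HB.instance Definition _ := [Choice of GL by <:].

Definition GL_mx (g : GL) : 'M[R]_n := (GL_pair g).1.

Lemma GL_one_subproof : mx_inverse_pair (1%:M, 1%:M).
Proof. by rewrite /mx_inverse_pair /= mulmx1 eqxx. Qed.

Lemma GL_mul_subproof (g h : GL) :
  mx_inverse_pair ((GL_pair g).1 *m (GL_pair h).1, (GL_pair h).2 *m (GL_pair g).2).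
Proof.
case: g h => [[A B] /= /andP[/eqP AB /eqP BA]] [[C D] /= /andP[/eqP CD /eqP DC]].
by rewrite /mx_inverse_pair /= mulmxA -(mulmxA A) CD mulmx1 AB mulmxA -(mulmxA D) BA
  mulmx1 DC !eqxx.
Qed.

Lemma GL_inv_subproof (g : GL) : mx_inverse_pair ((GL_pair g).2, (GL_pair g).1).
Proof. by case: g => [[A B] i]; rewrite /mx_inverse_pair /= andbC. Qed.

Definition GL_one := MkGL GL_one_subproof.
Definition GL_mul g h := MkGL (GL_mul_subproof g h).
Definition GL_inv g := MkGL (GL_inv_subproof g).

Lemma GL_mulA : associative GL_mul.
Proof. by move=> g h k; apply: val_inj; rewrite /= !mulmxA. Qed.

Lemma GL_1mul : left_id GL_one GL_mul.
Proof. by move=> g; apply: val_inj; rewrite /= mul1mx mulmx1; case: (GL_pair g). Qed.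

Lemma GL_mul1 : right_id GL_one GL_mul.
Proof. by move=> g; apply: val_inj; rewrite /= mul1mx mulmx1; case: (GL_pair g). Qed.

Lemma GL_Vmul : left_inverse GL_one GL_inv GL_mul.
Proof.
by case=> [[A B] i]; apply: val_inj => /=; case/andP: i => /= _ /eqP ->.
Qed.

Lemma GL_mulV : right_inverse GL_one GL_inv GL_mul.
Proof.
by case=> [[A B] i]; apply: val_inj => /=; case/andP: i => /= /eqP -> _.
Qed.

HB.instance Definition _ :=
  isGroup.Build GL GL_mulA GL_1mul GL_mul1 GL_Vmul GL_mulV.

Definition offdiag := {ij : 'I_n * 'I_n | ij.1 != ij.2}.

Definition elementary_mx (ij : offdiag) (r : R) : 'M[R]_n :=
  1%:M + r *: delta_mx (val ij).1 (val ij).2.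

Lemma elementary_mxN ij r : elementary_mx ij r *m elementary_mx ij (- r) = 1%:M.
Proof.
rewrite /elementary_mx mulmxDl mulmxDr !mulmx1 mul1mx -scalemxAl mulmxDr mulmx1.
suff -> : delta_mx (val ij).1 (val ij).2 *m
    (- r *: delta_mx (val ij).1 (val ij).2) = 0 :> 'M[R]_n.
  by rewrite addr0 -addrA scaleNr addNr addr0.
apply/matrixP => a b; rewrite !mxE big1 // => k _; rewrite !mxE.
case: eqP => [_|_]; last by rewrite mul0r.
case: eqP => [->|_]; last by rewrite mul0r.
by rewrite eq_sym (negPf (valP ij)) /= mulr0 mulr0.
Qed.

Lemma elementary_subproof ij r :
  mx_inverse_pair (elementary_mx ij r, elementary_mx ij (- r)).
Proof. by rewrite /mx_inverse_pair /= elementary_mxN -{2}(opprK r) elementary_mxN eqxx. Qed.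

Definition elementary_GL ij r : GL := MkGL (elementary_subproof ij r).

Definition elementary_set : set GL :=
  [set g | exists ij r, g = elementary_GL ij r].

Definition elementary_group := generated_group elementary_set.

HB.instance Definition _ := Group.on elementary_group.

Lemma elementary_in ij r : elementary_GL ij r \in generated_pred elementary_set.
Proof. by apply: sub_generated; exists ij, r. Qed.

Definition elementary ij r : elementary_group := GeneratedGroup (elementary_in ij r).

Definition E_mx (g : elementary_group) : 'M[R]_n := GL_mx (val g).

Lemma E_mx1 : E_mx 1%g = 1%:M.
Proof. by []. Qed.

Lemma E_mxM (g h : elementary_group) : E_mx (g * h)%g = E_mx g *m E_mx h.
Proof. by []. Qed.

End GeneralLinear.

Section Semidirect.
Variables (R : nzRingType) (m : nat).

Record ERm := MkERm { ERm_pair : elementary_group R m * 'cV[R]_m }.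

HB.instance Definition _ := [isNew for ERm_pair].
HB.instance Definition _ := [Choice of ERm by <:].

Definition ERm_lin (x : ERm) : elementary_group R m := (ERm_pair x).1.
Definition ERm_vec (x : ERm) : 'cV[R]_m := (ERm_pair x).2.

Definition ERm_one := MkERm (1%g, 0).
Definition ERm_mul (x y : ERm) :=
  MkERm ((ERm_lin x * ERm_lin y)%g, ERm_vec x + E_mx (ERm_lin x) *m ERm_vec y).
Definition ERm_inv (x : ERm) :=
  MkERm ((ERm_lin x)^-1%g, - (E_mx (ERm_lin x)^-1%g *m ERm_vec x)).

Lemma ERm_mulA : associative ERm_mul.
Proof.
move=> x y z; apply: val_inj; rewrite /ERm_lin /ERm_vec /=.
by rewrite mulgA E_mxM mulmxDr -mulmxA addrA.
Qed.

Lemma ERm_1mul : left_id ERm_one ERm_mul.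
Proof.
case=> [[g v]]; apply: val_inj; rewrite /ERm_lin /ERm_vec /=.
by rewrite mul1g E_mx1 mul1mx add0r.
Qed.

Lemma ERm_mul1 : right_id ERm_one ERm_mul.
Proof.
case=> [[g v]]; apply: val_inj; rewrite /ERm_lin /ERm_vec /=.
by rewrite mulg1 mulmx0 addr0.
Qed.

Lemma ERm_Vmul : left_inverse ERm_one ERm_inv ERm_mul.
Proof.
case=> [[g v]]; apply: val_inj; rewrite /ERm_lin /ERm_vec /=.
by rewrite mulVg addNr.
Qed.

Lemma ERm_mulV : right_inverse ERm_one ERm_inv ERm_mul.
Proof.
case=> [[g v]]; apply: val_inj; rewrite /ERm_lin /ERm_vec /=.
by rewrite mulgV mulmxN mulmxA -E_mxM mulgV E_mx1 mul1mx subrr.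
Qed.

HB.instance Definition _ :=
  isGroup.Build ERm ERm_mulA ERm_1mul ERm_mul1 ERm_Vmul ERm_mulV.

Definition Rm_subgroup : set ERm := [set x | ERm_lin x = 1%g].

Lemma Rm_subgroup_normal : normal_subgroup Rm_subgroup.
Proof.
split; first split=> //.
  move=> x y; rewrite /Rm_subgroup /= => x1 y1.
  by rewrite [LHS](_ : _ = ERm_lin x * (ERm_lin y)^-1)%g // x1 y1 mulgV.
move=> x y; rewrite /Rm_subgroup /= => y1.
by rewrite [LHS](_ : _ = ERm_lin x * ERm_lin y * (ERm_lin x)^-1)%g // y1 mulg1 mulgV.
Qed.

(* [ts] lists t_1, ..., t_k; t_0 = 1 is added here. *)
Definition signed_generators (ts : seq R) : seq R :=
  flatten [seq [:: t; - t] | t <- 1 :: ts].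

Definition standard_subset (ts : seq R) : seq ERm :=
  [seq MkERm (elementary ij r, 0)
    | ij <- enum {: offdiag m}, r <- signed_generators ts] ++
  [seq MkERm (1%g, r *: delta_mx i 0)
    | i <- enum 'I_m, r <- signed_generators ts].

End Semidirect.

Arguments Rm_subgroup : clear implicits.

Definition free_alg (k : nzRingType) (n : nat) : nzRingType :=
  malg (fmonom 'I_n) k.

Definition free_var (k : nzRingType) (n : nat) (i : 'I_n) : free_alg k n :=
  mkmalgU (fmu i) 1.

Definition free_vars (k : nzRingType) (n : nat) : seq (free_alg k n) :=
  [seq free_var k i | i <- enum 'I_n].

Lemma inj_countable (T : Type) (c : T -> nat) :
  injective c -> countable [set: T].
Proof. by move=> c_inj; apply/pcard_injP; exists c => x y _ _; exact: c_inj. Qed.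

Lemma countable_inj (T : Type) :
  countable [set: T] -> exists c : T -> nat, injective c.
Proof.
move=> /pcard_injP[c c_inj]; exists c => x y; apply: c_inj; exact: in_setT.
Qed.

Lemma free_alg_countable (k : nzRingType) (n : nat) :
  countable [set: k] -> countable [set: free_alg k n].
Proof.
move=> /countable_inj[c c_inj].
pose term (x : free_alg k n) (m : fmonom 'I_n) : seq 'I_n * nat :=
  (fmonom_val m, c (mcoeff m x)).
pose code x := choice.pickle [seq term x m | m <- finmap.enum_fset (msupp x)].
have sub x y : code x = code y -> forall m,
    m \in msupp x -> m \in msupp y /\ mcoeff m x = mcoeff m y.
  move=> /(pcan_inj choice.pickleK) xy m mx.
  have : term x m \in [seq term x m | m <- finmap.enum_fset (msupp x)].
    exact: map_f.
  rewrite xy => /mapP[m' m'y [/val_inj mm']]; rewrite -mm' in m'y * => /c_inj ->.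
  by split.
apply: (@inj_countable _ code) => x y xy; apply/malgP => m.
have [mx|mx] := boolP (m \in msupp x); first by have [] := sub x y xy m mx.
have [my|my] := boolP (m \in msupp y); first by have [] := sub y x (esym xy) m my.
by rewrite !mcoeff_outdom.
Qed.

Lemma ERm_countable (R : nzRingType) (m : nat) :
  countable [set: R] -> countable [set: ERm R m].
Proof.
move=> /countable_inj[c c_inj].
pose cmx p q (A : 'M[R]_(p, q)) := map_mx c A.
have cmx_inj p q : injective (@cmx p q).
  by move=> A B /matrixP AB; apply/matrixP => i j; have := AB i j; rewrite !mxE => /c_inj.
pose code (x : ERm R m) :=
  (cmx _ _ (GL_pair (val (ERm_lin x))).1, cmx _ _ (GL_pair (val (ERm_lin x))).2,
   cmx _ _ (ERm_vec x)).
apply: (@inj_countable _ (choice.pickle \o code)) => -[[g v]] [[h w]] /=.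
move=> /(pcan_inj choice.pickleK)[/cmx_inj gh1 /cmx_inj gh2 /cmx_inj vw].
congr (MkERm (_, _)) => //; apply: val_inj; apply: val_inj => /=.
by rewrite [LHS]surjective_pairing [RHS]surjective_pairing; congr pair.
Qed.

Section Banach.
Variable R : realType.

Definition banach_class := completeNormedModType R -> Prop.

Definition uniformly_convex : banach_class := fun B =>
  exists delta : R -> R,
    (forall t, 0 < t <= 2 -> 0 < delta t) /\
    forall x y : B, x <> y -> `|x| = 1 -> `|y| = 1 ->
      delta `|x - y| <= 1 - `|x + y| / 2.

Record isometric_representation (G : groupType) (B : completeNormedModType R)
    (rho : G -> B -> B) : Prop := {
  rep_linear : forall g, linear (rho g);
  rep_isometry : forall g x, `|rho g x| = `|x|;
  rep_surjective : forall g, range (rho g) = setT;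
  rep_mul : forall g h x, rho (g * h)%g x = rho g (rho h x) }.

Record isometric_action (G : groupType) (B : completeNormedModType R)
    (a : G -> B -> B) : Prop := {
  action_isometry : forall g x y, `|a g x - a g y| = `|x - y|;
  action_one : forall x, a 1%g x = x;
  action_mul : forall g h x, a (g * h)%g x = a g (a h x) }.

Definition fixed_vectors (G : groupType) (B : completeNormedModType R)
  (rho : G -> B -> B) (M : set G) : set B :=
  [set x | forall g, M g -> rho g x = x].

(* The infimum runs over the representatives of the class of [x] modulo [F]. *)
Definition norm_in_quotient (B : completeNormedModType R) (F : set B) (x : B) : R :=
  inf [set `|y| | y in [set y | F (y - x)]].

Definition relative_T (C : banach_class) (L : groupType) (M : set L)
    (K : seq L) : Prop :=
  forall B : completeNormedModType R, C B ->
  forall rho : L -> B -> B, isometric_representation rho ->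
  exists eps : R, 0 < eps /\
    forall x : B, eps * norm_in_quotient (fixed_vectors rho M) x <=
      \big[Num.max/0]_(s <- K) `|rho s x - x|.

Definition property_F (C : banach_class) (G : groupType) : Prop :=
  finitely_generated G /\
  forall B : completeNormedModType R, C B ->
  forall a : G -> B -> B, isometric_action a ->
  exists x : B, forall g, a g x = x.

End Banach.

Arguments uniformly_convex : clear implicits.

(* An edge [e] is the ordered pair of its origin [e.1] and its target [e.2]. *)
Record digraph := Digraph { vertex : finType; edges : {set vertex * vertex} }.

Definition degree (D : digraph) (v : vertex D) : nat :=
  #|[set e in edges D | (e.1 == v) || (e.2 == v)]|%SET.

Definition Cayley (gT : finGroupType) (S : {set gT}) : digraph :=
  @Digraph gT [set (h, (h * t)%g) | h in [set: gT], t in S]%SET.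

Section SuperExpanders.
Variable R : realType.

Section Gap.
Variables (D : digraph) (X : Type) (dist : X -> X -> R).

Definition poincare_ratio (f : vertex D -> X) : R :=
  (#|vertex D|%:R ^+ 2 * \sum_(e in edges D) dist (f e.2) (f e.1) ^+ 2) /
  (#|edges D|%:R *
     \sum_(vw : vertex D * vertex D) dist (f vw.1) (f vw.2) ^+ 2).

(* Valued in the extended reals, so that the infimum is +oo when there is no
   non-constant map, e.g. when X is a point. *)
Definition spectral_gap : \bar R :=
  ((2^-1)%:E * ereal_inf
    [set (poincare_ratio f)%:E | f in [set f | exists v w, f v <> f w]])%E.

End Gap.

Definition super_expanders (D : nat -> digraph) : Prop :=
  [/\ exists d : nat, forall n (v : vertex (D n)), (degree v <= d)%N,
      #|vertex (D n)| @[n --> \oo] --> \oo &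
      forall X : completeNormedModType R, uniformly_convex R X ->
        (0 < ereal_inf (range (fun n =>
               spectral_gap (D n) (fun x y : X => (`|x - y|)%R))))%E].

Definition can_form_super_expanders (G : nat -> finGroupType) : Prop :=
  exists S : forall n, {set G n},
    (forall n, <<S n>>%g = [set: G n]%SET) /\
    super_expanders (fun n => Cayley (S n)).

End SuperExpanders.

Section SpecialLinear.
Variables (n : nat) (F : finFieldType).

(* As for the library's ['GL_n[F]], the value is meaningful for n > 0. *)
Definition SL_set : {set {'GL_n[F]}} := [set g | \det (GLval g) == 1]%SET.

Lemma SL_group_set : group_set SL_set.
Proof.
apply/group_setP; split=> [|g h]; first by rewrite inE det1.
by rewrite !inE => /eqP g1 /eqP h1; rewrite det_mulmx g1 h1 mulr1.
Qed.

Definition SL : {group {'GL_n[F]}} := Group SL_group_set.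

End SpecialLinear.

(* Main.v *)
Require Import Defs.
From HB Require Import structures.
From mathcomp Require Import all_boot all_order all_algebra all_fingroup.
From mathcomp Require Import all_classical all_reals all_analysis.
From mathcomp Require Import -(notations) finmap monalg.
From mathcomp Require Import zify lra ring.

(** Both parts follow from one chain of implications, for a ring [A] generated by
    [1] and the given variables.

    Write [e i j r] for the elementary matrices, [rho] for the linear part of an
    isometric action on a uniformly convex space (such an action is affine, since
    balls are strictly convex), and [b g = g 0] for its cocycle.

    First, relative property (T) makes [b] bounded on each root subgroup. The
    element [e l j r] commutes with a copy of E(2,A) acting on the coordinates [i],
    [k] and with the copy of A^2 in the column [j], because there is a fourth index
    [l]. So its cocycle value is moved by the standard subset by an amount
    independent of [r], and the spectral gap puts this value at a bounded distance
    from the vectors fixed by A^2. The commutator relations then force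
    [3 |b (e i j r)| <= 2 |b (e k j r)| + c], and symmetrically in [i] and [k],
    hence a bound ([cocycle_bounded]).

    Second, bounded root subgroups give a global fixed point, although the group
    need not be a bounded product of them ([bounded_root_subgroups_fixed_point]).
    The column and the row of root subgroups through an index [o] have bounded
    orbits, hence fixed points. Consider pairs [(xi, eta)] of a point fixed by the
    column and one fixed by the row; a pair at distance 0 is a global fixed point.
    If there is none, a completeness argument produces a pair whose distance is
    nearly minimal among the pairs in a large ball around it. Elements away from
    [o], and up to a small error the transposition of [o] with another index,
    turn such a pair into another one; averaging the two pairs and using uniform
    convexity shows that the first elements almost fix [v = xi - eta] and that the
    transposition almost negates it. Together they generate the row, so the row
    almost fixes [xi], and a nearby point fixed by the row contradicts the choice
    of the pair. All the errors are uniform in the coefficients of the elementary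
    matrices, as the fixed points of infinite groups require.

    Third, property (F) on the space of square summable functions with values in
    [X], which is uniformly convex when [X] is, gives a spectral gap uniform over
    all the finite quotients of E(4,A) ([property_F_uniform_gap]): otherwise badly
    behaved functions on a sequence of quotients add up to an unbounded cocycle.

    Finally, the matrix ring of size [m] over F_p is a quotient of the free algebra
    on two variables, so SL(4m,F_p) is a quotient of E(4,A). For [n = 4m + d] with
    [d <= 3], SL(n,F_p) is a product of at most 5^d of the subgroups SL(4m,F_p)
    acting on some [4m] of the coordinates, taken from a list of at most 3^d of
    them. Averaging displacements over the group turns the uniform gap into the
    Poincare inequality for the Cayley graph whose generators are the images of the
    generators of E(4,A) ([covered_super_expanders]). *)

Set Implicit Arguments.
Unset Strict Implicit.
Unset Printing Implicit Defensive.

Import Order.TTheory GRing.Theory Num.Theory.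
Import numFieldNormedType.Exports.

Local Open Scope classical_set_scope.
Local Open Scope ring_scope.

(** * Linear identities in modules *)

Section LinearIdentities.
Variables (R : realFieldType) (V : lmodType R).

Inductive lin_expr :=
  | LinVar of nat
  | LinZero
  | LinAdd of lin_expr & lin_expr
  | LinOpp of lin_expr
  | LinScale of R & lin_expr.

Fixpoint lin_eval (env : seq V) (e : lin_expr) : V :=
  match e with
  | LinVar n => nth 0 env n
  | LinZero => 0
  | LinAdd a b => lin_eval env a + lin_eval env b
  | LinOpp a => - lin_eval env a
  | LinScale c a => c *: lin_eval env a
  end.

Fixpoint lin_coef (n : nat) (e : lin_expr) : R :=
  match e with
  | LinVar m => if PeanoNat.Nat.eqb m n then 1 else 0
  | LinZero => 0
  | LinAdd a b => lin_coef n a + lin_coef n b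
  | LinOpp a => - lin_coef n a
  | LinScale c a => c * lin_coef n a
  end.

Fixpoint lin_vars_below (k : nat) (e : lin_expr) : bool :=
  match e with
  | LinVar m => (m < k)%N
  | LinZero => true
  | LinAdd a b => lin_vars_below k a && lin_vars_below k b
  | LinOpp a | LinScale _ a => lin_vars_below k a
  end.

Lemma lin_evalE env e : lin_vars_below (size env) e ->
  lin_eval env e = \sum_(i < size env) lin_coef i e *: nth 0 env i.
Proof.
elim: e => [m mk||a IHa b IHb /andP[/IHa /= -> /IHb /= ->]|a IHa /IHa /= ->
  |c a IHa /IHa /= ->] /=.
- rewrite (bigD1 (Ordinal mk)) //= PeanoNat.Nat.eqb_refl scale1r big1 ?addr0 // => i im.
  case: (PeanoNat.Nat.eqb_spec m i) => [mi|_]; last by rewrite scale0r.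
  by case/eqP: im; exact: val_inj.
- by rewrite big1 // => i _; rewrite scale0r.
- by rewrite -big_split /=; apply: eq_bigr => i _; rewrite scalerDl.
- by rewrite -sumrN; apply: eq_bigr => i _; rewrite scaleNr.
- by rewrite scaler_sumr; apply: eq_bigr => i _; rewrite scalerA.
Qed.

Fixpoint lin_coef_eq (k : nat) (a b : lin_expr) : Prop :=
  if k is k'.+1 then lin_coef k' a = lin_coef k' b /\ lin_coef_eq k' a b else True.

Lemma lin_identity env a b :
  lin_vars_below (size env) a && lin_vars_below (size env) b ->
  lin_coef_eq (size env) a b -> lin_eval env a = lin_eval env b.
Proof.
move=> /andP[ak bk] ab; rewrite !lin_evalE //; apply: eq_bigr => i _.
congr (_ *: _); move: (size env) (i : nat) (ltn_ord i) ab.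
elim=> [//|k IH] j; rewrite ltnS leq_eqVlt => /orP[/eqP -> []//|jk [_ ab]].
exact: IH.
Qed.
End LinearIdentities.

Ltac lin_index x env :=
  lazymatch env with
  | x :: _ => constr:(O)
  | _ :: ?env' => let n := lin_index x env' in constr:(S n)
  end.

Ltac lin_mem x env :=
  lazymatch env with
  | x :: _ => constr:(true)
  | _ :: ?env' => lin_mem x env'
  | _ => constr:(false)
  end.

Ltac lin_atoms t env :=
  lazymatch t with
  | (?a + ?b)%R => let env' := lin_atoms a env in lin_atoms b env'
  | (- ?a)%R => lin_atoms a env
  | (_ *: ?a)%R => lin_atoms a env
  | 0%R => env
  | _ => lazymatch lin_mem t env with
         | true => env
         | false => constr:(t :: env)
         end
  end.

Ltac lin_reify R t env :=
  lazymatch t with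
  | (?a + ?b)%R =>
      let a' := lin_reify R a env in let b' := lin_reify R b env in
      constr:(@LinAdd R a' b')
  | (- ?a)%R => let a' := lin_reify R a env in constr:(@LinOpp R a')
  | (?c *: ?a)%R => let a' := lin_reify R a env in constr:(@LinScale R c a')
  | 0%R => constr:(@LinZero R)
  | _ => let n := lin_index t env in constr:(@LinVar R n)
  end.

(** Decision procedure for identities between vectors: the two sides are reified as
    linear combinations of atoms, and the coefficients of each atom are compared. *)
Ltac linear_identity R V :=
  lazymatch goal with
  | |- ?a = ?b =>
      let env0 := constr:(@nil V) in
      let env1 := lin_atoms a env0 in
      let env := lin_atoms b env1 in
      let a' := lin_reify R a env in
      let b' := lin_reify R b env in
      apply: (@lin_identity R V env a' b'); [by [] | rewrite /=; repeat split; try (by field); try lra]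
  end.

(** * Uniform convexity *)

Section UniformConvexity.
Variables (R : realType) (B : completeNormedModType R).
Implicit Types x y z : B.

Lemma dist_normalize x : x != 0 -> `| `|x|^-1 *: x - x | = `| 1 - `|x| |.
Proof.
move=> x0; rewrite -{3}[x]scale1r -scalerBl normrZ -{2}[`|x|]normr_id -normrM.
by rewrite mulrBl mul1r mulVf // normr_eq0.
Qed.

Lemma normalize_unit x : x != 0 -> `| `|x|^-1 *: x | = 1.
Proof. by move=> x0; rewrite normrZ normfV normr_id mulVf // normr_eq0. Qed.

(** The modulus [delta] need not be monotone, so it only controls pairs at the exact
    distance [delta] is applied to. A pair at distance at least [e] is moved to
    distance exactly [e] along the arc from [x] to [y], by the intermediate value
    theorem; if the midpoint of [x] and [y] is near the sphere, so are all the points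
    of the segment, and the arc stays close to it. *)
Lemma uniformly_convex_sphere (e : R) : uniformly_convex R B -> 0 < e ->
  exists k : R, 0 < k /\ forall x y, `|x| = 1 -> `|y| = 1 -> e <= `|x - y| ->
    `|x + y| <= 2 * (1 - k).
Proof.
move=> [delta [delta_gt0 deltaP]] e0.
have [e2|e2] := leP e 2; last first.
  exists 1; split=> // x y x1 y1 exy; exfalso.
  by have := le_trans exy (ler_normB _ _); rewrite x1 y1; lra.
have d0 : 0 < delta e by apply: delta_gt0; rewrite e0.
set k := Num.min (delta e / 4) (1 / 4).
have k0 : 0 < k by rewrite lt_min; apply/andP; split; lra.
have kd : k <= delta e / 4 by rewrite ge_min lexx.
have k1 : k <= 1 / 4 by rewrite ge_min lexx orbT.
exists k; split=> // x y x1 y1 exy; rewrite leNgt; apply/negP => xy.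
pose z (t : R) := (1 - t) *: x + t *: y.
have z_le1 t : 0 <= t <= 1 -> `|z t| <= 1.
  move=> /andP[t0 t1]; apply: le_trans (ler_normD _ _) _.
  by rewrite !normrZ x1 y1 !ger0_norm ?subr_ge0 //; lra.
have z_ge t : 0 <= t <= 1 -> 1 - 2 * k <= `|z t|.
  move=> t01; have xyE : x + y = z t + z (1 - t).
    by rewrite /z; linear_identity R B.
  have := ler_normD (z t) (z (1 - t)); rewrite -xyE.
  have : `|z (1 - t)| <= 1 by apply: z_le1; lra.
  lra.
have z_neq0 t : 0 <= t <= 1 -> z t != 0.
  by move=> t01; rewrite -normr_gt0; have := z_ge t t01; lra.
pose f (t : R) : R := `|x - `|z t|^-1 *: z t|.
have fc : {within `[0, 1], continuous f}.
  apply: continuous_in_subspaceT => t /set_mem; rewrite /= in_itv /= => t01.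
  have zc : z u @[u --> t] --> z t.
    by apply: cvgD; apply: cvgZr_tmp; [apply: cvgB; [exact: cvg_cst|] |]; exact: cvg_id.
  apply: cvg_norm; apply: cvgB; first exact: cvg_cst.
  apply: cvgZ => //; apply: cvgV; last exact: cvg_norm.
  by rewrite normr_eq0 z_neq0.
have f0 : f 0 = 0.
  by rewrite /f /z subr0 scale1r scale0r addr0 x1 invr1 scale1r subrr normr0.
have f1 : f 1 = `|x - y|.
  by rewrite /f /z subrr scale1r scale0r add0r y1 invr1 scale1r.
have [|t] := @IVT _ f 0 1 e ler01 fc.
  by rewrite f0 f1 ge_min le_max exy (ltW e0) orbT.
rewrite in_itv /= => t01 fte; set y' := `|z t|^-1 *: z t in fte.
have y'1 : `|y'| = 1 by apply: normalize_unit; exact: z_neq0.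
have xy' : x <> y'.
  by move=> E; move: fte; rewrite /f -/y' -E subrr normr0; lra.
have := deltaP x y' xy' x1 y'1; rewrite -/(f t) fte.
have y'z : `|y' - z t| <= 2 * k.
  rewrite dist_normalize ?z_neq0 // ger0_norm ?subr_ge0 ?z_le1 //.
  by have := z_ge t t01; lra.
have xz : 2 * (1 - 2 * k) <= `|x + z t|.
  have -> : x + z t = 2 *: z (t / 2).
    by rewrite /z; linear_identity R B.
  rewrite normrZ ger0_norm // ler_pM2l //; apply: z_ge; lra.
have : `|x + z t| <= `|x + y'| + `|y' - z t|.
  have -> : x + z t = (x + y') - (y' - z t) by rewrite /z; linear_identity R B.
  exact: ler_normB.
lra.
Qed.

Lemma uniformly_convex_unit_ball (e : R) : uniformly_convex R B -> 0 < e ->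
  exists k : R, 0 < k /\ forall x y, `|x| <= 1 -> `|y| <= 1 -> e <= `|x - y| ->
    `|x + y| <= 2 * (1 - k).
Proof.
move=> Buc e0; have e20 : 0 < e / 2 by lra.
have [k0 [k00 k0P]] := uniformly_convex_sphere Buc e20.
set a := Num.min (Num.min (e / 4) (k0 / 2)) (1 / 2).
have a0 : 0 < a by rewrite !lt_min; apply/andP; split; [apply/andP; split|]; lra.
have ae : a <= e / 4 by rewrite !ge_min lexx.
have ak : a <= k0 / 2 by rewrite !ge_min lexx orbT.
have a1 : a <= 1 / 2 by rewrite ge_min lexx orbT.
exists (a / 2); split=> [|x y x1 y1 exy]; first by lra.
have [xa|xa] := leP `|x| (1 - a); first by have := ler_normD x y; lra.
have [ya|ya] := leP `|y| (1 - a); first by have := ler_normD x y; lra.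
have x_neq0 : x != 0 by rewrite -normr_gt0; lra.
have y_neq0 : y != 0 by rewrite -normr_gt0; lra.
have xx' := dist_normalize x_neq0; have yy' := dist_normalize y_neq0.
have x'1 := normalize_unit x_neq0; have y'1 := normalize_unit y_neq0.
move: xx' yy' x'1 y'1; set x' := _ *: x; set y' := _ *: y => xx' yy' x'1 y'1.
rewrite ger0_norm ?subr_ge0 // in xx'; rewrite ger0_norm ?subr_ge0 // in yy'.
have sub_le : `|x - y| <= `|x' - y'| + `|x' - x| + `|y' - y|.
  have -> : x - y = (x' - y') - (x' - x) + (y' - y).
    by linear_identity R B.
  by apply: le_trans (ler_normD _ _) _; rewrite lerD2r ler_normB.
have add_le : `|x + y| <= `|x' + y'| + `|x' - x| + `|y' - y|.
  have -> : x + y = (x' + y') - (x' - x) - (y' - y).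
    by linear_identity R B.
  by apply: le_trans (ler_normB _ _) _; rewrite lerD2r ler_normB.
have := k0P x' y' x'1 y'1; lra.
Qed.

Lemma uniformly_convex_ball (e : R) : uniformly_convex R B -> 0 < e ->
  exists k : R, 0 < k /\ forall (D : R) x y, `|x| <= D -> `|y| <= D ->
    e * D <= `|x - y| -> `|x + y| <= 2 * (1 - k) * D.
Proof.
move=> Buc e0; have [k [k0 kP]] := uniformly_convex_unit_ball Buc e0.
exists k; split=> // D x y xD yD exy.
have [D0|D0] := leP D 0.
  have x0 : `|x| = 0 by apply/eqP; rewrite eq_le normr_ge0 (le_trans xD).
  have y0 : `|y| = 0 by apply/eqP; rewrite eq_le normr_ge0 (le_trans yD).
  have D0' : D = 0 by apply/eqP; rewrite eq_le D0 -x0.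
  by apply: le_trans (ler_normD _ _) _; rewrite x0 y0 D0'; lra.
have DV0 : 0 <= D^-1 by rewrite invr_ge0 ltW.
have := kP (D^-1 *: x) (D^-1 *: y).
rewrite -scalerBr -scalerDr !normrZ ger0_norm // ![D^-1 * _]mulrC.
by rewrite !ler_pdivrMr // !ler_pdivlMr // !mul1r; exact.
Qed.

End UniformConvexity.

(** * Isometric actions on uniformly convex spaces *)

Section ContractionLimit.
Variables (R : realType) (B : completeNormedModType R).

(** The completeness argument behind both kinds of fixed points below: defects decay
    geometrically along a sequence of improvements, and so do the steps between the
    positions, which they control. *)
Lemma contraction_limit (S : Type) (pos : S -> B) (defect : S -> R) (q C : R) :
  0 <= q -> q < 1 -> 0 <= C -> (forall s, 0 <= defect s) ->
  (forall s, exists s', defect s' <= q * defect s /\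
                        `|pos s' - pos s| <= C * defect s) ->
  forall s0, exists z, `|z - pos s0| <= C / (1 - q) * defect s0 /\
    forall e, 0 < e -> exists s, defect s <= e /\ `|pos s - z| <= e.
Proof.
move=> q0 q1 C0 defect0 step s0.
have [next nextP] := choice step.
pose s_ n := iter n next s0.
have q10 : 0 < 1 - q by rewrite subr_gt0.
have CqE : C / (1 - q) * q + C = C / (1 - q).
  by field; rewrite gt_eqF.
have Cq0 : 0 <= C / (1 - q) by rewrite divr_ge0 // ltW.
have iter_dist k s : `|pos (iter k next s) - pos s| <= C / (1 - q) * defect s.
  elim: k s => [|k IH] s; first by rewrite subrr normr0 mulr_ge0.
  rewrite iterSr; apply: le_trans (ler_distD (pos (next s)) _ _) _.
  have [dn pn] := nextP s; rewrite -CqE mulrDl; apply: lerD pn.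
  apply: le_trans (IH _) _; by rewrite -[leRHS]mulrA ler_wpM2l.
have defect_s n : defect (s_ n) <= q ^+ n * defect s0.
  elim: n => [|n IH]; first by rewrite expr0 mul1r.
  by have [dn _] := nextP (s_ n); rewrite (le_trans dn) // exprS -mulrA ler_wpM2l.
have dist_s n k : (n <= k)%N ->
    `|pos (s_ k) - pos (s_ n)| <= C / (1 - q) * (q ^+ n * defect s0).
  move=> /subnKC <-; rewrite {1}/s_ addnC iterD.
  by apply: le_trans (iter_dist _ _) _; apply: ler_wpM2l => //; exact: defect_s.
have small e : 0 < e -> exists n, q ^+ n * defect s0 <= e /\
    C / (1 - q) * (q ^+ n * defect s0) <= e.
  move=> e0; set c := Num.max 1 (C / (1 - q)).
  have c1 : 1 <= c by rewrite le_max lexx.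
  have cC : C / (1 - q) <= c by rewrite le_max lexx orbT.
  have cd0 : 0 < c * (defect s0 + 1) by rewrite mulr_gt0 ?ltr_wpDl // (lt_le_trans _ c1).
  have : (fun n => q ^+ n) @ \oo --> (0 : R) by apply: cvg_expr; rewrite ger0_norm.
  move=> /cvgrPdist_le /(_ (e / (c * (defect s0 + 1)))) [|N _ /(_ N (leqnn N)) /=].
    by rewrite divr_gt0.
  rewrite sub0r normrN ger0_norm ?exprn_ge0 // ler_pdivlMr // => qN.
  have qd0 : 0 <= q ^+ N * defect s0 by rewrite mulr_ge0 ?exprn_ge0.
  have le_e : c * (q ^+ N * defect s0) <= e.
    apply: le_trans qN; rewrite mulrCA ler_wpM2l ?exprn_ge0 // ler_wpM2l ?lerDl //.
    exact: le_trans c1.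
  exists N; split; first by apply: le_trans le_e; rewrite ler_peMl.
  by apply: le_trans le_e; rewrite ler_wpM2r.
have cvgs : cvg (pos (s_ n) @[n --> \oo]).
  apply: cauchy_cvg; apply: cauchy_exP => e e0.
  have [|n [_ nle]] := small (e / 2); first by lra.
  exists (pos (s_ n)); exists n => // k /= nk.
  rewrite -ball_normE /ball_ /= distrC.
  by apply: le_lt_trans (dist_s _ _ nk) _; lra.
move: cvgs => /cvg_ex[z sz]; exists z.
have near_z n : `|z - pos (s_ n)| <= C / (1 - q) * (q ^+ n * defect s0).
  apply/ler_addgt0Pr => e e0.
  have [N _ NP] := (cvgrPdist_le _ _).1 sz e e0.
  have := NP (maxn N n) (leq_maxl _ _); have := dist_s n _ (leq_maxr N n).
  set m := maxn N n => sm /= zm.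
  by apply: le_trans (ler_distD (pos (s_ m)) _ _) _; rewrite addrC lerD.
split; first by have := near_z 0%N; rewrite expr0 mul1r.
move=> e e0; have [n [n1 n2]] := small e e0.
exists (s_ n); split; first exact: le_trans (defect_s n) n1.
by rewrite distrC; exact: le_trans (near_z n) n2.
Qed.

End ContractionLimit.

Section IsometricActions.
Variables (R : realType) (B : completeNormedModType R).
Hypothesis Buc : uniformly_convex R B.

(** Balls being strictly convex, the midpoint of [x] and [y] is the only point at
    half their distance from both. *)
Lemma isometry_midpoint (f : B -> B) : (forall x y, `|f x - f y| = `|x - y|) ->
  forall x y, f (2^-1 *: (x + y)) = 2^-1 *: (f x + f y).
Proof.
move=> fiso x y; set m := 2^-1 *: (x + y).
set u := f x - f m; set v := f m - f y.
have half (w : B) : `|2^-1 *: w| = `|w| / 2 by rewrite normrZ ger0_norm // mulrC.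
have uD : `|u| = `|x - y| / 2.
  by rewrite /u fiso -half; congr (`| _ |); rewrite /m; linear_identity R B.
have vD : `|v| = `|x - y| / 2.
  by rewrite /v fiso -half; congr (`| _ |); rewrite /m; linear_identity R B.
have uvD : `|u + v| = `|x - y| by rewrite /u /v addrA subrK fiso.
have [uv|uv] := eqVneq u v.
  have -> : f x + f y = f m + f m + (u - v) by rewrite /u /v; linear_identity R B.
  by rewrite uv subrr addr0; linear_identity R B.
have uv0 : 0 < `|u - v| by rewrite normr_gt0 subr_eq0.
have D0 : 0 < `|x - y| / 2.
  by have := ler_normB u v; rewrite uD vD; lra.
have e0 : 0 < `|u - v| / (`|x - y| / 2) by rewrite divr_gt0.
have [k [k0 kP]] := uniformly_convex_ball Buc e0.
have uv_far : `|u - v| / (`|x - y| / 2) * (`|x - y| / 2) <= `|u - v|.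
  by rewrite divfK ?gt_eqF.
exfalso; have := kP (`|x - y| / 2) u v; rewrite uD vD lexx => /(_ isT isT uv_far).
rewrite uvD; nra.
Qed.

Lemma isometry_additive (f : B -> B) : (forall x y, `|f x - f y| = `|x - y|) ->
  f 0 = 0 -> {morph f : x y / x + y}.
Proof.
move=> fiso f0 x y; have half z : f (2^-1 *: z) = 2^-1 *: f z.
  by rewrite -[z in LHS]addr0 isometry_midpoint // f0 addr0.
by apply: (scalerI (a := 2^-1)); rewrite // -half isometry_midpoint.
Qed.

(** Additivity gives homogeneity for integers; comparing [n * c] with its integral
    part shows that the defect of homogeneity for [c] is at most [2|x|/n]. *)
Lemma isometry_linear (f : B -> B) : (forall x y, `|f x - f y| = `|x - y|) ->
  f 0 = 0 -> linear f.
Proof.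
move=> fiso f0; have fD := isometry_additive fiso f0.
have f_norm x : `|f x| = `|x| by rewrite -[in LHS](subr0 (f x)) -f0 fiso subr0.
have fN x : f (- x) = - f x by apply/eqP; rewrite -addr_eq0 -fD addNr f0.
have fMn n x : f (x *+ n) = f x *+ n.
  by elim: n => [|n IH]; [rewrite !mulr0n | rewrite !mulrS fD IH].
have fMz (m : int) x : f (x *~ m) = f x *~ m.
  by case: m => n; rewrite /intmul ?fN fMn.
move=> c x y; rewrite fD; congr (_ + _).
apply/eqP; rewrite -subr_eq0 -normr_le0; apply/ler_addgt0Pr => e e0.
rewrite add0r; set d := `|_|.
have [n n0 nd] : exists2 n : nat, (0 < n)%N & 2 * `|x| <= n%:R * e.
  exists (Num.truncn (2 * `|x| / e)).+1 => //.
  rewrite -ler_pdivrMr //; apply: ltW; exact: truncnS_gt.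
suff : n%:R * d <= 2 * `|x|.
  by move=> /le_trans /(_ nd); rewrite ler_pM2l // ltr0n.
set m := Num.floor (n%:R * c); set t := n%:R * c - m%:~R.
have t0 : 0 <= t by rewrite subr_ge0 floor_le_tmp.
have t1 : t <= 1 by rewrite lerBlDl ltW // -[1]/(1%:~R) -intrD floorD1_gt.
have -> : n%:R * d = `|n%:R *: (f (c *: x) - c *: f x)| by rewrite normrZ ger0_norm.
have -> : n%:R *: (f (c *: x) - c *: f x) = f (t *: x) - t *: f x.
  rewrite scalerBr scalerA scaler_nat -fMn -scaler_nat scalerA.
  have -> : n%:R * c = m%:~R + t by rewrite /t subrKC.
  by rewrite !scalerDl fD !scaler_int fMz opprD addrACA subrr add0r.
apply: le_trans (ler_normB _ _) _; rewrite normrZ !f_norm normrZ ger0_norm //.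
have := normr_ge0 x; nra.
Qed.

Section Action.
Variables (G : groupType) (a : G -> B -> B).
Hypothesis aP : isometric_action a.

Definition linear_part (g : G) (x : B) : B := a g x - a g 0.
Local Notation rho := linear_part.

Lemma action_midpoint g x y : a g (2^-1 *: (x + y)) = 2^-1 *: (a g x + a g y).
Proof. by apply: isometry_midpoint; exact: action_isometry. Qed.

Lemma linear_part_linear g : linear (rho g).
Proof.
apply: isometry_linear; last by rewrite /rho subrr.
by move=> x y; rewrite /rho opprB addrA subrK (action_isometry aP).
Qed.

Lemma linear_partD g : {morph rho g : x y / x + y}.
Proof. by move=> x y; have := linear_part_linear g 1 x y; rewrite !scale1r. Qed.

Lemma linear_part0 g : rho g 0 = 0.
Proof. by rewrite /rho subrr. Qed.

Lemma linear_partN g : {morph rho g : x / - x}.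
Proof.
by move=> x; apply/eqP; rewrite -addr_eq0 -linear_partD addNr linear_part0.
Qed.

Lemma linear_partB g : {morph rho g : x y / x - y}.
Proof. by move=> x y; rewrite linear_partD linear_partN. Qed.

Lemma action_sub g x y : a g x - a g y = rho g (x - y).
Proof. by rewrite linear_partB /rho opprB addrA subrK. Qed.

Lemma linear_part_norm g x : `|rho g x| = `|x|.
Proof. by rewrite /rho (action_isometry aP) subr0. Qed.

Lemma linear_partM g h x : rho (g * h)%g x = rho g (rho h x).
Proof. by rewrite -action_sub -!(action_mul aP). Qed.

Lemma linear_part1 x : rho 1%g x = x.
Proof. by rewrite /rho !(action_one aP) subr0. Qed.

Lemma linear_part_rep : isometric_representation rho.
Proof.
split; [exact: linear_part_linear | exact: linear_part_norm | | exact: linear_partM].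
move=> g; apply/seteqP; split=> // y _; exists (rho g^-1%g y) => //.
by rewrite -linear_partM mulgV linear_part1.
Qed.

Lemma action_dist_mul g h x : `|a (g * h)%g x - x| <= `|a g x - x| + `|a h x - x|.
Proof.
rewrite (action_mul aP); apply: le_trans (ler_distD (a g x) _ _) _.
by rewrite (action_isometry aP) addrC.
Qed.

Lemma action_dist_inv g x : `|a g^-1%g x - x| = `|a g x - x|.
Proof.
rewrite -(action_isometry aP g) -(action_mul aP) mulgV (action_one aP).
exact: distrC.
Qed.

End Action.

(** If the orbit of [x] has diameter at most [d] and [h] moves [x] by more than
    [d/2], then by uniform convexity the midpoint of [x] and [h x] has an orbit of
    diameter at most [(1 - k) d]. Iterating converges to a fixed point. *)
Lemma bounded_orbit_fixed_point : exists2 C : R, 0 < C &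
  forall (G : groupType) (a : G -> B -> B), isometric_action a ->
  forall H : set G, (forall g h, H g -> H h -> H (g * h)%g) ->
    (forall g, H g -> H g^-1%g) ->
  forall x d, (forall h, H h -> `|a h x - x| <= d) -> 0 <= d ->
  exists y, (forall h, H h -> a h y = y) /\ `|y - x| <= C * d.
Proof.
have h20 : 0 < (1 / 2 : R) by lra.
have [k [k0 kP]] := uniformly_convex_ball Buc h20.
set q := Num.max (1 / 2) (1 - k).
have q0 : 0 <= q by rewrite le_max; apply/orP; left; lra.
have q1 : q < 1 by rewrite gt_max; apply/andP; split; lra.
have q10 : 0 < 1 - q by rewrite subr_gt0.
have qh : 1 / 2 <= q by rewrite le_max lexx.
have qk : 1 - k <= q by rewrite le_max lexx orbT.
exists (1 / (1 - q)) => [|G a aP H HM HV x d xd d0]; first exact: divr_gt0.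
pose S := {xd : B * R | 0 <= xd.2 /\ forall h, H h -> `|a h xd.1 - xd.1| <= xd.2}.
pose s0 : S := exist _ (x, d) (conj d0 xd).
have half (w : B) : `|2^-1 *: w| = `|w| / 2 by rewrite normrZ ger0_norm // mulrC.
have [] // := @contraction_limit R B S (fun s => (sval s).1) (fun s => (sval s).2)
  q 1 q0 q1 ler01 (fun s => (svalP s).1) _ s0; last first.
  move=> z [zx zs]; exists z; split=> // h Hh; apply/eqP.
  rewrite -subr_eq0 -normr_le0; apply/ler_addgt0Pr => e e0; rewrite add0r.
  have [|[[y c] /= [_ yc]] /= [ce yz]] := zs (e / 3); first by lra.
  have zy : `|a h z - a h y| <= e / 3 by rewrite (action_isometry aP) distrC.
  have := ler_distD (a h y) (a h z) z; have := ler_distD y (a h y) z.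
  have := yc h Hh; lra.
move=> [[y c] /= [c0 yc]].
have [[h [Hh hy]]|small] := pselect (exists h, H h /\ c / 2 < `|a h y - y|); last first.
  have c20 : 0 <= c / 2 by lra.
  have yc2 : forall h, H h -> `|a h y - y| <= c / 2.
    by move=> h Hh; rewrite leNgt; apply/negP => hc; apply: small; exists h.
  exists (exist _ (y, c / 2) (conj c20 yc2)) => /=.
  by rewrite subrr normr0 mul1r; split=> //; nra.
set m := 2^-1 *: (y + a h y).
have near_m g : H g -> `|a g y - m| <= (1 - k) * c.
  move=> Hg; have := kP c (a g y - y) (a g y - a h y) (yc g Hg).
  have -> : a g y - y - (a g y - a h y) = a h y - y by linear_identity R B.
  have -> : a g y - m = 2^-1 *: (a g y - y + (a g y - a h y)).
    by rewrite /m; linear_identity R B.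
  have -> : `|a g y - a h y| = `|a (h^-1 * g)%g y - y|.
    by rewrite (action_mul aP) -(action_isometry aP h^-1%g) -!(action_mul aP) mulVg (action_one aP).
  rewrite half => /(_ (yc _ (HM _ _ (HV _ Hh) Hg))) gm.
  have := gm (ltac:(lra)); lra.
have mk g : H g -> `|a g m - m| <= q * c.
  move=> Hg; have gy := near_m g Hg; have := near_m _ (HM _ _ Hg Hh).
  rewrite (action_mul aP) => ghy.
  have -> : a g m - m = 2^-1 *: ((a g y - m) + (a g (a h y) - m)).
    by rewrite {1}/m action_midpoint //; linear_identity R B.
  rewrite half; have := ler_normD (a g y - m) (a g (a h y) - m).
  have : (1 - k) * c <= q * c by rewrite ler_wpM2r.
  lra.
have qc0 : 0 <= q * c by rewrite mulr_ge0.
exists (exist _ (m, q * c) (conj qc0 mk)) => /=; split=> //.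
have -> : m - y = 2^-1 *: (a h y - y) by rewrite /m; linear_identity R B.
rewrite half mul1r; have := yc h Hh; lra.
Qed.

End IsometricActions.

(** * Bounded root subgroups *)

(** All that the fixed point argument uses of elementary matrices. The coefficient
    [r'] in [elem_swap], which is [r] up to sign for matrices, is existential because
    the estimates are uniform in the coefficients. *)
Record elementary_family (A : nzRingType) (G : groupType) (I : finType)
    (e : I -> I -> A -> G) : Prop := {
  elem_add : forall i j r s, i != j -> e i j (r + s) = (e i j r * e i j s)%g;
  elem_commute : forall i j k l r s, i != j -> k != l -> j != k -> i != l ->
    (e i j r * e k l s = e k l s * e i j r)%g;
  elem_commutator : forall i j k r s, i != j -> j != k -> i != k ->
    (e i j r * e j k s = e i k (r * s)%R * e j k s * e i j r)%g;
  elem_generate : forall H : set G, is_subgroup H ->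
    (forall i j r, i != j -> H (e i j r)) -> forall g, H g;
  elem_swap : forall i j, i != j -> exists2 w : G,
    w = (e i j 1%R * e j i (- 1)%R * e i j 1%R)%g &
    forall k l r, k != l -> exists r',
      (e k l r * w = w * e (tperm i j k) (tperm i j l) r')%g }.

Lemma subgroup_fixing (R : realType) (B : completeNormedModType R)
    (G : groupType) (a : G -> B -> B) (x : B) : isometric_action a ->
  is_subgroup [set g | a g x = x].
Proof.
move=> aP; split=> [|g h /= gx hx]; first exact: action_one.
by rewrite (action_mul aP) -{1}hx -(action_mul aP h^-1%g) mulVg (action_one aP).
Qed.

Lemma linear_part_action (R : realType) (B : completeNormedModType R)
    (G : groupType) (a : G -> B -> B) : uniformly_convex R B ->
  isometric_action a -> isometric_action (linear_part a).
Proof.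
move=> Buc aP; split=> [g x y|x|g h x]; last exact: linear_partM.
  by rewrite -linear_partB // linear_part_norm.
exact: linear_part1.
Qed.

Lemma exists_notin (I : finType) (s : seq I) : (size s < #|I|)%N ->
  exists k, k \notin s.
Proof.
move=> sI; apply/existsP; apply: contraLR sI; rewrite negb_exists -leqNgt => /forallP ins.
apply: leq_trans (card_size s).
by apply: subset_leq_card; apply/fintype.subsetP => k _; have := ins k; rewrite negbK.
Qed.

Section ElementaryFamily.
Variables (R : realType) (B : completeNormedModType R).
Hypothesis Buc : uniformly_convex R B.
Variables (A : nzRingType) (G : groupType) (I : finType) (e : I -> I -> A -> G).
Hypothesis eP : elementary_family e.

Lemma elem0 i j : i != j -> e i j 0 = 1%g.
Proof.
by move=> ij; apply: (mulgI (e i j 0)); rewrite mulg1 -(elem_add eP) // addr0.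
Qed.

Lemma elem_opp i j r : i != j -> e i j (- r) = (e i j r)^-1%g.
Proof.
move=> ij; apply: (mulgI (e i j r)).
by rewrite -(elem_add eP) // subrr mulgV elem0.
Qed.

Lemma commutator_displacement (a : G -> B -> B) i j k s x D D' :
  isometric_action a -> i != j -> j != k -> i != k ->
  `|a (e i j 1) x - x| <= D -> `|a (e j k s) x - x| <= D' ->
  `|a (e i k s) x - x| <= 2 * (D + D').
Proof.
move=> aP ij jk ik xD xD'.
have -> : e i k s = (e i j 1%R * e j k s * (e i j 1%R)^-1 * (e j k s)^-1)%g.
  by rewrite (elem_commutator eP) // mul1r !mulgK.
apply: le_trans (action_dist_mul aP _ _ _) _.
rewrite action_dist_inv //; apply: le_trans (lerD (action_dist_mul aP _ _ _) xD') _.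
rewrite action_dist_inv //.
apply: le_trans (lerD (lerD (action_dist_mul aP _ _ _) xD) (lexx _)) _; lra.
Qed.

Section CommutingFamily.
Variables (J : eqType) (f : J -> A -> G) (s : seq J).
Hypothesis fD : forall i r t, i \in s -> f i (r + t) = (f i r * f i t)%g.
Hypothesis fC : forall i j r t, i \in s -> j \in s ->
  (f i r * f j t = f j t * f i r)%g.

Definition family_product (s' : seq J) (c : J -> A) : G :=
  foldr (fun i g => f i (c i) * g)%g 1%g s'.

Lemma family_product_commute s' i r c : {subset s' <= s} -> i \in s ->
  (family_product s' c * f i r = f i r * family_product s' c)%g.
Proof.
move=> s's si; elim: s' s's => [|j s' IH] s's /=; first by rewrite mul1g mulg1.
have s's' : {subset s' <= s} by move=> k ks; apply: s's; rewrite inE ks orbT.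
have sj : j \in s by apply: s's; rewrite mem_head.
by rewrite -mulgA (IH s's') mulgA (fC _ _ sj si) mulgA.
Qed.

Lemma family_productD s' c d : {subset s' <= s} ->
  family_product s' (fun i => c i + d i) =
  (family_product s' c * family_product s' d)%g.
Proof.
elim: s' => [|j s' IH] s's /=; first by rewrite mulg1.
have s's' : {subset s' <= s} by move=> k ks; apply: s's; rewrite inE ks orbT.
have sj : j \in s by apply: s's; rewrite mem_head.
rewrite IH // fD // -!mulgA; congr (_ * _)%g.
by rewrite !mulgA (family_product_commute _ _ s's' sj).
Qed.

Lemma family_product0 s' : {subset s' <= s} -> family_product s' (fun=> 0) = 1%g.
Proof.
elim: s' => [//|j s' IH] s's /=; rewrite IH ?mulg1.
  by apply: (mulgI (f j 0)); rewrite -fD ?addr0 ?mulg1 //; apply: s's; rewrite mem_head.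
by move=> k ks; apply: s's; rewrite inE ks orbT.
Qed.

Lemma family_product_single s' i r : {subset s' <= s} -> uniq s' -> i \in s' ->
  family_product s' (fun j => if j == i then r else 0) = f i r.
Proof.
have f0 j : j \in s -> f j 0 = 1%g.
  by move=> sj; apply: (mulgI (f j 0)); rewrite -fD // addr0 mulg1.
elim: s' => [//|j s' IH] s's /= /andP[js' us'].
have s's' : {subset s' <= s} by move=> k ks; apply: s's; rewrite inE ks orbT.
have sj : j \in s by apply: s's; rewrite mem_head.
rewrite inE => /orP[/eqP ij|is']; last first.
  rewrite IH //; case: eqVneq => [ji|_]; last by rewrite f0 ?mul1g.
  by rewrite ji is' in js'.
rewrite -ij eqxx -[RHS]mulg1 ij; congr (_ * _)%g.
rewrite -[RHS](family_product0 s's'); move: js'; rewrite -ij; clear.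
elim: s' => [//|k s' IH] /=; rewrite inE negb_or => /andP[ik is'].
by rewrite IH // eq_sym (negPf ik).
Qed.

(** Almost fixing [x] uniformly is a statement about the orbit of [x] under the
    abelian group of all the products of the family, which is bounded. *)
Lemma family_fixed_point : uniq s -> exists2 C : R, 0 < C &
  forall a : G -> B -> B, isometric_action a ->
  forall x d, 0 <= d -> (forall i r, i \in s -> `|a (f i r) x - x| <= d) ->
  exists y, (forall i r, i \in s -> a (f i r) y = y) /\ `|y - x| <= C * d.
Proof.
move=> us; have [C0 C00 C0P] := bounded_orbit_fixed_point Buc.
exists (C0 * ((size s)%:R + 1)) => [|a aP x d d0 xd].
  by rewrite mulr_gt0 // ltr_wpDl.
pose H := [set g | exists c, g = family_product s c].
have sub s' c : {subset s' <= s} ->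
    `|a (family_product s' c) x - x| <= (size s')%:R * d.
  elim: s' => [|j s' IH] s's /=; first by rewrite (action_one aP) subrr normr0 mul0r.
  apply: le_trans (action_dist_mul aP _ _ _) _.
  rewrite -natr1 mulrDl mul1r addrC lerD //.
    by apply: IH => k ks; apply: s's; rewrite inE ks orbT.
  by apply: xd; apply: s's; rewrite mem_head.
have [| | | |y [yH yx]] := C0P G a aP H _ _ x (((size s)%:R + 1) * d).
- by move=> _ _ [c ->] [c' ->]; exists (fun i => c i + c' i); rewrite family_productD.
- move=> _ [c ->]; exists (fun i => - c i); apply: (mulgI (family_product s c)).
  rewrite mulgV -family_productD //; rewrite -(family_product0 (s' := s)) //.
  by congr family_product; apply/funext => i; rewrite subrr.
- move=> _ [c ->]; apply: le_trans (sub _ _ _) _ => //.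
  by rewrite ler_wpM2r // lerDl.
- by rewrite mulr_ge0 // addr_ge0.
exists y; split=> [i r si|]; last by rewrite -mulrA.
apply: yH; exists (fun j => if j == i then r else 0).
by rewrite family_product_single.
Qed.
End CommutingFamily.

Section BoundedOrbits.
Variable a : G -> B -> B.
Hypothesis aP : isometric_action a.
Local Notation rho := (linear_part a).
Local Notation b g := (a g 0).

Lemma cocycleE g h : b (g * h)%g = b g + rho g (b h).
Proof. by rewrite (action_mul aP) /linear_part addrC subrK. Qed.

Lemma commuting_cocycle g h : (g * h = h * g)%g ->
  `|rho g (b h) - b h| <= 2 * `|b g|.
Proof.
move=> gh; have := cocycleE g h; rewrite gh cocycleE => E.
have -> : rho g (b h) - b h = rho h (b g) - b g.
  by apply: (addrI (b g)); rewrite addrA -E; linear_identity R B.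
apply: le_trans (ler_normB _ _) _; rewrite linear_part_norm //; lra.
Qed.

(** What relative property (T) gives for the copy of the semidirect product acting on
    the coordinates [i] and [k], with A^2 embedded in the column [j]. *)
Definition root_spectral_gap (i k j : I) (tau : G -> B -> B) : Prop :=
  exists (C : R) (K : seq G),
    (forall s, s \in K -> exists p q r,
       [/\ p != q, p \in [:: i; k], q \in [:: i; k; j] & s = e p q r]) /\
    forall x D, 0 <= D -> (forall s, s \in K -> `|tau s x - x| <= D) ->
      forall r, `|tau (e i j r) x - x| <= C * D.

Hypothesis gap : forall i k j, uniq [:: i; k; j] -> root_spectral_gap i k j rho.

(** The elements [e l j r] commute with the finite set [K], so [K] displaces their
    cocycle values by a bounded amount, whatever [r]. *)
Lemma cocycle_almost_invariant i k j l : uniq [:: i; k; j; l] ->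
  exists C, forall r r', `|rho (e i j r') (b (e l j r)) - b (e l j r)| <= C.
Proof.
move=> uq.
have /and4P[] := uq; rewrite !inE !negb_or.
move=> /and3P[ik ij il] /andP[kj kl] jl _.
have uq' : uniq [:: i; k; j] by rewrite /= !inE negb_or ik ij kj.
have [C [K [KP gapP]]] := gap uq'.
set D := \sum_(s <- K) 2 * `|b s|.
have D0 : 0 <= D by apply: sumr_ge0 => s _; rewrite mulr_ge0.
exists (C * D) => r r'; apply: gapP => // s sK.
apply: (@le_trans _ _ (2 * `|b s|)); last first.
  by rewrite /D (big_rem s) //= lerDl sumr_ge0 // => ? _; rewrite mulr_ge0.
apply: commuting_cocycle.
have [p [q [t [pq pP qP ->]]]] := KP s sK.
apply: (elem_commute eP) => //; first by rewrite eq_sym.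
  by move: qP; rewrite !inE => /or3P[] /eqP ->.
by move: pP; rewrite !inE => /orP[] /eqP ->.
Qed.

(** The relation between [e i k 1] and [e k j r] says that [y = e i k 1] sends
    [b (e k j r)] to about [b (e k j r) + b (e i j r)] and nearly fixes the second
    term; so the third power of the isometry [y] adds three times that term. *)
Lemma cocycle_compare i k j l : uniq [:: i; k; j; l] ->
  exists c, forall r, 3 * `|b (e i j r)| <= 2 * `|b (e k j r)| + c.
Proof.
move=> uq; have uq' : uniq [:: i; l; j; k].
  move: uq; rewrite /= !inE !negb_or => /and4P[/and3P[-> -> ->] /andP[kj kl] jl _].
  by rewrite eq_sym jl eq_sym kl eq_sym kj.
have [C CP] := cocycle_almost_invariant uq'.
have /and4P[] := uq; rewrite !inE !negb_or.
move=> /and3P[ik ij il] /andP[kj kl] jl _.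
set y := e i k 1; set N := `|b y|.
exists (3 * (C + 2 * N) + 6 * N) => r.
set F := b (e i j r); set H := b (e k j r).
set v1 := rho y H - H - F; set v2 := rho y F - F.
have v1N : `|v1| <= C + 2 * N.
  have := cocycleE y (e k j r).
  rewrite (elem_commutator eP) // mul1r -mulgA !cocycleE -/y -/F -/H => E.
  have -> : v1 = (rho (e i j r) H - H) + rho (e i j r) (rho (e k j r) (b y)) - b y.
    rewrite /v1; apply: (addrI (b y)).
    rewrite [b y + (rho y H - H - F)]addrA [b y + (rho y H - H)]addrA -E linear_partD //.
    by linear_identity R B.
  apply: le_trans (ler_normB _ _) _; apply: le_trans (lerD (ler_normD _ _) (lexx _)) _.
  have -> : `|rho (e i j r) (rho (e k j r) (b y))| = N by rewrite !linear_part_norm.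
  have := CP r r; rewrite -/H -/N; lra.
have v2N : `|v2| <= 2 * N.
  by apply: commuting_cocycle; apply: (elem_commute eP) => //; rewrite eq_sym.
have F3 : 3%:R *: F = rho y (rho y (rho y H)) - H
    - (rho y (rho y v1) + rho y v1 + v1) - (rho y v2 + v2 + v2).
  by rewrite /v1 /v2 !linear_partB //; linear_identity R B.
have : `|3%:R *: F| = 3 * `|F| by rewrite normrZ ger0_norm.
rewrite F3 => <-.
have n3 (p q s : B) : `|p + q + s| <= `|p| + `|q| + `|s|.
  by apply: le_trans (ler_normD _ _) _; rewrite lerD2r ler_normD.
have n1 := n3 (rho y (rho y v1)) (rho y v1) v1.
have n2 := n3 (rho y v2) v2 v2.
have n0 := ler_normB (rho y (rho y (rho y H))) H.
rewrite !linear_part_norm // in n0 n1 n2.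
apply: le_trans (ler_normB _ _) _.
apply: le_trans (lerD (ler_normB _ _) (lexx _)) _; lra.
Qed.

(** The comparison for [i] and [k] in both orders is a contraction: writing [F], [H]
    for the two cocycle norms, [9 F <= 6 H + 3 c <= 4 F + 2 c' + 3 c]. *)
Lemma cocycle_bounded i j : (3 < #|I|)%N -> i != j ->
  exists C, forall r, `|b (e i j r)| <= C.
Proof.
move=> I4 ij.
have [k ku] := exists_notin (s := [:: i; j]) (ltnW I4).
have [l lu] := exists_notin (s := [:: i; j; k]) I4.
move: ku lu; rewrite !inE !negb_or => /andP[ki kj] /and3P[li lj lk].
have uq : uniq [:: i; k; j; l].
  by rewrite /= !inE !negb_or ij kj [i == k]eq_sym ki [i == l]eq_sym li [k == l]eq_sym lk [j == l]eq_sym lj.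
have uq' : uniq [:: k; i; j; l].
  by rewrite /= !inE !negb_or ki kj ij [i == l]eq_sym li [k == l]eq_sym lk [j == l]eq_sym lj.
have [c cP] := cocycle_compare uq; have [c' cP'] := cocycle_compare uq'.
by exists (2 * c' + 3 * c) => r; have := cP r; have := cP' r; have := normr_ge0 (b (e i j r)); lra.
Qed.
End BoundedOrbits.
End ElementaryFamily.

(** * From bounded root subgroups to a global fixed point *)

Section GlobalFixedPoint.
Variables (R : realType) (B : completeNormedModType R).
Hypothesis Buc : uniformly_convex R B.
Variables (A : nzRingType) (G : groupType) (I : finType) (e : I -> I -> A -> G).
Hypothesis eP : elementary_family e.
Hypothesis I4 : (3 < #|I|)%N.

Lemma line_fixed_point (o : I) : exists2 C : R, 0 < C &
  forall a : G -> B -> B, isometric_action a -> forall x d, 0 <= d ->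
  ((forall i r, i != o -> `|a (e i o r) x - x| <= d) ->
    exists y, (forall i r, i != o -> a (e i o r) y = y) /\ `|y - x| <= C * d) /\
  ((forall i r, i != o -> `|a (e o i r) x - x| <= d) ->
    exists y, (forall i r, i != o -> a (e o i r) y = y) /\ `|y - x| <= C * d).
Proof.
pose s := [seq i <- enum I | i != o].
have su : uniq s by rewrite filter_uniq ?enum_uniq.
have sE i : (i \in s) = (i != o) by rewrite mem_filter mem_enum andbT.
have [| |C1 C10 C1P] := @family_fixed_point R B Buc A G I (fun i => e i o) s _ _ su.
- by move=> i r t; rewrite sE; exact: elem_add.
- move=> i j r t; rewrite !sE => io jo.
  by apply: (elem_commute eP) => //; rewrite eq_sym.
have [| |C2 C20 C2P] := @family_fixed_point R B Buc A G I (fun i => e o i) s _ _ su.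
- by move=> i r t; rewrite sE eq_sym; exact: elem_add.
- move=> i j r t; rewrite !sE => io jo.
  by apply: (elem_commute eP) => //; rewrite eq_sym.
have CE (C c d : R) : C <= c -> 0 <= d -> C * d <= c * d by move=> *; rewrite ler_wpM2r.
exists (Num.max C1 C2) => [|a aP x d d0]; first by rewrite lt_max C10.
split=> xd.
  have [|y [yf yx]] := C1P a aP x d d0; first by move=> i r; rewrite sE; exact: xd.
  exists y; split=> [i r io|]; first by apply: yf; rewrite sE.
  by apply: le_trans yx (CE _ _ _ _ d0); rewrite le_max lexx.
have [|y [yf yx]] := C2P a aP x d d0; first by move=> i r; rewrite sE; exact: xd.
exists y; split=> [i r io|]; first by apply: yf; rewrite sE.
by apply: le_trans yx (CE _ _ _ _ d0); rewrite le_max lexx orbT.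
Qed.

Section Action.
Variable a : G -> B -> B.
Hypothesis aP : isometric_action a.
Local Notation rho := (linear_part a).
Variables (o : I).

Definition fixed_by_column (x : B) := forall i r, i != o -> a (e i o r) x = x.
Definition fixed_by_row (x : B) := forall i r, i != o -> a (e o i r) x = x.

Lemma fixed_by_column_midpoint x y : fixed_by_column x -> fixed_by_column y ->
  fixed_by_column (2^-1 *: (x + y)).
Proof. by move=> xf yf i r io; rewrite action_midpoint // xf // yf. Qed.

Lemma fixed_by_row_midpoint x y : fixed_by_row x -> fixed_by_row y ->
  fixed_by_row (2^-1 *: (x + y)).
Proof. by move=> xf yf i r io; rewrite action_midpoint // xf // yf. Qed.

Lemma row_column_generate x : fixed_by_column x -> fixed_by_row x ->
  forall g, a g x = x.
Proof.
move=> xc xr; apply: (elem_generate eP); first exact: subgroup_fixing.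
move=> i j r ij /=.
have [io|io] := eqVneq i o; first by rewrite io; apply: xr; rewrite -io eq_sym.
have [jo|jo] := eqVneq j o; first by rewrite jo; apply: xc.
apply/eqP; rewrite -subr_eq0 -normr_le0.
rewrite -(mulr0 2) -[X in 2 * X]addr0.
apply: (commutator_displacement eP (j := o)) => //; rewrite ?xc ?xr ?subrr ?normr0 //.
by rewrite eq_sym.
Qed.

(** The root subgroups away from [o] normalize both the column and the row
    subgroup. *)
Lemma inner_preserves_column i j r x : i != o -> j != o -> i != j ->
  fixed_by_column x -> fixed_by_column (a (e i j r) x).
Proof.
move=> io jo ij xf k s ko; rewrite -(action_mul aP).
have [kj|kj] := eqVneq k j; last first.
  have -> : (e k o s * e i j r = e i j r * e k o s)%g.
    by apply: (elem_commute eP) => //; rewrite eq_sym.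
  by rewrite (action_mul aP) xf.
(* Up to the element [e i o (r * s)], which fixes both sides, [e j o s] and
   [e i j r] commute. *)
set z := e i o (r * s)%R.
have zf : a z (a (e i j r) x) = a (e i j r) x.
  rewrite -(action_mul aP).
  have -> : (z * e i j r = e i j r * z)%g.
    by apply: (elem_commute eP) => //; rewrite eq_sym.
  by rewrite (action_mul aP) xf.
rewrite kj; apply/eqP; rewrite -subr_eq0 -normr_eq0 -(action_isometry aP z) zf.
rewrite -(action_mul aP) mulgA -(elem_commutator eP) // (action_mul aP) xf //.
by rewrite subrr normr0.
Qed.

Lemma inner_preserves_row i j r x : i != o -> j != o -> i != j ->
  fixed_by_row x -> fixed_by_row (a (e i j r) x).
Proof.
move=> io jo ij xf.
have comm k s : k != o -> k != i -> a (e o k s) (a (e i j r) x) = a (e i j r) x.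
  move=> ko ki; rewrite -(action_mul aP).
  have -> : (e o k s * e i j r = e i j r * e o k s)%g.
    by apply: (elem_commute eP) => //; rewrite eq_sym.
  by rewrite (action_mul aP) xf.
move=> k s ko; have [->|ki] := eqVneq k i; last exact: comm.
rewrite -(action_mul aP) (elem_commutator eP) //; try by rewrite eq_sym.
by rewrite -mulgA (action_mul aP) (action_mul aP _ (e o i s)) xf // comm // eq_sym.
Qed.

Section NearlyMinimalPair.
Variables (xi eta : B) (kappa : R).
Local Notation v := (xi - eta).
Local Notation d := (`|xi - eta|).
Hypotheses (xi_col : fixed_by_column xi) (eta_row : fixed_by_row eta).

Hypothesis d0 : (0 : R) < d.
(* The midpoints to which this is applied stay within [4 d] of [xi]. *)
Hypothesis minimal : forall x y, fixed_by_column x -> fixed_by_row y ->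
  `|x - xi| <= 20 * d -> (1 - kappa) * d < `|x - y|.

Lemma line_moves i r : i != o ->
  [/\ `|a (e i o r) xi - xi| <= 2 * d, `|a (e i o r) eta - eta| <= 2 * d,
      `|a (e o i r) xi - xi| <= 2 * d & `|a (e o i r) eta - eta| <= 2 * d].
Proof.
move=> io; have d20 : 0 <= 2 * d by rewrite mulr_ge0.
rewrite xi_col // eta_row // !subrr !normr0 d20; split=> //.
  apply: le_trans (ler_distD (a (e i o r) xi) _ _) _.
  rewrite (action_isometry aP) xi_col // [`|eta - xi|]distrC. lra.
apply: le_trans (ler_distD (a (e o i r) eta) _ _) _.
by rewrite (action_isometry aP) eta_row // [`|eta - xi|]distrC; lra.
Qed.

Lemma inner_moves i j r : i != o -> j != o -> i != j ->
  `|a (e i j r) xi - xi| <= 8 * d.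
Proof.
move=> io jo ij; have [m1 _ _ _] := line_moves 1 io; have [_ _ m2 _] := line_moves r jo.
have -> : 8 * d = 2 * (2 * d + 2 * d) by lra.
by apply: (commutator_displacement eP (j := o)) => //; rewrite eq_sym.
Qed.

Lemma half_norm (w : B) : `|2^-1 *: w| = `|w| / 2.
Proof. by rewrite normrZ ger0_norm // mulrC. Qed.

(** Averaging [(xi, eta)] with its image under an inner element gives an admissible
    pair, whose distance cannot be much smaller; by uniform convexity the two
    differences [v] and [rho h v] are then close. *)
Lemma inner_almost_fixes_difference (e1 : R) i j r :
  (forall (D : R) (x y : B), `|x| <= D -> `|y| <= D -> e1 * D <= `|x - y| ->
    `|x + y| <= 2 * (1 - kappa) * D) ->
  i != o -> j != o -> i != j -> `|rho (e i j r) v - v| <= e1 * d.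
Proof.
move=> uc io jo ij; set h := e i j r.
have := @minimal (2^-1 *: (xi + a h xi)) (2^-1 *: (eta + a h eta)).
have -> : 2^-1 *: (xi + a h xi) - xi = 2^-1 *: (a h xi - xi) by linear_identity R B.
have -> : 2^-1 *: (xi + a h xi) - 2^-1 *: (eta + a h eta) =
    2^-1 *: (v + (a h xi - a h eta)) by linear_identity R B.
rewrite action_sub // !half_norm => min.
have far : (1 - kappa) * d < `|v + rho h v| / 2.
  apply: min.
  - by apply: fixed_by_column_midpoint => //; exact: inner_preserves_column.
  - by apply: fixed_by_row_midpoint => //; exact: inner_preserves_row.
  - have := inner_moves r io jo ij; rewrite -/h; move: d0; lra.
rewrite leNgt; apply/negP; rewrite [`|rho h v - v|]distrC => hv.
have := uc d v (rho h v) (lexx _); rewrite linear_part_norm // lexx.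
by move=> /(_ isT (ltW hv)); lra.
Qed.

Section InnerAlmostFixes.
Variable e1 : R.
Hypothesis inner_v : forall i j r, i != o -> j != o -> i != j ->
  `|rho (e i j r) v - v| <= e1 * d.
Local Notation c := (e1 * d).

(** The translation [w_h] by which an inner [h] moves [xi] is fixed by the column
    and, being almost the translation of [eta], almost fixed by the row; hence it
    is almost fixed by the inner elements. So [h |-> w_h] is almost a homomorphism
    to the additive group, and almost vanishes on commutators. *)
Lemma inner_almost_fixes_points i j r : i != o -> j != o -> i != j ->
  `|a (e i j r) xi - xi| <= 16 * c /\ `|a (e i j r) eta - eta| <= 17 * c.
Proof.
pose w g : B := a g xi - xi; pose w' g : B := a g eta - eta.
have wv i' j' r' : w (e i' j' r') - w' (e i' j' r') = rho (e i' j' r') v - v.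
  by rewrite -action_sub // /w /w'; linear_identity R B.
have w_col i' j' r' k s : i' != o -> j' != o -> i' != j' -> k != o ->
    rho (e k o s) (w (e i' j' r')) = w (e i' j' r').
  move=> io jo ij ko; rewrite /w -action_sub // xi_col // inner_preserves_column //.
have w'_row i' j' r' k s : i' != o -> j' != o -> i' != j' -> k != o ->
    rho (e o k s) (w' (e i' j' r')) = w' (e i' j' r').
  move=> io jo ij ko; rewrite /w' -action_sub // eta_row // inner_preserves_row //.
have w_row i' j' r' k s : i' != o -> j' != o -> i' != j' -> k != o ->
    `|rho (e o k s) (w (e i' j' r')) - w (e i' j' r')| <= 2 * c.
  move=> io jo ij ko; set g := e o k s; set h := e i' j' r'.
  have -> : rho g (w h) - w h = rho g (w h - w' h) - (w h - w' h).
    by rewrite linear_partB // (w'_row i' j') // -/h; linear_identity R B.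
  rewrite wv; apply: le_trans (ler_normB _ _) _; rewrite linear_part_norm //.
  by have := inner_v r' io jo ij; rewrite -/h; move: d0; lra.
have w_inner i' j' r' k l s : i' != o -> j' != o -> i' != j' ->
    k != o -> l != o -> k != l ->
    `|rho (e k l s) (w (e i' j' r')) - w (e i' j' r')| <= 4 * c.
  move=> io jo ij ko lo kl; have -> : 4 * c = 2 * (0 + 2 * c) by lra.
  apply: (commutator_displacement eP (j := o) (linear_part_action Buc aP)) => //.
  - by rewrite eq_sym.
  - by rewrite w_col // subrr normr0.
  - exact: w_row.
have w_small i' j' r' : i' != o -> j' != o -> i' != j' -> `|w (e i' j' r')| <= 16 * c.
  move=> io jo ij; have [k] := exists_notin (s := [:: i'; j'; o]) I4.
  rewrite !inE !negb_or => /and3P[ki kj ko].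
  set h := e i' j' r'; set h1 := e i' k 1; set h2 := e k j' r'.
  have ik : i' != k by rewrite eq_sym.
  have wM g g' : w (g * g')%g = w g + rho g (w g').
    by rewrite /w -action_sub // -(action_mul aP); linear_identity R B.
  have E : (h1 * h2 = h * (h2 * h1))%g by rewrite mulgA (elem_commutator eP) // mul1r.
  have := wM h1 h2; rewrite E !wM linear_partD // => {}E.
  have -> : w h = (rho h1 (w h2) - w h2) - (rho h (w h2) - w h2)
      - (rho h (rho h2 (w h1) - w h1)) - (rho h (w h1) - w h1).
    have -> : w h = w h1 + rho h1 (w h2) - (rho h (w h2) + rho h (rho h2 (w h1))).
      by rewrite -E; linear_identity R B.
    by rewrite linear_partB //; linear_identity R B.
  apply: le_trans (ler_normB _ _) _; apply: le_trans (lerD (ler_normB _ _) (lexx _)) _.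
  apply: le_trans (lerD (lerD (ler_normB _ _) (lexx _)) (lexx _)) _.
  (* Each of the four terms is at most [4 c] by [w_inner]. *)
  rewrite (linear_part_norm aP h).
  have n1 := w_inner k j' r' i' k 1 ko jo kj io ko ik.
  have n2 := w_inner k j' r' i' j' r' ko jo kj io jo ij.
  have n3 := w_inner i' k 1 k j' r' io ko ik ko jo kj.
  have n4 := w_inner i' k 1 i' j' r' io ko ik io jo ij.
  rewrite -/h -/h1 -/h2 in n1 n2 n3 n4; lra.
move=> io jo ij; split; first exact: w_small.
have := w_small i j r io jo ij; have := inner_v r io jo ij; rewrite -wv.
have -> : a (e i j r) eta - eta = w (e i j r) - (w (e i j r) - w' (e i j r)).
  by rewrite /w'; linear_identity R B.
move=> n1 n2; apply: le_trans (ler_normB _ _) _; lra.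
Qed.

End InnerAlmostFixes.

(** The swap [w] of [o] and [u] conjugates the column into inner elements and one row
    element, all of which almost fix [eta]; so [w eta] is almost fixed by the column,
    and likewise [w xi] by the row. Thus [(w eta, w xi)] is almost an admissible pair,
    and comparing it with [(xi, eta)] as before, [w v] is almost [- v]. *)
Lemma swap_almost_negates_difference (C e1 e2 k2 : R) (w : G) u :
  (forall x D, 0 <= D ->
    ((forall i r, i != o -> `|a (e i o r) x - x| <= D) ->
      exists y, fixed_by_column y /\ `|y - x| <= C * D) /\
    ((forall i r, i != o -> `|a (e o i r) x - x| <= D) ->
      exists y, fixed_by_row y /\ `|y - x| <= C * D)) ->
  0 <= e1 -> 0 < C -> 34 * C * e1 <= k2 -> k2 <= 1 -> 2 * kappa <= k2 ->
  (forall (D : R) (x y : B), `|x| <= D -> `|y| <= D -> e2 * D <= `|x - y| ->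
    `|x + y| <= 2 * (1 - k2) * D) ->
  (forall i j r, i != o -> j != o -> i != j ->
    `|a (e i j r) xi - xi| <= 17 * (e1 * d) /\
    `|a (e i j r) eta - eta| <= 17 * (e1 * d)) ->
  u != o -> w = (e o u 1 * e u o (- 1)%R * e o u 1)%g ->
  (forall k l r, k != l -> exists r',
      (e k l r * w = w * e (tperm o u k) (tperm o u l) r')%g) ->
  `|rho w v + v| <= e2 * d.
Proof.
move=> fixC e10 C0 Ce k21 kap uc inner uo wE w_swap.
set D := 17 * (e1 * d).
have D0 : 0 <= D by rewrite !mulr_ge0.
have wcol i r : i != o -> `|a (e i o r) (a w eta) - a w eta| <= D.
  move=> io; have [r' E] := w_swap i o r io.
  rewrite -(action_mul aP) E (action_mul aP) (action_isometry aP) tpermL.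
  have [->|iu] := eqVneq i u; first by rewrite tpermR eta_row // subrr normr0.
  by rewrite tpermD // 1?eq_sym //; have [] := inner i u r' io uo iu.
have wrow i r : i != o -> `|a (e o i r) (a w xi) - a w xi| <= D.
  move=> io; have oi : o != i by rewrite eq_sym.
  have [r' E] := w_swap o i r oi.
  rewrite -(action_mul aP) E (action_mul aP) (action_isometry aP) tpermL.
  have [->|iu] := eqVneq i u; first by rewrite tpermR xi_col // subrr normr0.
  have ui : u != i by rewrite eq_sym.
  by rewrite tpermD //; have [] := inner u i r' uo io ui.
have [x [x_col xw]] := (fixC (a w eta) D D0).1 wcol.
have [y [y_row yw]] := (fixC (a w xi) D D0).2 wrow.
have CD : C * D <= k2 * d / 2.
  have -> : C * D = 34 * C * e1 * d / 2 by rewrite /D; lra.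
  by rewrite ler_pM2r // ler_wpM2r.
have k2d : k2 * d <= d by rewrite ler_piMl.
have w_eta : `|a w eta - eta| <= 6 * d.
  rewrite wE; have [_ _ _ m1] := line_moves 1 uo; have [_ m2 _ _] := line_moves (- 1) uo.
  apply: le_trans (action_dist_mul aP _ _ _) _.
  apply: le_trans (lerD (action_dist_mul aP _ _ _) (lexx _)) _; lra.
have := @minimal (2^-1 *: (xi + x)) (2^-1 *: (eta + y)).
have -> : 2^-1 *: (xi + x) - xi =
    2^-1 *: ((x - a w eta) + (a w eta - eta) - v) by linear_identity R B.
have -> : 2^-1 *: (xi + x) - 2^-1 *: (eta + y) =
    2^-1 *: ((v - (a w xi - a w eta)) + (x - a w eta) - (y - a w xi)).
  by linear_identity R B.
rewrite action_sub // !half_norm => min.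
have far : (1 - kappa) * d <
    `|(v - rho w v) + (x - a w eta) - (y - a w xi)| / 2.
  apply: min; [exact: fixed_by_column_midpoint | exact: fixed_by_row_midpoint |].
  have := ler_normB ((x - a w eta) + (a w eta - eta)) v.
  have := ler_normD (x - a w eta) (a w eta - eta).
  move: d0; lra.
have := ler_normB ((v - rho w v) + (x - a w eta)) (y - a w xi).
have := ler_normD (v - rho w v) (x - a w eta).
move=> n1 n2; rewrite leNgt; apply/negP; rewrite [rho w v + v]addrC => wv.
have := uc d v (- rho w v); rewrite opprK normrN linear_part_norm // lexx.
move=> /(_ isT isT (ltW wv)).
have : 2 * kappa * d <= k2 * d by rewrite ler_wpM2r.
lra.
Qed.

(** A row element is conjugate to an inner element under the swap, except for
    [e o u r], which is a commutator of such a conjugate and an inner element. *)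
Lemma row_almost_fixes_difference (c1 c2 : R) (w : G) u :
  c1 <= c2 -> u != o ->
  (forall i j r, i != o -> j != o -> i != j -> `|rho (e i j r) v - v| <= c1) ->
  `|rho w v + v| <= c2 ->
  (forall k l r, k != l -> exists r',
      (e k l r * w = w * e (tperm o u k) (tperm o u l) r')%g) ->
  forall j r, j != o -> `|a (e o j r) xi - xi| <= 8 * c2.
Proof.
move=> c12 uo inner wv w_swap j r jo.
have -> : a (e o j r) xi - xi = rho (e o j r) v - v.
  by rewrite -action_sub // eta_row //; linear_identity R B.
have c20 : 0 <= c2 by apply: le_trans wv.
have easy k s : k != o -> k != u -> `|rho (e o k s) v - v| <= 3 * c2.
  move=> ko ku; have ok : o != k by rewrite eq_sym.
  have uk : u != k by rewrite eq_sym.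
  have [s' E] := w_swap o k s ok; rewrite tpermL tpermD // in E.
  have := linear_partM Buc aP (e o k s) w v; rewrite E linear_partM // => {}E.
  have -> : rho (e o k s) v - v = rho (e o k s) (rho w v + v)
      - rho w (rho (e u k s') v - v) - (rho w v + v).
    by move: (xi - eta) E => t E; rewrite linear_partD // linear_partB // E; linear_identity R B.
  apply: le_trans (ler_normB _ _) _; apply: le_trans (lerD (ler_normB _ _) (lexx _)) _.
  have := inner u k s' uo ko uk; rewrite !linear_part_norm //; lra.
have [ju|ju] := eqVneq j u; last by have := easy j r jo ju; lra.
have [k] := exists_notin (s := [:: o; u]) (ltnW I4).
rewrite !inE !negb_or => /andP[ko ku].
have n1 := easy k 1 ko ku; have n2 := inner k u r ko uo ku.
have : `|rho (e o u r) v - v| <= 2 * (3 * c2 + c1).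
  apply: (commutator_displacement eP (j := k) (linear_part_action Buc aP)) => //.
    by rewrite eq_sym.
  by rewrite eq_sym.
by rewrite -ju; lra.
Qed.

End NearlyMinimalPair.
End Action.

(** Among pairs of a point fixed by the column and one fixed by the row, take one
    whose distance cannot be shortened by a definite factor within a bounded
    multiple of this distance; if there were none, shortening pairs would converge
    to a point fixed by both, hence by the group. For such a pair the row almost
    fixes the first point as well, and a nearby point fixed by the row shortens the
    distance after all. *)
Theorem bounded_root_subgroups_fixed_point (a : G -> B -> B) :
  isometric_action a ->
  (forall i j, i != j -> exists C, forall r, `|a (e i j r) 0| <= C) ->
  exists x, forall g, a g x = x.
Proof.
move=> aP bounded.
have [ o _ ] := @exists_notin I [::] (ltn_trans (isT : (0 < 3)%N) I4).
have [u] := exists_notin (s := [:: o]) (ltnW (ltnW I4)); rewrite inE => uo.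
have ou : o != u by rewrite eq_sym.
have [C C0 fixC] := line_fixed_point o.
have [D D0 DP] : exists2 D : R, 0 <= D & forall i j r, i != j -> `|a (e i j r) 0| <= D.
  have [f fP] : exists f : I * I -> R, forall ij, ij.1 != ij.2 ->
      forall r, `|a (e ij.1 ij.2 r) 0| <= f ij.
    have /choice[f fP] : forall ij : I * I, exists D, ij.1 != ij.2 ->
        forall r, `|a (e ij.1 ij.2 r) 0| <= D.
      move=> [i j] /=; have [/bounded[D DP]|_] := boolP (i != j); last by exists 0.
      by exists D.
    by exists f.
  exists (\sum_ij `|f ij|) => [|i j r ij]; first exact: sumr_ge0.
  rewrite (bigD1 (i, j)) //=; apply: le_trans (fP (i, j) ij r) _.
  by apply: le_trans (ler_norm _) _; rewrite lerDl sumr_ge0.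
have [xi0 [xi0_col _]] : exists y, (forall i r, i != o -> a (e i o r) y = y) /\
    `|y - 0| <= C * D.
  by apply: (fixC a aP 0 D D0).1 => i r io; rewrite subr0 DP.
have [eta0 [eta0_row _]] : exists y, (forall i r, i != o -> a (e o i r) y = y) /\
    `|y - 0| <= C * D.
  by apply: (fixC a aP 0 D D0).2 => i r io; rewrite subr0 DP // eq_sym.
(* The thresholds are chosen backwards: [e2] for the final contradiction, [e1] so
   that the errors of the swap step stay below the convexity gain [k2] for [e2],
   and [kappa] below the gains for both. *)
pose e2 : R := 1 / (16 * C).
have e20 : 0 < e2 by rewrite divr_gt0 // mulr_gt0.
have [k2' [k2'0 uc2']] := uniformly_convex_ball Buc e20.
pose k2 := Num.min k2' 1.
have k20 : 0 < k2 by rewrite lt_min k2'0 ltr01.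
have k2k : k2 <= k2' by rewrite ge_min lexx.
have k21 : k2 <= 1 by rewrite ge_min lexx orbT.
have weaken (k k' t : R) : k <= k' ->
    (forall (D' : R) (x y : B), `|x| <= D' -> `|y| <= D' -> t * D' <= `|x - y| ->
      `|x + y| <= 2 * (1 - k') * D') ->
    forall (D' : R) (x y : B), `|x| <= D' -> `|y| <= D' -> t * D' <= `|x - y| ->
      `|x + y| <= 2 * (1 - k) * D'.
  move=> kk' uc D' x y xD yD xy; apply: le_trans (uc D' x y xD yD xy) _.
  by apply: ler_wpM2r; [exact: le_trans xD | lra].
pose e1 := Num.min e2 (k2 / (34 * C)).
have e10 : 0 < e1 by rewrite lt_min e20 divr_gt0 // mulr_gt0.
have e12 : e1 <= e2 by rewrite ge_min lexx.
have Ce1 : 34 * C * e1 <= k2.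
  by rewrite mulrC -ler_pdivlMr ?mulr_gt0 // ge_min lexx orbT.
have [k1 [k10 uc1]] := uniformly_convex_ball Buc e10.
pose kappa := Num.min k1 (k2 / 2).
have kap0 : 0 < kappa by rewrite lt_min k10; lra.
have kap1 : kappa <= k1 by rewrite ge_min lexx.
have kap2 : kappa <= k2 / 2 by rewrite ge_min lexx orbT.
pose S := {xy : B * B | fixed_by_column a o xy.1 /\ fixed_by_row a o xy.2}.
pose dist (s : S) : R := `|(sval s).1 - (sval s).2|.
have [improve|/existsNP[[[xi eta] /= [xi_col eta_row]] stuck]] :=
  pselect (forall s : S, exists s', dist s' <= (1 - kappa) * dist s /\
    `|(sval s').1 - (sval s).1| <= 20 * dist s).
  have q0 : 0 <= 1 - kappa by lra.
  have q1 : 1 - kappa < 1 by lra.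
  have := contraction_limit q0 q1 (ler0n R 20) _ improve.
  move=> /(_ (fun s => normr_ge0 _) (exist _ (xi0, eta0) (conj xi0_col eta0_row))).
  move=> [z [_ z_lim]]; exists z; apply: (row_column_generate aP (o := o)) => i r io;
    apply/eqP; rewrite -subr_eq0 -normr_le0; apply/ler_addgt0Pr => t t0; rewrite add0r.
    have [|[[x y] /= [x_col y_row]] /= [_ xz]] := z_lim (t / 2); first by lra.
    apply: le_trans (ler_distD (a (e i o r) x) _ _) _.
    by rewrite (action_isometry aP) x_col // [`|z - x|]distrC; lra.
  have [|[[x y] /= [x_col y_row]] /= [xy xz]] := z_lim (t / 4); first by lra.
  have yz : `|y - z| <= t / 2.
    by have := ler_distD x y z; rewrite [`|y - x|]distrC; move: xy; rewrite /dist /=; lra.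
  apply: le_trans (ler_distD (a (e o i r) y) _ _) _.
  by rewrite (action_isometry aP) y_row // [`|z - y|]distrC; lra.
set d := `|xi - eta|.
have d_ge0 : 0 <= d by exact: normr_ge0.
have minimal x y : fixed_by_column a o x -> fixed_by_row a o y ->
    `|x - xi| <= 20 * d -> (1 - kappa) * d < `|x - y|.
  move=> xc yr xxi; rewrite ltNge; apply/negP => xy; apply: stuck.
  by exists (exist _ (x, y) (conj xc yr)).
have d0 : 0 < d.
  rewrite lt_def d_ge0 andbT; apply/eqP => dE.
  by have := minimal xi eta xi_col eta_row; rewrite subrr normr0 -/d dE !mulr0 ltxx lexx => /(_ isT).
have fix_a := fixC a aP.
have inner_v i j r : i != o -> j != o -> i != j ->
    `|linear_part a (e i j r) (xi - eta) - (xi - eta)| <= e1 * d.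
  exact: (inner_almost_fixes_difference aP xi_col eta_row d0 minimal r (weaken _ _ _ kap1 uc1)).
have [w wE w_swap] := elem_swap eP ou.
have wv : `|linear_part a w (xi - eta) + (xi - eta)| <= e2 * d.
  apply: (swap_almost_negates_difference aP xi_col eta_row d0 minimal fix_a (ltW e10) C0
    Ce1 k21 _ (weaken _ _ _ k2k uc2') _ uo wE w_swap); first by lra.
  move=> i j r io jo ij.
  have [n1 n2] := inner_almost_fixes_points aP xi_col eta_row d0 inner_v r io jo ij.
  have e1d : 0 <= e1 * d by rewrite mulr_ge0 // ltW.
  by split; rewrite -/d; move: n1 n2; rewrite -/d; lra.
have e12d : e1 * d <= e2 * d by rewrite ler_wpM2r.
have row := row_almost_fixes_difference aP eta_row e12d uo inner_v wv w_swap.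
have [|y [y_row yxi]] := (fix_a xi (8 * (e2 * d)) _).2 row.
  by rewrite mulr_ge0 // mulr_ge0 // ltW.
have := minimal xi y xi_col y_row.
rewrite subrr normr0 mulr_ge0 // => /(_ isT).
have : C * (8 * (e2 * d)) = d / 2 by rewrite /e2; field; rewrite gt_eqF.
move: yxi; rewrite distrC => yxi E.
have : 1 / 2 * d <= (1 - kappa) * d by rewrite ler_wpM2r //; lra.
lra.
Qed.

End GlobalFixedPoint.

(** * Elementary groups over a ring *)

Section ElementaryMatrices.
Variables (A : nzRingType) (n : nat).
Local Notation E := (elementary_group A n).

Definition root_elem (i j : 'I_n) (r : A) : E :=
  if insub (i, j) is Some ij then elementary ij r else 1%g.

Lemma root_elem_mx i j r : i != j ->
  E_mx (root_elem i j r) = 1%:M + r *: delta_mx i j.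
Proof. by move=> ij; rewrite /root_elem insubT. Qed.

Lemma elementary_root ij r : elementary ij r = root_elem (val ij).1 (val ij).2 r.
Proof.
rewrite /root_elem; case: ij => [[i j] /= ij]; rewrite insubT /=.
by congr (elementary _ r); apply: val_inj.
Qed.

Lemma E_mx_inj : injective (@E_mx A n).
Proof.
move=> g h gh; apply: val_inj; apply: val_inj.
have /andP[/eqP _ /eqP gV] := valP (val g); have /andP[/eqP hV _] := valP (val h).
rewrite [LHS]surjective_pairing [RHS]surjective_pairing.
have gh1 : (GL_pair (val g)).1 = (GL_pair (val h)).1 by exact: gh.
congr pair => //; rewrite -[LHS]mulmx1 -hV -gh1 mulmxA.
by move: gV => /= ->; rewrite mul1mx.
Qed.

Lemma mul_scale_delta (i j k l : 'I_n) (r s : A) :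
  (r *: delta_mx i j) *m (s *: delta_mx k l) =
  if j == k then (r * s) *: delta_mx i l else 0 :> 'M[A]_n.
Proof.
apply/matrixP => a b; rewrite mxE (bigD1 j) //= big1 => [|m mj]; last first.
  by rewrite !mxE (negPf mj) andbF mulr0 mul0r.
rewrite addr0; have [<-|jk] := eqVneq j k.
  rewrite !mxE !eqxx andbT /=; case: (a == i); case: (b == l);
    by rewrite ?mulr1 ?mulr0 ?mul0r.
by rewrite !mxE (negPf jk) /= !mulr0.
Qed.

Lemma mul_elementary (i j k l : 'I_n) (r s : A) :
  (1%:M + r *: delta_mx i j) *m (1%:M + s *: delta_mx k l) =
  1%:M + r *: delta_mx i j + s *: delta_mx k l +
  (if j == k then (r * s) *: delta_mx i l else 0) :> 'M[A]_n.
Proof.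
by rewrite mulmxDl mul1mx mulmxDr mulmx1 mul_scale_delta -addrA [_ *: _ + (_ + _)]addrCA !addrA [1%:M + _ + _]addrAC.
Qed.

Lemma root_elem_generate (H : set E) : is_subgroup H ->
  (forall i j r, i != j -> H (root_elem i j r)) -> forall g, H g.
Proof.
move=> [H1 HV] Hroot g; have /asboolP gen := valP g.
have := gen [set x | exists2 h : E, H h & val h = x]; case.
- split; first split.
  + by exists 1%g.
  + by move=> x y [h Hh <-] [h' Hh' <-]; exists (h * h'^-1)%g => //; exact: HV.
  + move=> x [ij [r ->]]; exists (elementary ij r) => //.
    by rewrite elementary_root; apply: Hroot; exact: valP ij.
- by move=> h Hh /val_inj <-.
Qed.

Section Swap.
Variables (i j : 'I_n).
Hypothesis ij : i != j.

Definition swap_mx : 'M[A]_n := 1%:M + (-1 : A) *: delta_mx i i + (-1 : A) *: delta_mx j j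
  + (1 : A) *: delta_mx i j + (-1 : A) *: delta_mx j i.

Definition swap_sign (k : 'I_n) : A := if k == j then -1 else 1.

Lemma scale_delta_swap (k l : 'I_n) r :
  (r *: delta_mx k l) *m swap_mx = (r * swap_sign l) *: delta_mx k (tperm i j l).
Proof.
have ji : j != i by rewrite eq_sym.
rewrite /swap_mx !mulmxDr mulmx1 !mul_scale_delta /swap_sign.
have [->|li] := eqVneq l i.
  rewrite tpermL ?eqxx ?(negPf ij) !mulr1 mulrN1 scaleNr !addr0.
  by rewrite subrr add0r.
have [->|lj] := eqVneq l j.
  by rewrite tpermR !mulrN1 !scaleNr !addr0 subrr add0r.
by rewrite tpermD 1?eq_sym // !addr0 mulr1.
Qed.

Lemma swap_scale_delta (k l : 'I_n) r :
  swap_mx *m (r *: delta_mx (tperm i j k) l) = (swap_sign k * r) *: delta_mx k l.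
Proof.
have ji : j != i by rewrite eq_sym.
rewrite /swap_mx !mulmxDl mul1mx !mul_scale_delta /swap_sign.
have [->|ki] := eqVneq k i.
  rewrite tpermL ?eqxx ?(negPf ij) ?(negPf ji) !mul1r mulN1r scaleNr !addr0.
  by rewrite subrr add0r.
have [->|kj] := eqVneq k j.
  by rewrite tpermR ?eqxx ?(negPf ij) ?(negPf ji) !mulN1r !scaleNr !addr0 subrr add0r.
rewrite tpermD 1?eq_sym // ?[i == k]eq_sym ?[j == k]eq_sym ?(negPf ki) ?(negPf kj).
by rewrite !addr0 mul1r.
Qed.

Lemma swap_mxE :
  E_mx (root_elem i j (1 : A) * root_elem j i (- 1 : A)%R * root_elem i j (1 : A))%g
    = swap_mx.
Proof.
have ji : j != i by rewrite eq_sym.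
rewrite !E_mxM !root_elem_mx // mul_elementary eqxx.
rewrite [_ *m _]mulmxDr mulmx1 !mulmxDl mul1mx !mul_scale_delta !eqxx (negPf ji).
rewrite /swap_mx ?(negPf ij) !mulrN1 ?mulN1r ?mul1r ?mulr1 !scaleNr !scale1r ?addr0.
by rewrite !addrA [LHS]addrAC addrK [LHS](+%R.[ACl 1*4*5*2*3]).
Qed.

Lemma swap_root_elem k l r : k != l ->
  (root_elem k l r *
     (root_elem i j (1 : A) * root_elem j i (- 1 : A)%R * root_elem i j (1 : A)) =
   root_elem i j (1 : A) * root_elem j i (- 1 : A)%R * root_elem i j (1 : A) *
     root_elem (tperm i j k) (tperm i j l) (swap_sign k * r * swap_sign l)%R)%g.
Proof.
move=> kl; apply: E_mx_inj; rewrite E_mxM [RHS]E_mxM swap_mxE !root_elem_mx //; last first.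
  by rewrite (inj_eq perm_inj).
rewrite mulmxDl mul1mx scale_delta_swap mulmxDr mulmx1 swap_scale_delta !mulrA.
suff -> : swap_sign k * swap_sign k = 1 by rewrite mul1r.
by rewrite /swap_sign; case: ifP; rewrite ?mulrNN mulr1.
Qed.
End Swap.

Lemma root_elem_family : elementary_family root_elem.
Proof.
split.
- move=> i j r s ij; apply: E_mx_inj; rewrite E_mxM !root_elem_mx // mul_elementary.
  by rewrite eq_sym (negPf ij) addr0 scalerDl addrA.
- move=> i j k l r s ij kl jk il; apply: E_mx_inj; rewrite !E_mxM !root_elem_mx //.
  rewrite !mul_elementary (negPf jk) [l == i]eq_sym (negPf il) !addr0.
  exact: addrAC.
- move=> i j k r s ij jk ik; apply: E_mx_inj; rewrite !E_mxM !root_elem_mx //.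
  rewrite !mul_elementary eqxx [k == j]eq_sym (negPf jk) addr0.
  rewrite mulmxDr mulmx1 !mulmxDl mul1mx !mul_scale_delta [k == i]eq_sym (negPf ik) !addr0.
  by rewrite [RHS](+%R.[ACl 1*4*3*2]).
- exact: root_elem_generate.
- move=> i j ij; exists (root_elem i j (1 : A) * root_elem j i (- 1 : A)%R * root_elem i j (1 : A))%g => //.
  by move=> k l r kl; exists (swap_sign j k * r * swap_sign j l); exact: swap_root_elem.
Qed.

(** Generation as a ring, in the form of an induction principle. *)
Definition ring_generated (ts : seq A) : Prop :=
  forall S : set A, S 1 -> (forall x y, S x -> S y -> S (x - y)) ->
    (forall x y, S x -> S y -> S (x * y)) -> (forall t, t \in ts -> S t) ->
    forall x, S x.

Definition root_generators (ts : seq A) : seq E :=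
  [seq root_elem ij.1 ij.2 t | ij <- enum {: 'I_n * 'I_n}, t <- 1 :: ts].

(** The coefficients [r] for which all the [e i j r] lie in a given subgroup form a
    subring: products come from the commutator relation. *)
Lemma root_generators_generate (ts : seq A) : (2 < n)%N -> ring_generated ts ->
  smallest (@is_subgroup E) [set` root_generators ts] = setT.
Proof.
move=> n3 gen; apply/seteqP; split=> // g _ H [HG HK]; have eP := root_elem_family.
have [H1 HV] := HG.
have HVg x : H x -> H (x^-1)%g by move=> Hx; rewrite -[(x^-1)%g]mul1g; exact: HV.
have HM x y : H x -> H y -> H (x * y)%g.
  by move=> Hx Hy; rewrite -[y]invgK; apply: HV => //; exact: HVg.
apply: (root_elem_generate HG) => i j r ij; move: r i j ij.
suff : forall r, [set r | forall i j, i != j -> H (root_elem i j r)] r by [].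
have HK1 t i j : t \in 1 :: ts -> H (root_elem i j t).
  move=> tts; apply: HK; rewrite /=; apply/allpairsP.
  by exists ((i, j), t); rewrite mem_enum.
apply: gen => [|x y Hx Hy|x y Hx Hy|t tts] /= i j ij.
- by apply: HK1; rewrite mem_head.
- rewrite (elem_add eP) // (elem_opp eP) //; apply: HM; first exact: Hx.
  by apply: HVg; exact: Hy.
- have [|k] := @exists_notin _ [:: i; j]; first by rewrite card_ord.
  rewrite !inE !negb_or => /andP[ki kj].
  have ik : i != k by rewrite eq_sym.
  have -> : root_elem i j (x * y) =
      (root_elem i k x * root_elem k j y * (root_elem i k x)^-1 * (root_elem k j y)^-1)%g.
    by rewrite (elem_commutator eP) // !mulgK.
  by apply: (HV); [apply: (HV); [apply: HM; [exact: Hx|exact: Hy] | exact: Hx] | exact: Hy].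
- by apply: HK1; rewrite inE tts orbT.
Qed.

End ElementaryMatrices.

Section Parabolic.
Variables (A : nzRingType) (n : nat) (i k j : 'I_n).
Hypothesis uq : uniq [:: i; k; j].
Local Notation P := (ERm A 2).
Local Notation E := (elementary_group A n).

Definition two_index (a : 'I_2) : 'I_n := if a == 0 then i else k.

Definition two_embed : 'M[A]_(n, 2) := \matrix_(b, a) (b == two_index a)%:R.
Definition two_restrict : 'M[A]_(2, n) := \matrix_(a, b) (b == two_index a)%:R.
Definition coord_row : 'M[A]_(1, n) := \matrix_(a, b) (b == j)%:R.

Lemma two_index_inj : injective two_index.
Proof.
move: uq; rewrite /= !inE !negb_or => /andP[/andP[ik _] _].
move=> [[|[|//]] p] [[|[|//]] q]; rewrite /two_index /= => /eqP; rewrite ?(negPf ik) //.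
- by move=> _; apply: val_inj.
- by rewrite eq_sym (negPf ik).
- by move=> _; apply: val_inj.
Qed.

Lemma two_index_neq a : two_index a != j.
Proof.
move: uq; rewrite /= !inE !negb_or => /andP[/andP[_ ij] /andP[kj _]].
by rewrite /two_index; case: ifP.
Qed.

Lemma restrict_embed : two_restrict *m two_embed = 1%:M.
Proof.
apply/matrixP => a b; rewrite !mxE (bigD1 (two_index a)) //= big1 => [|c ca].
  by rewrite !mxE eqxx mul1r addr0 (inj_eq two_index_inj).
by rewrite !mxE (negPf ca) mul0r.
Qed.

Lemma coord_embed : coord_row *m two_embed = 0.
Proof.
apply/matrixP => a b; rewrite !mxE (bigD1 j) //= big1 => [|c cj].
  by rewrite !mxE eqxx mul1r addr0 eq_sym (negPf (two_index_neq b)).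
by rewrite !mxE (negPf cj) mul0r.
Qed.

(** The block matrix with rows [g v] and [0 1] on the coordinates [i], [k], [j],
    completed by the identity. *)
Definition parabolic_mx (g : 'M[A]_2) (v : 'cV[A]_2) : 'M[A]_n :=
  1%:M + two_embed *m (g - 1%:M) *m two_restrict + two_embed *m v *m coord_row.

Lemma parabolic_mxM g v g' v' : parabolic_mx g v *m parabolic_mx g' v' =
  parabolic_mx (g *m g') (v + g *m v').
Proof.
rewrite /parabolic_mx; set U := two_embed; set V := two_restrict; set c := coord_row.
have [x ->] : exists x, g = x + 1%:M by exists (g - 1%:M); rewrite subrK.
have [y ->] : exists y, g' = y + 1%:M by exists (g' - 1%:M); rewrite subrK.
have -> : (x + 1%:M) *m (y + 1%:M) - 1%:M = x *m y + x + y.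
  by rewrite mulmxDr mulmx1 mulmxDl mul1mx [_ + (x + _)]addrA addrK addrAC.
rewrite !addrK !mulmxDl !mulmxDr !mul1mx !mulmxDl.
have VU m (w : 'M[A]_(2, m)) : V *m (U *m w) = w.
  by rewrite mulmxA restrict_embed mul1mx.
have cU m (w : 'M[A]_(2, m)) : c *m (U *m w) = 0.
  by rewrite mulmxA coord_embed mul0mx.
rewrite !mulmx1 -!mulmxA !VU !cU !mulmx0 !addr0 !addrA.
by rewrite [LHS](+%R.[ACl 1*5*4*2*7*6*3]).
Qed.

Lemma embed_delta m (w : 'M[A]_(m, n)) (f : 'I_m -> 'I_n) (r : A) a b :
  w = \matrix_(a', b') (b' == f a')%:R ->
  two_embed *m (r *: delta_mx a b) *m w = r *: delta_mx (two_index a) (f b).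
Proof.
move=> ->; apply/matrixP => c d; rewrite !mxE (bigD1 b) //= big1 => [|b' b'b].
  rewrite !mxE (bigD1 a) //= big1 => [|a' a'a].
    rewrite !mxE !eqxx mulr1 !addr0 /=.
    by case: (c == _); case: (d == _); rewrite ?mulr1 ?mulr0 ?mul1r ?mul0r.
  by rewrite !mxE (negPf a'a) mulr0 mulr0.
by rewrite !mxE big1 ?mul0r // => a' _; rewrite !mxE (negPf b'b) andbF !mulr0.
Qed.

Lemma parabolic_mx1 : parabolic_mx 1%:M 0 = 1%:M.
Proof. by rewrite /parabolic_mx subrr !mulmx0 !mul0mx !addr0. Qed.

Lemma parabolic_mx_lin a b r : a != b ->
  parabolic_mx (1%:M + r *: delta_mx a b) 0 =
  E_mx (root_elem (two_index a) (two_index b) r).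
Proof.
move=> ab; rewrite root_elem_mx ?(inj_eq two_index_inj) // /parabolic_mx.
rewrite [1%:M + _ in X in _ + X + _]addrC addrK mulmx0 mul0mx addr0.
by rewrite (@embed_delta _ _ two_index).
Qed.

Lemma parabolic_mx_vec a r :
  parabolic_mx 1%:M (r *: delta_mx a 0) = E_mx (root_elem (two_index a) j r).
Proof.
rewrite root_elem_mx ?two_index_neq // /parabolic_mx subrr mulmx0 mul0mx addr0.
by rewrite (@embed_delta _ _ (fun=> j)).
Qed.

Lemma parabolic_exists (x : P) :
  exists g : E, E_mx g = parabolic_mx (E_mx (ERm_lin x)) (ERm_vec x).
Proof.
have lin (h : elementary_group A 2) : exists g : E, E_mx g = parabolic_mx (E_mx h) 0.
  move: h; apply: root_elem_generate; first split.
  - by exists 1%g; rewrite E_mx1 parabolic_mx1.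
  - move=> h h' [g gh] [g' gh']; exists (g * g'^-1)%g; rewrite E_mxM gh.
    have -> : E_mx (g'^-1)%g = parabolic_mx (E_mx (h'^-1)%g) 0.
      have inv : parabolic_mx (E_mx h') 0 *m parabolic_mx (E_mx (h'^-1)%g) 0 = 1%:M.
        by rewrite parabolic_mxM mulmx0 addr0 -E_mxM mulgV E_mx1 parabolic_mx1.
      by rewrite -[LHS]mulmx1 -inv -gh' mulmxA -E_mxM mulVg E_mx1 mul1mx.
    by rewrite parabolic_mxM mulmx0 addr0 -E_mxM.
  - move=> a b r ab; exists (root_elem (two_index a) (two_index b) r).
    by rewrite -parabolic_mx_lin // root_elem_mx.
have vec (v : 'cV[A]_2) : exists g : E, E_mx g = parabolic_mx 1%:M v.
  exists (root_elem (two_index 0) j (v 0 0) * root_elem (two_index 1%R) j (v 1%R 0))%g.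
  rewrite E_mxM -!parabolic_mx_vec parabolic_mxM mulmx1 mul1mx; congr parabolic_mx.
  apply/matrixP => a b; rewrite [b]ord1 !mxE.
  rewrite eqxx !andbT; have [->|a0] := eqVneq a 0; first by rewrite mulr1 mulr0 addr0.
  suff -> : a = 1 by rewrite mulr0 mulr1 add0r.
  by apply: val_inj; case: a a0 => [[|[|//]] p].
case: x => [[h v]]; rewrite /ERm_lin /ERm_vec /=.
have [g gh] := lin h; have [g' g'v] := vec v; exists (g' * g)%g.
by rewrite E_mxM gh g'v parabolic_mxM mul1mx mulmx0 addr0.
Qed.

Definition parabolic_hom (x : P) : E := projT1 (cid (parabolic_exists x)).

Lemma parabolic_homE x :
  E_mx (parabolic_hom x) = parabolic_mx (E_mx (ERm_lin x)) (ERm_vec x).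
Proof. by rewrite /parabolic_hom; case: cid. Qed.

Lemma parabolic_homM x y :
  parabolic_hom (x * y)%g = (parabolic_hom x * parabolic_hom y)%g.
Proof.
by apply: E_mx_inj; rewrite E_mxM !parabolic_homE parabolic_mxM -E_mxM.
Qed.

Lemma parabolic_standard (ts : seq A) s : s \in standard_subset 2 ts ->
  exists p q r, [/\ p != q, p \in [:: i; k], q \in [:: i; k; j] &
                    parabolic_hom s = root_elem p q r].
Proof.
have two_in a : two_index a \in [:: i; k].
  by rewrite /two_index !inE; case: ifP; rewrite eqxx ?orbT.
have two_in' a : two_index a \in [:: i; k; j].
  by have := two_in a; rewrite !inE => /orP[] ->; rewrite ?orbT.
rewrite mem_cat => /orP[] /allpairsP[[x r] /= [_ _ ->]].
  exists (two_index (val x).1), (two_index (val x).2), r; split=> //.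
    by rewrite (inj_eq two_index_inj); exact: valP x.
  apply: E_mx_inj; rewrite parabolic_homE -parabolic_mx_lin; last exact: valP x.
  by [].
exists (two_index x), j, r; split=> //; first exact: two_index_neq.
  by rewrite !inE eqxx !orbT.
by apply: E_mx_inj; rewrite parabolic_homE -parabolic_mx_vec.
Qed.

(** A vector moved by at most [D] by the standard subset is within [D / eps] of the
    vectors fixed by [A^2], hence moved by at most [2 D / eps] by all of [A^2]. *)
Lemma relative_T_root_gap (R : realType) (B : completeNormedModType R)
    (ts : seq A) (tau : E -> B -> B) :
  uniformly_convex R B -> isometric_representation tau ->
  relative_T (uniformly_convex R) (Rm_subgroup A 2) (standard_subset 2 ts) ->
  root_spectral_gap (@root_elem A n) i k j tau.
Proof.
move=> Buc tauP relT.
have tau_rep : isometric_representation (fun x : P => tau (parabolic_hom x)).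
  split=> [g|g x|g|g h x]; [exact: rep_linear | exact: rep_isometry | exact: rep_surjective |].
  by rewrite parabolic_homM (rep_mul tauP).
have [eps [eps0 gap]] := relT B Buc _ tau_rep.
exists (2 / eps), [seq parabolic_hom s | s <- standard_subset 2 ts]; split.
  by move=> _ /mapP[s sK ->]; exact: parabolic_standard sK.
move=> x D D0 xD r; set g := root_elem i j r.
have [m mM mg] : exists2 m, Rm_subgroup A 2 m & parabolic_hom m = g.
  exists (MkERm (1%g, r *: delta_mx 0 0)) => //.
  by apply: E_mx_inj; rewrite parabolic_homE parabolic_mx_vec.
set F := fixed_vectors (fun x : P => tau (parabolic_hom x)) (Rm_subgroup A 2).
have max_le : \big[Num.max/0]_(s <- standard_subset 2 ts)
    `|tau (parabolic_hom s) x - x| <= D.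
  rewrite big_seq_cond; elim/big_ind: _ => // [u w uD wD|s]; first by rewrite ge_max uD.
  by rewrite andbT => sK; apply: xD; exact: map_f.
have tauB h u w : tau h (u - w) = tau h u - tau h w.
  have := rep_linear tauP h (-1) w u.
  by rewrite !scaleN1r [- w + u]addrC [- tau h w + _]addrC.
have quot : `|tau g x - x| / 2 <= norm_in_quotient F x.
  apply: lb_le_inf.
    by exists `|x|, x => // h _; rewrite tauB !subrr.
  move=> _ [y /= yF <-]; rewrite ler_pdivrMr // mulrC.
  have -> : tau g x - x = tau g y - y.
    have := yF m mM; rewrite /= mg tauB => E.
    have -> : tau g y - y = (tau g y - tau g x) + (tau g x - y) by linear_identity R B.
    by rewrite E; linear_identity R B.
  by apply: le_trans (ler_normB _ _) _; rewrite (rep_isometry tauP); lra.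
have := le_trans (gap x) max_le; rewrite mulrC -ler_pdivlMr // => q_le.
have -> : 2 / eps * D = D / eps * 2 by rewrite mulrAC [2 * D]mulrC mulrAC.
by rewrite -ler_pdivrMr //; exact: le_trans quot q_le.
Qed.

End Parabolic.

Theorem relative_T_property_F (R : realType) (A : nzRingType) (ts : seq A) :
  ring_generated ts ->
  relative_T (uniformly_convex R) (Rm_subgroup A 2) (standard_subset 2 ts) ->
  forall n, (4 <= n)%N -> property_F (uniformly_convex R) (elementary_group A n).
Proof.
move=> gen relT n n4; split=> [|B Buc a aP].
  by exists (root_generators n ts); apply: root_generators_generate => //; exact: ltnW.
apply: (bounded_root_subgroups_fixed_point Buc (root_elem_family A n) _ aP).
  by rewrite card_ord.
move=> i j ij; apply: (cocycle_bounded Buc (root_elem_family A n) aP) => //.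
  by move=> i' k j' uq; apply: (relative_T_root_gap uq Buc (linear_part_rep Buc aP) relT).
by rewrite card_ord.
Qed.

(** * Square summable functions *)

Lemma cvg_finite_sum (R : realType) (S J : Type) (F : set_system S)
    (FF : Filter F) (r : seq J) (f : J -> S -> R) (l : J -> R) :
  (forall j, f j @ F --> l j) ->
  (fun x => \sum_(j <- r) f j x) @ F --> \sum_(j <- r) l j.
Proof.
move=> fl; elim: r => [|j r IH].
  by under eq_fun do rewrite big_nil; rewrite big_nil; exact: cvg_cst.
by under eq_fun do rewrite big_cons; rewrite big_cons; exact: cvgD.
Qed.

Section SquareSummable.
Variables (R : realType) (T : nat -> finType) (X : completeNormedModType R).
Local Notation I := {k : nat & T k}.

Definition block_sum (f : I -> X) (k : nat) : R :=
  \sum_(h : T k) `|f (Tagged T h)| ^+ 2.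

Definition partial_sum (f : I -> X) (K : nat) : R :=
  \sum_(k < K) block_sum f k.

Definition square_summable : {pred (I -> X)} :=
  [pred f | `[< exists C, forall K, partial_sum f K <= C >]].

Lemma block_sum_ge0 f k : 0 <= block_sum f k.
Proof. by apply: sumr_ge0 => h _; exact: sqr_ge0. Qed.

Lemma partial_sum_ge0 f K : 0 <= partial_sum f K.
Proof. by apply: sumr_ge0 => k _; exact: block_sum_ge0. Qed.

Lemma partial_sumS f K : partial_sum f K.+1 = partial_sum f K + block_sum f K.
Proof. by rewrite /partial_sum big_ord_recr. Qed.

Lemma partial_sum_homo f : {homo partial_sum f : K L / (K <= L)%N >-> K <= L}.
Proof.
apply: homo_leq => [//|y x z|K]; first exact: le_trans.
by rewrite partial_sumS lerDl block_sum_ge0.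
Qed.

Lemma partial_sum0 K : partial_sum (0 : I -> X) K = 0.
Proof.
rewrite /partial_sum big1 // => k _; rewrite /block_sum big1 // => h _.
by rewrite [X in `|X|](_ : _ = 0) // normr0 expr0n.
Qed.

Lemma partial_sumZ (c : R) f K :
  partial_sum (c *: f) K = c ^+ 2 * partial_sum f K.
Proof.
rewrite /partial_sum mulr_sumr; apply: eq_bigr => k _.
rewrite /block_sum mulr_sumr; apply: eq_bigr => h _.
by rewrite [(c *: f) _]/(c *: f (Tagged T h)) normrZ exprMn real_normK ?num_real.
Qed.

(** A weighted form of the triangle inequality. It is additive in the squares,
    so it can be summed over the indices; optimizing the weights [a] and [b]
    afterwards gives Minkowski's inequality. *)
Lemma partial_sumD (a b : R) f g K : 0 < a -> 0 < b ->
  partial_sum (f + g) K <= (a + b) * (partial_sum f K / a + partial_sum g K / b).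
Proof.
move=> a0 b0; rewrite /partial_sum /block_sum !mulr_suml -big_split mulr_sumr /=.
apply: ler_sum => k _; rewrite !mulr_suml -big_split mulr_sumr /=.
apply: ler_sum => h _; rewrite [(f + g) _]/(f _ + g _).
set x := f _; set y := g _.
apply: (@le_trans _ _ ((`|x| + `|y|) ^+ 2)).
  by rewrite ler_pXn2r ?nnegrE ?addr_ge0 // ler_normD.
have := sqr_ge0 (b * `|x| - a * `|y|).
move: (`|x|) (`|y|) => u v; rewrite -subr_ge0 => uv; rewrite -subr_ge0.
suff -> : (a + b) * (u ^+ 2 / a + v ^+ 2 / b) - (u + v) ^+ 2 =
   (b * u - a * v) ^+ 2 / (a * b) by rewrite divr_ge0 ?sqr_ge0 // mulr_ge0 ?ltW.
by field; rewrite !gt_eqF.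
Qed.

Lemma square_summableP f :
  reflect (exists C, forall K, partial_sum f K <= C) (f \in square_summable).
Proof. exact: asboolP. Qed.

Lemma square_summable_submod : submod_closed square_summable.
Proof.
split=> [|c f g /square_summableP[C fC] /square_summableP[D gD]].
  by apply/square_summableP; exists 0 => K; rewrite partial_sum0.
apply/square_summableP; exists (2 * (c ^+ 2 * C + D)) => K.
apply: (le_trans (@partial_sumD 1 1 _ _ _ ltr01 ltr01)).
rewrite !divr1 partial_sumZ ler_pM2l // lerD // ler_wpM2l ?sqr_ge0 //.
Qed.

HB.instance Definition _ :=
  GRing.isSubmodClosed.Build R (I -> X) square_summable square_summable_submod.

Record ell2 := Ell2 { ell2_fun : I -> X; _ : ell2_fun \in square_summable }.

HB.instance Definition _ := [isSub for ell2_fun].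
HB.instance Definition _ := gen_eqMixin ell2.
HB.instance Definition _ := gen_choiceMixin ell2.
HB.instance Definition _ := [SubChoice_isSubLmodule of ell2 by <:].

Implicit Types f g : ell2.

Definition ell2_norm f : R := Num.sqrt (sup (range (partial_sum (val f)))).

Lemma ell2_has_sup f : has_sup (range (partial_sum (val f))).
Proof.
split; first by exists (partial_sum (val f) 0%N), 0%N.
by have /square_summableP[C fC] := valP f; exists C => _ [K _ <-].
Qed.

Lemma ell2_norm_ge0 f : 0 <= ell2_norm f.
Proof. exact: sqrtr_ge0. Qed.

Lemma partial_sum_le_norm f K : partial_sum (val f) K <= ell2_norm f ^+ 2.
Proof.
have Kle : partial_sum (val f) K <= sup (range (partial_sum (val f))).
  by apply: ub_le_sup; [case: (ell2_has_sup f) | exists K].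
by rewrite sqr_sqrtr //; apply: le_trans Kle; exact: partial_sum_ge0.
Qed.

Lemma ell2_norm_le f (c : R) : 0 <= c ->
  (forall K, partial_sum (val f) K <= c ^+ 2) -> ell2_norm f <= c.
Proof.
move=> c0 fc; rewrite -(ler_pXn2r (n := 2)) ?nnegrE ?ell2_norm_ge0 //.
have supc : sup (range (partial_sum (val f))) <= c ^+ 2.
  by apply: ge_sup; [case: (ell2_has_sup f) | move=> _ [K _ <-]].
rewrite sqr_sqrtr //; apply: le_trans (partial_sum_ge0 (val f) 0) _.
by apply: ub_le_sup; [case: (ell2_has_sup f) | exists 0%N].
Qed.

Lemma ell2_normD f g : ell2_norm (f + g) <= ell2_norm f + ell2_norm g.
Proof.
apply/ler_addgt0Pr => e e0.
have e20 : 0 < e / 2 by rewrite divr_gt0.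
set a := ell2_norm f + e / 2; set b := ell2_norm g + e / 2.
have a0 : 0 < a by rewrite ltr_wpDl ?ell2_norm_ge0.
have b0 : 0 < b by rewrite ltr_wpDl ?ell2_norm_ge0.
have -> : ell2_norm f + ell2_norm g + e = a + b by rewrite /a /b; lra.
apply: ell2_norm_le => [|K]; first by rewrite addr_ge0 // ltW.
apply: (le_trans (partial_sumD _ _ _ a0 b0)).
have ab0 : 0 < a + b by exact: addr_gt0.
rewrite expr2 ler_pM2l //.
have sq h (c : R) : 0 < c -> ell2_norm h <= c -> partial_sum (val h) K / c <= c.
  move=> c0 hc; rewrite ler_pdivrMr //; apply: le_trans (partial_sum_le_norm _ _) _.
  by rewrite -expr2 ler_pXn2r ?nnegrE ?ell2_norm_ge0 ?(ltW c0).
by apply: lerD; apply: sq => //; rewrite lerDl ltW.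
Qed.

Lemma ell2_normZ (c : R) f : ell2_norm (c *: f) = `|c| * ell2_norm f.
Proof.
have le (d : R) h : ell2_norm (d *: h) <= `|d| * ell2_norm h.
  apply: ell2_norm_le => [|K]; first by rewrite mulr_ge0 ?ell2_norm_ge0.
  rewrite [val _]/(d *: val h) partial_sumZ exprMn real_normK ?num_real //.
  by rewrite ler_wpM2l ?sqr_ge0 ?partial_sum_le_norm.
apply/eqP; rewrite eq_le le /=.
have [->|c0] := eqVneq c 0; first by rewrite normr0 mul0r ell2_norm_ge0.
have := le c^-1 (c *: f); rewrite scalerA mulVf // scale1r normfV.
by rewrite mulrC ler_pdivlMr ?normr_gt0 // mulrC.
Qed.

Lemma block_term_le (F : I -> X) k (h : T k) :
  `|F (Tagged T h)| ^+ 2 <= block_sum F k.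
Proof.
by rewrite /block_sum (bigD1 h) //= lerDl sumr_ge0 // => ? _; exact: sqr_ge0.
Qed.

Lemma block_sum_le_partial (F : I -> X) k : block_sum F k <= partial_sum F k.+1.
Proof. by rewrite partial_sumS lerDr partial_sum_ge0. Qed.

Lemma ell2_eval_le f i : `|val f i| <= ell2_norm f.
Proof.
case: i => k h; rewrite -(ler_pXn2r (n := 2)) ?nnegrE ?ell2_norm_ge0 //.
apply: le_trans (partial_sum_le_norm f k.+1).
exact: le_trans (block_term_le (val f) h) (block_sum_le_partial _ _).
Qed.

Lemma ell2_norm0_eq0 f : ell2_norm f = 0 -> f = 0.
Proof.
move=> f0; apply: val_inj; apply/funext => i; apply/eqP.
by rewrite -normr_le0 -f0 ell2_eval_le.
Qed.

HB.instance Definition _ := Lmodule_isNormed.Build R ell2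
  ell2_normD ell2_normZ ell2_norm0_eq0.

Lemma ell2_normE f : `|f| = ell2_norm f.
Proof. by []. Qed.

Lemma partial_sum_cvg (F : set_system ell2) (FF : ProperFilter F)
    (u : ell2) (g : I -> X) K :
  (forall i, (fun f : ell2 => val f i) @ F --> g i) ->
  (fun f : ell2 => partial_sum (val u - val f) K) @ F --> partial_sum (val u - g) K.
Proof.
move=> Fg; rewrite /partial_sum /block_sum.
apply: cvg_finite_sum => k; apply: cvg_finite_sum => h.
have uf : (fun f : ell2 => `|(val u - val f) (Tagged T h)|) @ F -->
    `|(val u - g) (Tagged T h)|.
  by apply: cvg_norm; apply: cvgB; [exact: cvg_cst | exact: Fg].
by rewrite expr2; under eq_fun do rewrite expr2; exact: cvgM.
Qed.

Lemma ell2_complete (F : set_system ell2) : ProperFilter F -> cauchy F -> cvg F.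
Proof.
move=> FF /cauchy_ballP Fc.
have Fpair (e : R) : 0 < e -> exists2 A, F A & forall f g, A f -> A g -> `|f - g| < e.
  move=> e0; have [[A B] /= [FA FB] AB] := Fc e e0.
  exists (A `&` B); first exact: filterI.
  by move=> f g [Af _] [_ Bg]; have := AB (f, g) (conj Af Bg); rewrite -ball_normE.
pose ev i (f : ell2) : X := val f i.
have ev_cvg i : cvg (ev i @ F).
  apply: cauchy_cvg; apply/cauchy_ballP => e e0; have [A FA Ae] := Fpair e e0.
  exists (ev i @` A, ev i @` A) => /=.
    by split; apply: (@filterS _ F _ A _ _ FA) => f Af; exists f.
  move=> [_ _] /= [[f Af <-] [g Ag <-]]; rewrite -ball_normE /ball_ /=.
  exact: le_lt_trans (ell2_eval_le (f - g) i) (Ae _ _ Af Ag).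
pose g i : X := lim (ev i @ F).
have evg i : ev i @ F --> g i by exact: ev_cvg.
have near_g (e : R) : 0 < e -> exists2 A, F A &
    forall f, A f -> forall K, partial_sum (val f - g) K <= e ^+ 2.
  move=> e0; have [A FA Ae] := Fpair e e0; exists A => // f Af K.
  have fg := @partial_sum_cvg F FF f g K evg.
  rewrite -(cvg_lim _ fg) //; apply: limr_le; first by apply/cvg_ex; eexists; exact: fg.
  apply: filterS FA => f' Af'; apply: le_trans (partial_sum_le_norm (f - f') K) _.
  by rewrite ler_pXn2r ?nnegrE ?ell2_norm_ge0 ?(ltW e0) // ltW // Ae.
have gS : g \in square_summable.
  have [A FA Ag] := near_g 1 ltr01; have [f Af] := filter_ex FA.
  have fgS : val f - g \in square_summable.
    by apply/square_summableP; exists (1 ^+ 2) => K; exact: Ag.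
  by rewrite -(subKr (val f) g) rpredB // (valP f).
apply/cvg_ex; exists (Ell2 gS); apply/cvgrPdist_le => e e0.
have [A FA Ag] := near_g e e0; apply: filterS FA => f Af.
by rewrite distrC; apply: ell2_norm_le => [|K]; [exact: ltW | exact: Ag].
Qed.

HB.instance Definition _ := Uniform_isComplete.Build ell2 ell2_complete.

Definition ell2_banach : completeNormedModType R := ell2.

End SquareSummable.

(** * Uniform convexity of the space of square summable functions *)

(** The form of uniform convexity that can be summed over coordinates. *)
Definition convexity_inequality (R : realType) (B : completeNormedModType R) : Prop :=
  forall e : R, 0 < e -> exists k : R, 0 < k /\ forall x y : B,
    `|x + y| ^+ 2 + k * `|x - y| ^+ 2 <= (2 + k * e ^+ 2) * (`|x| ^+ 2 + `|y| ^+ 2).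

(** The inequality holds trivially when [|x - y|] is small compared with [|x|] and
    [|y|]. Otherwise either these two norms differ much, and the identity
    [(s + t)^2 + (s - t)^2 = 2 (s^2 + t^2)] for them gains, or they are comparable and
    uniform convexity gains. *)
Lemma uniformly_convex_inequality (R : realType) (B : completeNormedModType R) :
  uniformly_convex R B -> convexity_inequality B.
Proof.
move=> Buc e e0; have [k0 [k00 k0P]] := uniformly_convex_ball Buc e0.
pose k := Num.min k0 1.
have k_gt0 : 0 < k by rewrite lt_min k00 ltr01.
have kk0 : k <= k0 by rewrite ge_min lexx.
have k1 : k <= 1 by rewrite ge_min lexx orbT.
have kP (D : R) (x y : B) : `|x| <= D -> `|y| <= D -> e * D <= `|x - y| ->
    `|x + y| <= 2 * (1 - k) * D.
  move=> xD yD xy; apply: le_trans (k0P D x y xD yD xy) _.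
  by apply: ler_wpM2r; [exact: le_trans xD | lra].
exists (k ^+ 2 / 16); split=> [|x y]; first by rewrite divr_gt0 // exprn_gt0.
wlog xy : x y / `|x| <= `|y|.
  move=> H; have [xy|/ltW xy] := leP `|x| `|y|; first exact: H.
  by have := H y x xy; rewrite [`|x| ^+ 2 + _]addrC [y + x]addrC [`|y - x|]distrC.
have sD := xy; have pD := ler_normD x y; have qD := ler_normB x y.
have kD := kP `|y| x y xy (lexx _).
move: sD pD qD kD; have := normr_ge0 x; have := normr_ge0 (x + y).
have := normr_ge0 (x - y); clear k0P kP xy.
move: `|x + y| `|x - y| `|x| `|y| => p q s D q0 p0 s0 sD pD qD kD.
have p2 : p ^+ 2 <= (s + D) ^+ 2 by rewrite ler_sqr ?nnegrE // addr_ge0 // (le_trans s0).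
have q2 : q ^+ 2 <= (s + D) ^+ 2 by rewrite ler_sqr ?nnegrE // addr_ge0 // (le_trans s0).
have D0 : 0 <= D by exact: le_trans sD.
set c := k ^+ 2 / 16; have c0 : 0 <= c by rewrite divr_ge0 // sqr_ge0.
have [small|big] := leP (q ^+ 2) (e ^+ 2 * (s ^+ 2 + D ^+ 2)).
  have : c * q ^+ 2 <= c * (e ^+ 2 * (s ^+ 2 + D ^+ 2)) by rewrite ler_wpM2l.
  have : (s + D) ^+ 2 <= 2 * (s ^+ 2 + D ^+ 2) by have := sqr_ge0 (s - D); lra.
  lra.
have extra : 0 <= c * e ^+ 2 * (s ^+ 2 + D ^+ 2).
  by apply: mulr_ge0; [rewrite mulr_ge0 ?sqr_ge0 | rewrite addr_ge0 ?sqr_ge0].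
suff : p ^+ 2 + c * q ^+ 2 <= 2 * (s ^+ 2 + D ^+ 2) by lra.
have [far|near] := leP (k / 2 * D) (D - s).
  have kD0 : 0 <= k / 2 * D by rewrite mulr_ge0 //; lra.
  have far2 : (k / 2 * D) ^+ 2 <= (D - s) ^+ 2 by rewrite ler_sqr ?nnegrE //; lra.
  have : (s + D) ^+ 2 <= (2 * D) ^+ 2 by rewrite ler_sqr ?nnegrE ?addr_ge0 ?mulr_ge0 //; lra.
  move=> /(le_trans q2) /(ler_wpM2l c0); rewrite /c; lra.
have eD : e * D <= q.
  have eD0 : 0 <= e * D by rewrite mulr_ge0 // ltW.
  have : (e * D) ^+ 2 <= q ^+ 2.
    by apply: le_trans (ltW big); rewrite exprMn ler_wpM2l ?sqr_ge0 // lerDr sqr_ge0.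
  by rewrite ler_sqr.
have {}kD := kD eD.
have p2' : p ^+ 2 <= (2 * (1 - k) * D) ^+ 2.
  by rewrite ler_sqr ?nnegrE //; apply: le_trans p0 kD.
have s2 : ((1 - k / 2) * D) ^+ 2 <= s ^+ 2.
  by rewrite ler_sqr ?nnegrE //; [lra | rewrite mulr_ge0 //; lra].
have : (s + D) ^+ 2 <= (2 * D) ^+ 2 by rewrite ler_sqr ?nnegrE ?addr_ge0 ?mulr_ge0 //; lra.
move=> /(le_trans q2) /(ler_wpM2l c0) cq.
have : (k ^+ 2 * D ^+ 2) <= k * D ^+ 2.
  by rewrite ler_wpM2r ?sqr_ge0 // expr2 ler_piMl // ltW.
have : 0 <= k * D ^+ 2 by rewrite mulr_ge0 ?sqr_ge0 // ltW.
move: cq p2' s2; rewrite /c !exprMn; lra.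
Qed.

Lemma inequality_uniformly_convex (R : realType) (B : completeNormedModType R) :
  convexity_inequality B -> uniformly_convex R B.
Proof.
move=> Bineq.
have /choice[delta deltaP] : forall t : R, exists d : R, 0 < t -> 0 < d /\
    forall x y : B, `|x| = 1 -> `|y| = 1 -> `|x - y| = t -> d <= 1 - `|x + y| / 2.
  move=> t; have [t0|_] := ltP 0 t; last by exists 0.
  have t20 : 0 < t / 2 by rewrite divr_gt0.
  have [k [k0 kP]] := Bineq _ t20.
  exists (k * t ^+ 2 / 16) => _; split=> [|x y x1 y1 xy].
    by rewrite divr_gt0 // mulr_gt0 // exprn_gt0.
  have := kP x y; rewrite x1 y1 xy expr1n exprMn => ineq.
  rewrite leNgt; apply/negP => xy_big; set p := `|x + y| in ineq xy_big.
  set c := k * t ^+ 2 in xy_big.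
  have c0 : 0 < c by rewrite mulr_gt0 // exprn_gt0.
  have p0 : 0 <= p by exact: normr_ge0.
  have {}ineq : p ^+ 2 <= 4 - c / 2 by rewrite /c; lra.
  have c8 : c <= 8 by have := sqr_ge0 p; lra.
  have pc : 2 - c / 8 < p by lra.
  have : (2 - c / 8) ^+ 2 < p ^+ 2 by rewrite ltr_sqr ?nnegrE //; lra.
  by have := sqr_ge0 c; lra.
exists delta; split=> [t /andP[/deltaP[]//]|x y xy x1 y1].
have xy0 : 0 < `|x - y| by rewrite normr_gt0 subr_eq0; apply/eqP.
by have [_] := deltaP _ xy0; exact.
Qed.

(** Day's theorem: the inequality is additive over the indices. *)
Lemma ell2_uniformly_convex (R : realType) (T : nat -> finType)
    (X : completeNormedModType R) :
  uniformly_convex R X -> uniformly_convex R (ell2_banach T X).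
Proof.
move=> /uniformly_convex_inequality Xineq.
apply: inequality_uniformly_convex => e e0; have [k [k0 kP]] := Xineq e e0.
exists k; split=> // f g.
pose F := val (f : ell2 T X); pose H := val (g : ell2 T X).
have partial K : partial_sum (F + H) K + k * partial_sum (F - H) K <=
    (2 + k * e ^+ 2) * (partial_sum F K + partial_sum H K).
  rewrite /partial_sum mulr_sumr -!big_split mulr_sumr /=; apply: ler_sum => m _.
  rewrite /block_sum mulr_sumr -!big_split mulr_sumr /=; apply: ler_sum => h _.
  exact: kP.
set C := (2 + k * e ^+ 2) * (`|f| ^+ 2 + `|g| ^+ 2).
have C0 : 0 <= 2 + k * e ^+ 2 by rewrite addr_ge0 // mulr_ge0 ?sqr_ge0 // ltW.
have both K L : partial_sum (F + H) K + k * partial_sum (F - H) L <= C.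
  have [KM LM] := (leq_maxl K L, leq_maxr K L).
  apply: le_trans (le_trans (partial (maxn K L)) _); last first.
    by apply: ler_wpM2l => //; apply: lerD; exact: partial_sum_le_norm.
  by apply: lerD; [exact: partial_sum_homo | apply: ler_wpM2l; [exact: ltW | exact: partial_sum_homo]].
have norm2_le (u : ell2 T X) c : (forall K, partial_sum (val u) K <= c) ->
    ell2_norm u ^+ 2 <= c.
  move=> uc; have c0 : 0 <= c by exact: le_trans (partial_sum_ge0 (val u) 0) (uc 0%N).
  rewrite -[c]sqr_sqrtr // ler_sqr ?nnegrE ?sqrtr_ge0 ?ell2_norm_ge0 //.
  by apply: ell2_norm_le => [|K]; [exact: sqrtr_ge0 | rewrite sqr_sqrtr].
have diff K : k * `|f - g| ^+ 2 <= C - partial_sum (F + H) K.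
  rewrite mulrC -ler_pdivlMr //; apply: norm2_le => L.
  by rewrite ler_pdivlMr // mulrC lerBrDl; exact: both.
rewrite -lerBrDr; apply: norm2_le => K.
by have := diff K; rewrite lerBrDl addrC -lerBrDl.
Qed.

(** * A uniform spectral gap over all finite quotients *)

Section UniformDisplacement.
Variables (R : realType) (Gamma : groupType) (X : completeNormedModType R).

Definition displacement (H : finGroupType) (f : H -> X) (g : H) : R :=
  \sum_(h : H) `|f (h * g)%g - f h| ^+ 2.

Definition group_hom (H : finGroupType) (psi : Gamma -> H) : Prop :=
  forall x y, psi (x * y)%g = (psi x * psi y)%g.

Lemma displacement_ge0 (H : finGroupType) (f : H -> X) g : 0 <= displacement f g.
Proof. by apply: sumr_ge0 => h _; exact: sqr_ge0. Qed.

Section SumOfQuotients.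
Variables (T : nat -> finGroupType) (psi : forall k, Gamma -> T k).
Hypothesis psiM : forall k, group_hom (psi k).
Local Notation I := {k : nat & T k}.
Implicit Types F H : I -> X.

Lemma psi1 k : psi k 1%g = 1%g.
Proof. by apply: (mulgI (psi k 1%g)); rewrite -psiM !mulg1. Qed.

Definition translate (g : Gamma) F : I -> X :=
  fun i => F (Tagged T (tagged i * psi (tag i) g)%g).

Lemma translateM g g' F : translate g (translate g' F) = translate (g * g')%g F.
Proof. by apply/funext => -[k h]; rewrite /translate /= psiM mulgA. Qed.

Lemma translate1 F : translate 1%g F = F.
Proof. by apply/funext => -[k h]; rewrite /translate /= psi1 mulg1. Qed.

Lemma translateB g F H : translate g (F - H) = translate g F - translate g H.
Proof. by []. Qed.

Lemma translate_block g F k : block_sum (translate g F) k = block_sum F k.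
Proof.
rewrite /block_sum [RHS](reindex_inj (mulIg (psi k g))) /=.
by apply: eq_bigr.
Qed.

Lemma translate_partial_sum g F : partial_sum (translate g F) = partial_sum F.
Proof. by apply/funext => K; apply: eq_bigr => k _; exact: translate_block. Qed.

Lemma translate_summable g F : F \in @square_summable R T X ->
  translate g F \in @square_summable R T X.
Proof.
by move=> /square_summableP[C FC]; apply/square_summableP; exists C; rewrite translate_partial_sum.
Qed.

Variable Phi : I -> X.
(** [Phi] itself need not be square summable: it is a potential, on all functions, for a
    cocycle with values in the square summable ones. *)
Definition coboundary (g : Gamma) : I -> X := translate g Phi - Phi.

Lemma coboundaryM g g' : coboundary (g * g')%g = translate g (coboundary g') + coboundary g.
Proof. by rewrite /coboundary translateB translateM addrA subrK. Qed.

Variable K : seq Gamma.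
Hypothesis K_generates : smallest (@is_subgroup Gamma) [set` K] = setT.
Hypothesis K_summable : forall s, s \in K -> coboundary s \in @square_summable R T X.

Lemma coboundary_summable g : coboundary g \in @square_summable R T X.
Proof.
have : [set: Gamma] g by [].
rewrite -K_generates => /(_ [set g | coboundary g \in @square_summable R T X]); apply.
split; last by move=> s /= sK; exact: K_summable.
split=> [|x y /= xS yS]; first by rewrite /= /coboundary translate1 subrr rpred0.
have yE : coboundary y^-1%g = - translate y^-1%g (coboundary y).
  by rewrite /coboundary translateB translateM mulVg translate1 opprB.
rewrite coboundaryM yE rpredD // translate_summable // rpredN translate_summable //.
Qed.

Definition affine_action (g : Gamma) (u : ell2_banach T X) : ell2_banach T X :=
  Ell2 (rpredD (translate_summable g (valP (u : ell2 T X))) (coboundary_summable g)).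

Lemma affine_action_isometric : isometric_action affine_action.
Proof.
split=> [g u v|u|g h u].
- rewrite !ell2_normE /ell2_norm.
  have -> : val ((affine_action g u : ell2 T X) - affine_action g v) =
      translate g (val ((u : ell2 T X) - v)).
    by apply/funext => i; rewrite /= /translate /= opprD addrACA subrr addr0.
  by rewrite translate_partial_sum.
- apply: val_inj; rewrite /= translate1 /coboundary translate1 subrr.
  exact: addr0.
- apply: val_inj; rewrite /= coboundaryM -translateM addrA.
  by congr (_ + _); apply/funext => i.
Qed.

(** A fixed point [u] exhibits the cocycle as a coboundary of a square summable
    function, so its values are bounded. *)
Lemma fixed_point_bounds_coboundary (u : ell2_banach T X) :
  (forall g, affine_action g u = u) ->
  forall g k, block_sum (coboundary g) k <= 4 * ell2_norm (u : ell2 T X) ^+ 2.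
Proof.
move=> fixed g k; pose U := val (u : ell2 T X).
have -> : coboundary g = U - translate g U.
  have E : translate g U + coboundary g = U.
    by have := congr1 val (fixed g : _ = u :> ell2 T X).
  by apply/esym/eqP; rewrite subr_eq addrC E.
have block_le : block_sum (U - translate g U) k <=
    2 * (block_sum U k + block_sum (translate g U) k).
  rewrite /block_sum -big_split mulr_sumr /=; apply: ler_sum => h _.
  rewrite [(U - translate g U) _]/(U _ - translate g U _).
  have := ler_normB (U (Tagged T h)) (translate g U (Tagged T h)).
  have := normr_ge0 (U (Tagged T h) - translate g U (Tagged T h)).
  have := normr_ge0 (U (Tagged T h)); have := normr_ge0 (translate g U (Tagged T h)).
  move: `|_ - _| `|U _| `|translate _ _ _| => p q r r0 q0 p0 pqr.
  have : p ^+ 2 <= (q + r) ^+ 2 by rewrite ler_sqr ?nnegrE ?addr_ge0.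
  have := sqr_ge0 (q - r); lra.
have blockU : block_sum U k <= ell2_norm (u : ell2 T X) ^+ 2.
  exact: le_trans (block_sum_le_partial U k) (partial_sum_le_norm (u : ell2 T X) k.+1).
by apply: le_trans block_le _; rewrite translate_block; lra.
Qed.
End SumOfQuotients.

Record test_function := TestFunction {
  test_group : finGroupType;
  test_hom : Gamma -> test_group;
  test_fun : test_group -> X;
  test_elem : Gamma }.

(** Property (F) for the single space [ell2] implies a spectral gap that is uniform
    over all finite quotients: functions violating it worse and worse, on the
    members of a sequence of quotients and suitably rescaled, would add up to an
    unbounded cocycle on the sum of the quotients. *)
Theorem property_F_uniform_gap (K : seq Gamma) :
  smallest (@is_subgroup Gamma) [set` K] = setT ->
  property_F (uniformly_convex R) Gamma -> uniformly_convex R X ->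
  exists2 C : R, 0 < C & forall (H : finGroupType) (psi : Gamma -> H),
    group_hom psi -> forall (f : H -> X) (g : Gamma),
    displacement f (psi g) <= C * \sum_(s <- K) displacement f (psi s).
Proof.
move=> K_generates [_ propF] Xuc; apply: contrapT => no_gap.
have /choice[D DP] : forall k : nat, exists D : test_function, group_hom (@test_hom D) /\
    (k.+1%:R * 2 ^+ k) *
      \sum_(s <- K) displacement (@test_fun D) (test_hom D s)
    < displacement (@test_fun D) (test_hom D (test_elem D)).
  move=> k; apply: contrapT => noD; apply: no_gap.
  exists (k.+1%:R * 2 ^+ k) => [|H psi psiM f g]; first by rewrite mulr_gt0 // exprn_gt0.
  rewrite leNgt; apply/negP => bad; apply: noD.
  by exists (TestFunction psi f g).
pose T k := test_group (D k); pose psi k : Gamma -> T k := @test_hom (D k).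
have psiM k : group_hom (psi k) by have [] := DP k.
pose disp k g := displacement (@test_fun (D k)) g.
pose top k := disp k (psi k (test_elem (D k))).
pose low k := \sum_(s <- K) disp k (psi k s).
have low_ge0 k : 0 <= low k by apply: sumr_ge0 => s _; exact: displacement_ge0.
have C_gt0 k : 0 < k.+1%:R * 2 ^+ k :> R by rewrite mulr_gt0 // exprn_gt0.
have low_top k : k.+1%:R * 2 ^+ k * low k < top k by have [] := DP k.
have top_gt0 k : 0 < top k.
  by apply: le_lt_trans (low_top k); rewrite mulr_ge0 // ltW.
(* The scaling makes the displacement by the bad element [k + 1], while the
   displacements by [K] sum to less than [2 ^- k]. *)
pose c k := Num.sqrt (k.+1%:R / top k).
have c2 k : c k ^+ 2 = k.+1%:R / top k by rewrite sqr_sqrtr // divr_ge0 // ltW.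
pose Phi (i : {k : nat & T k}) : X := c (tag i) *: @test_fun (D (tag i)) (tagged i).
have blockE g k : block_sum (coboundary psi Phi g) k = c k ^+ 2 * disp k (psi k g).
  rewrite /block_sum /disp /displacement mulr_sumr; apply: eq_bigr => h _.
  have -> : coboundary psi Phi g (Tagged T h) =
      c k *: (@test_fun (D k) (h * psi k g)%g - @test_fun (D k) h) by rewrite scalerBr.
  rewrite normrZ exprMn.
  by rewrite real_normK ?num_real.
have K_summable s : s \in K -> coboundary psi Phi s \in @square_summable R T X.
  move=> sK; apply/square_summableP; exists 2 => N.
  suff : partial_sum (coboundary psi Phi s) N <= 2 - 2 * 2^-1 ^+ N.
    by move=> /le_trans; apply; rewrite lerBlDr lerDl mulr_ge0 // exprn_ge0.
  elim: N => [|N IH]; first by rewrite /partial_sum big_ord0 expr0; lra.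
  rewrite partial_sumS blockE c2.
  have disp_low : disp N (psi N s) <= low N.
    rewrite /low (big_rem s) //= lerDl sumr_ge0 // => s' _; exact: displacement_ge0.
  have : N.+1%:R / top N * disp N (psi N s) <= 2^-1 ^+ N.
    rewrite mulrAC ler_pdivrMr // exprVn [_^-1 * _]mulrC ler_pdivlMr ?exprn_gt0 //.
    apply: le_trans (ltW (low_top N)); rewrite mulrAC.
    by apply: ler_wpM2l; [exact: ltW | exact: disp_low].
  by move: IH; rewrite exprS; lra.
have [u u_fixed] := propF _ (ell2_uniformly_convex T Xuc) _
  (affine_action_isometric psiM K_generates K_summable).
have bound := fixed_point_bounds_coboundary u_fixed.
set M := 4 * _ in bound.
have [k kM] : exists k : nat, M < k.+1%:R.
  by exists (Num.truncn M); exact: truncnS_gt.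
have := bound (test_elem (D k)) k; rewrite blockE c2 divfK ?gt_eqF //.
by rewrite leNgt kM.
Qed.

End UniformDisplacement.

(** * Super-expanders from coverings *)

Section CoveredGroups.
Variables (R : realType) (X : completeNormedModType R).

Lemma displacement1 (H : finGroupType) (f : H -> X) : displacement f 1%g = 0.
Proof.
by rewrite /displacement big1 // => h _; rewrite mulg1 subrr normr0 expr0n.
Qed.

Lemma displacementM (H : finGroupType) (f : H -> X) (g g' : H) :
  displacement f (g * g')%g <= 2 * (displacement f g + displacement f g').
Proof.
have -> : displacement f g' = \sum_(h : H) `|f (h * g * g')%g - f (h * g)%g| ^+ 2.
  by rewrite /displacement (reindex_inj (mulIg g)).
rewrite /displacement -big_split mulr_sumr /=; apply: ler_sum => h _.
rewrite mulgA; have := ler_distD (f (h * g)%g) (f (h * g * g')%g) (f h).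
move: (normr_ge0 (f (h * g * g')%g - f h)) (normr_ge0 (f (h * g * g')%g - f (h * g)%g)).
move: (normr_ge0 (f (h * g)%g - f h)).
move: `|f (h * g * g')%g - f h| `|_ - f (h * g)%g| `|f (h * g)%g - f h| => p q r r0 p0 q0 pqr.
have : p ^+ 2 <= (q + r) ^+ 2 by rewrite ler_sqr ?nnegrE ?addr_ge0.
have := sqr_ge0 (q - r); lra.
Qed.

Lemma displacement_word (H : finGroupType) (f : H -> X) (D : R) (gs : seq H) :
  0 <= D -> (forall g, g \in gs -> displacement f g <= D) ->
  displacement f (\prod_(g <- gs) g)%g <= 4 ^+ size gs * D.
Proof.
move=> D0; elim: gs => [|g gs IH] gsD; first by rewrite big_nil displacement1 mul1r.
rewrite big_cons /= exprS; apply: le_trans (displacementM _ _ _) _.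
have gD : displacement f g <= D by apply: gsD; rewrite mem_head.
have := IH (fun h hgs => gsD h (mem_behead (s := g :: gs) hgs)).
have : D <= 4 ^+ size gs * D by rewrite ler_peMl // exprn_ege1 // ler1n.
lra.
Qed.

(** Averaging over [g] the displacement of [f] by [g] gives the denominator of the
    Poincare ratio of a Cayley graph; the edges give the displacements by [S]. *)
Lemma Cayley_gap (H : finGroupType) (S : {set H}) (C N : R) :
  0 < C -> #|S|%:R <= N ->
  (forall (f : H -> X) g, displacement f g <= C * \sum_(t in S) displacement f t) ->
  (((2 * C * (N + 1))^-1)%:E <=
     spectral_gap (Cayley S) (fun x y : X => `|x - y|%R))%E.
Proof.
move=> C0 SN gap; rewrite /spectral_gap.
have N1 : 0 < N + 1 by rewrite ltr_wpDl // (le_trans _ SN).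
have -> : (2 * C * (N + 1))^-1 = 2^-1 * (C * (N + 1))^-1 by rewrite -invfM mulrA.
rewrite EFinM lee_pmul2l ?lte_fin //.
apply: le_ereal_inf_tmp => _ [f [v [w fvw]] <-]; rewrite lee_fin /poincare_ratio.
pose F : H -> X := f.
have edgesE : \sum_(ed in edges (Cayley S)) `|f ed.2 - f ed.1| ^+ 2 =
    \sum_(t in S) displacement F t.
  rewrite /= curry_imset2X big_imset /=; last first.
    move=> [h t] [h' t'] _ _ /= [-> /mulgI ->] //.
  rewrite [LHS](_ : _ = \sum_(h : H) \sum_(t in S) `|F (h * t)%g - F h| ^+ 2).
    exact: exchange_big.
  by rewrite pair_big /=; apply: eq_big => [[h t]|[h t] _] //=; rewrite !inE.
have cardE : #|edges (Cayley S)| = (#|H| * #|S|)%N.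
  rewrite /= curry_imset2X card_imset; last by move=> [h t] [h' t'] /= [-> /mulgI ->].
  by rewrite cardsX cardsT.
have allE : \sum_(vw : vertex (Cayley S) * vertex (Cayley S)) `|f vw.1 - f vw.2| ^+ 2 =
    \sum_(g : H) displacement F g.
  rewrite -(pair_bigA _ (fun v w : H => `|F v - F w| ^+ 2)) /= exchange_big /=.
  rewrite [RHS]exchange_big /=; apply: eq_bigr => h _.
  by rewrite (reindex_inj (mulgI h)).
rewrite edgesE cardE allE.
set Delta := \sum_(t in S) _; set total := \sum_(g : H) _.
have H0 : 0 < #|H|%:R :> R by rewrite ltr0n; apply/card_gt0P; exists 1%g.
have total_gt0 : 0 < total.
  rewrite /total (bigD1 (w^-1 * v)%g) //=; apply: ltr_pwDl; last first.
    by apply: sumr_ge0 => g _; exact: displacement_ge0.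
  rewrite /displacement (bigD1 (w : H)) //=; apply: ltr_pwDl; last first.
    by apply: sumr_ge0 => g _; exact: sqr_ge0.
  by rewrite mulKVg exprn_gt0 // normr_gt0 subr_eq0; apply/eqP.
have total_le : total <= #|H|%:R * (C * Delta).
  rewrite mulr_natl -sumr_const; apply: ler_sum => g _; exact: gap.
have Delta0 : 0 < Delta.
  by have := lt_le_trans total_gt0 total_le; rewrite pmulr_rgt0 // pmulr_rgt0.
have S0 : 0 < #|S|%:R :> R.
  rewrite ltr0n lt0n; apply/negP => /eqP/cards0_eq S0; move: Delta0.
  by rewrite /Delta S0 big_set0 ltxx.
rewrite natrM ler_pdivlMr ?mulr_gt0 // mulrC ler_pdivrMr ?mulr_gt0 //.
apply: le_trans (_ : #|H|%:R * #|S|%:R * (#|H|%:R * (C * Delta)) <= _).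
  by rewrite ler_wpM2l // mulr_ge0 // ltW.
have -> : #|H|%:R * #|S|%:R * (#|H|%:R * (C * Delta)) =
   #|H|%:R ^+ 2 * Delta * (C * #|S|%:R) :> R by ring.
apply: ler_wpM2l; first by rewrite mulr_ge0 ?sqr_ge0 // ltW.
by rewrite ler_pM2l //; lra.
Qed.

Lemma Cayley_degree (H : finGroupType) (S : {set H}) (v : vertex (Cayley S)) :
  (degree v <= 2 * #|S|)%N.
Proof.
rewrite /degree mul2n -addnn.
have sub : [set ed in edges (Cayley S) | (ed.1 == v) || (ed.2 == v)]%SET \subset
   ([set ((v : H), (v * t)%g) | t in S] :|: [set ((v * t^-1)%g, (v : H)) | t in S])%SET.
  apply/fintype.subsetP => -[x y]; rewrite !inE /= => /andP[/imset2P[h t _ tS [-> ->]]].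
  move=> /orP[]/eqP <-; apply/orP; [left|right]; apply/imsetP; exists t => //.
  by rewrite mulgK.
apply: leq_trans (subset_leq_card sub) _; apply: leq_trans (leq_card_setU _ _) _.
by apply: leq_add; exact: leq_imset_card.
Qed.
End CoveredGroups.

(** The uniform gap for [Gamma] bounds the displacement of a function by the elements
    of each image, hence by their products of bounded length, that is by all the
    elements of the group. *)
Theorem covered_super_expanders (R : realType) (Gamma : groupType)
    (G : nat -> finGroupType) (N L : nat) :
  property_F (uniformly_convex R) Gamma ->
  (forall k, exists psis : seq (Gamma -> G k), [/\ (size psis <= N)%N,
     (forall j, (j < size psis)%N -> group_hom (nth (fun=> 1%g) psis j)) &
     forall g : G k, exists gs : seq (G k), [/\ (size gs <= L)%N,
       g = (\prod_(x <- gs) x)%g &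
       forall x, x \in gs -> exists j gamma, (j < size psis)%N /\
         x = nth (fun=> 1%g) psis j gamma]]) ->
  #|G k| @[k --> \oo] --> \oo ->
  can_form_super_expanders R G.
Proof.
move=> propF cover cardG; have [K K_generates] := propF.1.
pose psis k := projT1 (cid (cover k)).
have psisP k := projT2 (cid (cover k)).
pose psi k j := nth (fun=> 1%g) (psis k) j.
pose S k : {set G k} :=
  [set:: [seq psi k j s | j <- iota 0 (size (psis k)), s <- K]]%SET.
have SE k j s : (j < size (psis k))%N -> s \in K -> psi k j s \in S k.
  move=> jk sK; rewrite inE; apply/allpairsP; exists (j, s).
  by rewrite mem_iota.
have cardS k : (#|S k| <= N * size K)%N.
  rewrite cardsE; apply: leq_trans (card_size _) _.
  by rewrite size_allpairs size_iota leq_mul2r; have [-> _ _] := psisP k; rewrite orbT.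
exists S; split=> [k|].
  apply/eqP; rewrite finset.eqEsubset finset.subsetT /=; apply/fintype.subsetP => g _.
  have [_ hom cov] := psisP k; have [gs [_ -> gsP]] := cov g.
  rewrite big_seq; elim/big_ind: _ => [|x y xS yS|x]; first exact: group1.
    exact: groupM.
  move=> /gsP[j [gamma [jk ->]]].
  have : [set: Gamma] gamma by [].
  have psiM a b : psi k j (a * b)%g = (psi k j a * psi k j b)%g by exact: hom.
  have psi1 : psi k j 1%g = 1%g by apply: (mulgI (psi k j 1%g)); rewrite -psiM !mulg1.
  rewrite -K_generates => /(_ [set g' | psi k j g' \in <<S k>>%g]); apply; split.
    split=> [|x' y' xS yS] /=; first by rewrite psi1 group1.
    rewrite psiM groupM //; suff -> : psi k j y'^-1%g = (psi k j y')^-1%g by rewrite groupV.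
    by apply: (mulgI (psi k j y')); rewrite -psiM !mulgV.
  by move=> s sK /=; apply: mem_gen; exact: SE.
split=> [||X Xuc].
- exists (2 * (N * size K))%N => k v; apply: leq_trans (Cayley_degree v) _.
  by rewrite leq_mul2l cardS.
- exact: cardG.
have [C C0 CP] := property_F_uniform_gap K_generates propF Xuc.
pose C' : R := 4 ^+ L * (C * (size K + 1)%:R).
have C'0 : 0 < C' by rewrite mulr_gt0 ?exprn_gt0 // mulr_gt0 // ltr0n addn1.
apply: (@lt_le_trans _ _ ((2 * C' * ((N * size K)%:R + 1))^-1)%:E).
  by rewrite lte_fin invr_gt0 mulr_gt0 ?mulr_gt0 // ltr_wpDl.
apply: le_ereal_inf_tmp => _ [k _ <-].
apply: Cayley_gap => //; first by rewrite ler_nat.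
move=> f g; have [_ hom cov] := psisP k; have [gs [gsL -> gsP]] := cov g.
set Delta := \sum_(t in S k) _.
have Delta0 : 0 <= Delta by apply: sumr_ge0 => t _; exact: displacement_ge0.
have D0 : 0 <= C * (size K + 1)%:R * Delta by rewrite mulr_ge0 // mulr_ge0 // ltW.
apply: le_trans (displacement_word (D := C * (size K + 1)%:R * Delta) D0 _) _.
  move=> x /gsP[j [gamma [jk ->]]].
  apply: le_trans (CP _ _ (hom j jk) f gamma) _.
  rewrite -mulrA ler_wpM2l ?(ltW C0) //.
  apply: (@le_trans _ _ (\sum_(s <- K) Delta)).
    rewrite big_seq [leRHS]big_seq; apply: ler_sum => s sK.
    have := SE k j s jk sK => tS; rewrite /Delta (bigD1 (psi k j s)) //= lerDl.
    by apply: sumr_ge0 => t _; exact: displacement_ge0.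
  rewrite big_const_seq count_predT iter_addr_0 -[Delta *+ _]mulr_natl ler_wpM2r // ler_nat.
  exact: leq_addr.
rewrite /C' -!mulrA; apply: ler_wpM2r; first by rewrite mulrA.
by rewrite ler_weXn2l // ler1n.
Qed.

(** * The free algebra *)

Section FreeAlgebra.
Variables (k : nzRingType) (n : nat).
Local Notation A := (free_alg k n).

Lemma free_vars_generate : (forall c : k, exists z : int, c = z%:~R) ->
  ring_generated (free_vars k n).
Proof.
move=> kZ S S1 SB SM Svar x.
have S0 : S 0 by rewrite -(subrr 1); exact: SB.
have SN y : S y -> S (- y) by move=> Sy; rewrite -[- y]add0r; exact: SB.
have SD y z : S y -> S z -> S (y + z).
  by move=> Sy Sz; rewrite -[z]opprK; apply: SB => //; exact: SN.
have Sword (w : seq 'I_n) : S (mkmalgU (FMonom w) 1).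
  elim: w => [|i w IH].
    have -> : FMonom [::] = (mone : fmonom 'I_n) by rewrite /mone /= fmoneE.
    exact: S1.
  have -> : mkmalgU (FMonom (i :: w)) 1 = free_var k i * mkmalgU (FMonom w) 1 :> A.
    rewrite malgM_def fgmulUU mulr1; congr mkmalgU.
    by rewrite /mmul /= fmmulE fmuE.
  apply: SM IH; apply: Svar; apply: map_f; exact: mem_enum.
rewrite (monalgE x); elim/big_ind: _ => // m _; have [z ->] := kZ (mcoeff m x).
have -> : mkmalgU m z%:~R = (mkmalgU m 1 : A) *~ z by rewrite raddfMz.
have Sm : S (mkmalgU m 1) by case: m => w; exact: Sword.
have Snat j : S (mkmalgU m 1 *+ j) by elim: j => [|j IH]; rewrite ?mulr0n // mulrS; exact: SD.
by case: z => j; rewrite /intmul; [exact: Snat | apply: SN; exact: Snat].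
Qed.

Section Evaluation.
Variables (S : nzRingType) (f : {rmorphism k -> S}) (v : 'I_n -> S).
Hypothesis f_central : forall c x, GRing.comm (f c) x.

Definition word_value (m : fmonom 'I_n) : S := \prod_(i <- fmonom_val m) v i.

Lemma word_value_mmorphism : mmorphism word_value.
Proof.
split=> [x y|]; rewrite /word_value; last by rewrite /mone /= fmoneE big_nil.
by rewrite /mmul /= fmmulE big_cat.
Qed.

HB.instance Definition _ := monalg.isMultiplicative.Build _ _ word_value
  word_value_mmorphism.

Definition free_alg_eval : A -> S := mmap f word_value.

Lemma free_alg_eval_additive : additive free_alg_eval.
Proof. exact: mmap_is_additive. Qed.

Lemma free_alg_eval_multiplicative : GRing.monoid_morphism free_alg_eval.
Proof.
have [//|evM ev1] := @commr_mmap_is_multiplicative _ _ _ f word_value.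
by split=> [|x y]; [exact: ev1 | exact: evM].
Qed.

Lemma free_alg_eval_var i : free_alg_eval (free_var k i) = v i.
Proof.
rewrite /free_alg_eval /free_var mmapU [X in X * _](rmorph1 f : _ = 1) mul1r.
by rewrite /word_value fmuE big_seq1.
Qed.
End Evaluation.

Lemma free_alg_morphism (S : nzRingType) (f : {rmorphism k -> S}) (v : 'I_n -> S) :
  (forall c x, GRing.comm (f c) x) ->
  exists phi : {rmorphism A -> S}, forall i, phi (free_var k i) = v i.
Proof.
move=> f_central.
pose phi := free_alg_eval f v.
pose phi_add := GRing.isZmodMorphism.Build _ _ phi (free_alg_eval_additive f v).
pose phi_mul := GRing.isMonoidMorphism.Build _ _ phi (free_alg_eval_multiplicative v f_central).
pose phiR : {rmorphism A -> S} := HB.pack phi phi_add phi_mul.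
by exists phiR => i; exact: free_alg_eval_var.
Qed.
End FreeAlgebra.

(** * Bounded generation of special linear groups *)

Section Transvections.
Variables (F : fieldType) (n : nat).
Local Notation M := 'M[F]_n.
Implicit Types (J : {set 'I_n}) (i j b : 'I_n).

Definition transvection i j (c : F) : M := 1%:M + c *: delta_mx i j.

Definition SL_on J (A : M) : Prop :=
  \det A = 1 /\ forall i j, (i \notin J) || (j \notin J) -> A i j = (i == j)%:R.

Inductive transvection_product J : M -> Prop :=
  | transvection_product1 : transvection_product J 1%:M
  | transvection_productM i j c A : i \in J -> j \in J -> i != j ->
      transvection_product J A -> transvection_product J (transvection i j c *m A).

Lemma mul_delta (i j k l : 'I_n) (r s : F) :
  (r *: delta_mx i j) *m (s *: delta_mx k l) =
  if j == k then (r * s) *: delta_mx i l else 0 :> M.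
Proof.
rewrite -scalemxAl -scalemxAr scalerA mul_delta_mx_cond.
by case: eqP => _; rewrite ?mulr1n // mulr0n scaler0.
Qed.

Lemma transvectionN i j c : i != j -> transvection i j c *m transvection i j (- c) = 1%:M.
Proof.
move=> ij; rewrite /transvection mulmxDl mul1mx mulmxDr mulmx1 mul_delta eq_sym (negPf ij).
by rewrite addr0 scaleNr addrNK.
Qed.

Lemma transvection_single J i j c : i \in J -> j \in J -> i != j ->
  transvection_product J (transvection i j c).
Proof. by move=> *; rewrite -[transvection _ _ _]mulmx1; do 2?constructor. Qed.

Lemma transvection_product_mul J A B : transvection_product J A ->
  transvection_product J B -> transvection_product J (A *m B).
Proof.
move=> AJ BJ; elim: AJ => [|i j c A' iJ jJ ij _ IH]; first by rewrite mul1mx.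
by rewrite -mulmxA; constructor.
Qed.

Lemma transvection_product_inv J A : transvection_product J A ->
  exists B, [/\ transvection_product J B, B *m A = 1%:M & A *m B = 1%:M].
Proof.
elim=> [|i j c A' iJ jJ ij _ [B [BJ BA AB]]].
  by exists 1%:M; rewrite mulmx1; split=> //; constructor.
have tt := transvectionN c ij; have tt' := transvectionN (- c) ij; rewrite opprK in tt'.
exists (B *m transvection i j (- c)); split.
- exact: transvection_product_mul BJ (transvection_single _ iJ jJ ij).
- by rewrite -mulmxA [transvection i j (- c) *m _]mulmxA tt' mul1mx.
- by rewrite -mulmxA [A' *m _]mulmxA AB mul1mx.
Qed.

Lemma transvection_product_sub J J' A : J \subset J' ->
  transvection_product J A -> transvection_product J' A.
Proof.
move=> /fintype.subsetP JJ'; elim=> [|i j c A' iJ jJ ij _ IH]; first exact: transvection_product1.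
by apply: transvection_productM => //; exact: JJ'.
Qed.

Lemma transvection_det i j c : i != j -> \det (transvection i j c) = 1.
Proof.
wlog ij : i j / (j < i)%N.
  move=> H ij; case: (ltngtP j i) => [ji|ji|E]; first exact: H.
    rewrite -det_tr; have -> : (transvection i j c)^T = transvection j i c.
      by rewrite /transvection linearD /= trmx1 linearZ /= trmx_delta.
    by apply: H => //; rewrite eq_sym.
  by case/eqP: ij; apply: val_inj.
move=> _; rewrite det_trig.
  rewrite big1 // => k _; rewrite !mxE eqxx; case: eqP => [->|_]; last by rewrite mulr0 addr0.
  case: eqP => [E|_]; last by rewrite mulr0 addr0.
  by rewrite E ltnn in ij.
apply/is_trig_mxP => k l kl; rewrite !mxE.
rewrite -val_eqE /= ltn_eqF // add0r.
have [ki|_] := eqVneq k i; last by rewrite mulr0.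
have [lj|_] := eqVneq l j; last by rewrite mulr0.
by move: kl; rewrite ki lj ltnNge (ltnW ij).
Qed.

Lemma SL_on_mul J A B : SL_on J A -> SL_on J B -> SL_on J (A *m B).
Proof.
move=> [detA AJ] [detB BJ]; split=> [|i j ij]; first by rewrite det_mulmx detA detB mulr1.
rewrite !mxE; case: (boolP (i \in J)) ij => [iJ /= jJ|iJ _].
  rewrite (bigD1 j) //= big1 => [|k kj]; last by rewrite BJ ?jJ ?orbT // (negPf kj) mulr0.
  by rewrite AJ ?jJ ?orbT // BJ ?jJ ?orbT // eqxx mulr1 addr0.
rewrite (bigD1 i) //= big1 => [|k ki]; last by rewrite AJ ?iJ // eq_sym (negPf ki) mul0r.
by rewrite AJ ?iJ // BJ ?iJ // eqxx mul1r addr0.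
Qed.

Lemma SL_on1 J : SL_on J 1%:M.
Proof. by split=> [|i j _]; [exact: det1 | rewrite mxE]. Qed.

Lemma transvection_product_SL J A : transvection_product J A -> SL_on J A.
Proof.
elim=> [|i j c A' iJ jJ ij _ IH]; first exact: SL_on1.
apply: SL_on_mul => //; split=> [|k l kl]; first exact: transvection_det.
rewrite !mxE; have [ki|_] := eqVneq k i; last by rewrite mulr0 addr0.
have [lj|_] := eqVneq l j; last by rewrite mulr0 addr0.
by move: kl; rewrite ki lj iJ jJ.
Qed.

Lemma SL_on_sub J J' A : J \subset J' -> SL_on J A -> SL_on J' A.
Proof.
move=> /fintype.subsetP JJ' [detA AJ]; split=> // i j ij; apply: AJ.
by case/orP: ij => ij; rewrite (contra (JJ' _) ij) ?orbT.
Qed.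

Lemma column_operation J b (s : seq 'I_n) (w : 'I_n -> F) :
  b \in J -> {in s, forall i, i \in J /\ i != b} ->
  transvection_product J (1%:M + \sum_(i <- s) w i *: delta_mx i b).
Proof.
move=> bJ; elim: s => [|i s IH] sP; first by rewrite big_nil addr0; exact: transvection_product1.
have [iJ ib] := sP i (mem_head i s).
have -> : 1%:M + \sum_(i <- i :: s) w i *: delta_mx i b =
    transvection i b (w i) *m (1%:M + \sum_(i <- s) w i *: delta_mx i b) :> M.
  rewrite /transvection mulmxDl mul1mx big_cons mulmxDr mulmx1 mulmx_sumr.
  rewrite [X in _ = _ + (_ + X)]big1_seq ?addr0; last first.
    move=> k /andP[_ ks]; have [_ kb] := sP k (mem_behead (s := i :: s) ks).
    by rewrite mul_delta eq_sym (negPf kb).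
  by rewrite [w i *: _ + _]addrC addrA.
by apply: transvection_productM => //; apply: IH => k ks; apply: sP; rewrite inE ks orbT.
Qed.

Lemma row_operation J b (s : seq 'I_n) (w : 'I_n -> F) :
  b \in J -> {in s, forall i, i \in J /\ i != b} ->
  transvection_product J (1%:M + \sum_(i <- s) w i *: delta_mx b i).
Proof.
move=> bJ; elim: s => [|i s IH] sP; first by rewrite big_nil addr0; exact: transvection_product1.
have [iJ ib] := sP i (mem_head i s).
have -> : 1%:M + \sum_(i <- i :: s) w i *: delta_mx b i =
    transvection b i (w i) *m (1%:M + \sum_(i <- s) w i *: delta_mx b i) :> M.
  rewrite /transvection mulmxDl mul1mx big_cons mulmxDr mulmx1 mulmx_sumr.
  rewrite [X in _ = _ + (_ + X)]big1_seq ?addr0; last first.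
    by move=> k /andP[_ ks]; rewrite mul_delta (negPf ib).
  by rewrite [w i *: _ + _]addrC addrA.
apply: transvection_productM => //; first by rewrite eq_sym.
by apply: IH => k ks; apply: sP; rewrite inE ks orbT.
Qed.

Definition supported J (v : 'cV[F]_n) : Prop := forall i, i \notin J -> v i 0 = 0.

Lemma transvection_act i j c (v : 'cV[F]_n) k :
  (transvection i j c *m v) k 0 = v k 0 + (if k == i then c * v j 0 else 0).
Proof.
rewrite mulmxDl mul1mx !mxE; congr (_ + _).
rewrite (bigD1 j) //= big1 => [|l lj]; last by rewrite !mxE (negPf lj) andbF mulr0 mul0r.
by rewrite !mxE eqxx andbT addr0; case: eqP; rewrite ?mulr1 // mulr0 mul0r.
Qed.

(** A nonzero entry away from [b] is used to make the entry [b] equal to 1, which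
    then clears the others; if there is none, one is created first. *)
Lemma transvection_transitive J (v : 'cV[F]_n) b :
  (1 < #|J|)%N -> b \in J -> supported J v -> v != 0 ->
  exists2 A, transvection_product J A & A *m v = delta_mx b 0.
Proof.
move=> J2 bJ vJ v0.
have generic (u : 'cV[F]_n) a : a \in J -> a != b -> supported J u -> u a 0 != 0 ->
    exists2 A, transvection_product J A & A *m u = delta_mx b 0.
  move=> aJ ab uJ ua; have ba : b != a by rewrite eq_sym.
  set t := transvection b a ((1 - u b 0) / u a 0); set u' := t *m u.
  have u'E k : u' k 0 = if k == b then 1 else u k 0.
    rewrite transvection_act; case: eqP => [->|_]; last by rewrite addr0.
    by rewrite divfK // addrC subrK.
  pose s := [seq i <- enum J | i != b].
  exists ((1%:M + \sum_(i <- s) (- u i 0) *: delta_mx i b) *m t).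
    apply: transvection_product_mul; last exact: transvection_single.
    by apply: column_operation => // i; rewrite mem_filter mem_enum => /andP[].
  rewrite -mulmxA -/u' mulmxDl mul1mx mulmx_suml; clearbody u'.
  have -> : \sum_(i <- s) (- u i 0 *: delta_mx i b) *m u' =
      \sum_(i <- s) (- u i 0) *: delta_mx i 0.
    apply: eq_bigr => i _; rewrite -scalemxAl; congr (_ *: _).
    apply/matrixP => k l; rewrite ord1 !mxE (bigD1 b) //= big1 => [|j jb].
      by rewrite !mxE u'E !eqxx mulr1 addr0.
    by rewrite !mxE (negPf jb) andbF mul0r.
  rewrite big_filter big_enum_cond /=.
  apply/matrixP => k l; rewrite ord1 !mxE u'E summxE eqxx andbT.
  have [->|kb] := eqVneq k b.
    rewrite big1 ?addr0 // => i /andP[_ ib].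
    by rewrite !mxE eq_sym (negPf ib) mulr0.
  have [kJ|kJ] := boolP (k \in J); last first.
    rewrite uJ // add0r big1 // => i /andP[iJ _]; rewrite !mxE.
    by case: eqP => [E|_]; [rewrite E iJ in kJ | rewrite mulr0].
  rewrite (bigD1 k) /= ?kJ // big1 => [|i /andP[_ ik]].
    by rewrite !mxE !eqxx mulr1 addr0 subrr.
  by rewrite !mxE eq_sym (negPf ik) mulr0.
have [/existsP[a /and3P[aJ ab va]]|none] :=
  boolP [exists a, [&& a \in J, a != b & v a 0 != 0]]; first exact: generic va.
have vE a : a != b -> v a 0 = 0.
  move=> ab; have [aJ|aJ] := boolP (a \in J); last exact: vJ.
  apply/eqP; apply: contraNT none => va; apply/existsP; exists a.
  by rewrite aJ ab va.
have vb : v b 0 != 0.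
  apply: contraNneq v0 => vb; apply/eqP/matrixP => k l; rewrite ord1 mxE.
  by have [->|/vE] := eqVneq k b.
have [a aJ ab] : exists2 a, a \in J & a != b.
  move: J2; rewrite (cardsD1 b) bJ => /card_gt0P[a].
  by rewrite !inE => /andP[ab aJ]; exists a.
have ba : b != a by rewrite eq_sym.
have [||A AJ AE] := generic (transvection a b 1 *m v) a aJ ab.
- move=> i iJ; rewrite transvection_act vJ // add0r.
  by case: eqP => [E|//]; rewrite E aJ in iJ.
- by rewrite transvection_act vE // eqxx mul1r add0r.
exists (A *m transvection a b 1); last by rewrite -mulmxA.
by apply: transvection_product_mul AJ _; exact: transvection_single.
Qed.

Lemma SL_on_column J A b : b \in J -> SL_on J A ->
  supported J (A *m delta_mx b 0) /\ A *m delta_mx b 0 != 0 :> 'cV_n.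
Proof.
move=> bJ [detA AJ]; split.
  move=> i iJ; rewrite mxE (bigD1 b) //= big1 => [|k kb]; last first.
    by rewrite !mxE (negPf kb) mulr0.
  by rewrite !mxE !eqxx mulr1 addr0 AJ ?iJ //; case: eqP => // ib; rewrite ib bJ in iJ.
have Aunit : A \in unitmx by rewrite unitmxE detA unitr1.
apply/eqP => /(congr1 (mulmx (invmx A))); rewrite mulKmx // mulmx0.
by move=> /matrixP/(_ b 0); rewrite !mxE !eqxx => /eqP; rewrite oner_eq0.
Qed.

(** When the column [b] is standard, subtracting multiples of it from the other columns
    clears the row [b] and nothing else. *)
Lemma SL_on_clear_row J A b (s : seq 'I_n) : SL_on J A -> b \in J ->
  s = [seq i <- enum J | i != b] -> A *m delta_mx b 0 = delta_mx b 0 :> 'cV_n ->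
  exists2 A', SL_on (J :\ b) A' & A = A' *m (1%:M + \sum_(i <- s) A b i *: delta_mx b i).
Proof.
move=> [detA AJ] bJ sE Ab; set X := \sum_(i <- s) _.
have sP : {in s, forall i, i \in J /\ i != b}.
  by move=> i; rewrite sE mem_filter mem_enum => /andP[].
have AbE k : A k b = (k == b)%:R.
  have /matrixP/(_ k 0) := Ab; rewrite !mxE (bigD1 b) //= big1 => [|l lb].
    by rewrite !mxE !eqxx mulr1 addr0 andbT.
  by rewrite !mxE (negPf lb) mulr0.
have AX : A *m X = X.
  rewrite mulmx_sumr; apply: eq_bigr => i _; rewrite -scalemxAr; congr (_ *: _).
  apply/matrixP => k l; rewrite !mxE (bigD1 b) //= big1 => [|j jb].
    by rewrite !mxE eqxx AbE addr0; case: (k == b); case: (l == i); rewrite ?mulr1 ?mulr0 ?mul0r.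
  by rewrite !mxE (negPf jb) mulr0.
have XX : X *m X = 0.
  rewrite {1}/X mulmx_suml big1_seq // => i /andP[_ /sP[_ ib]].
  rewrite mulmx_sumr big1 // => k _.
  by rewrite mul_delta (negPf ib).
have AE : A = (A - X) *m (1%:M + X).
  by rewrite mulmxDr mulmx1 mulmxBl AX XX subr0 subrK.
have XE k l : X k l = if (k == b) && (l \in J :\ b) then A b l else 0.
  rewrite summxE sE big_filter big_enum_cond /=; case: (eqVneq k b) => [->|kb] /=; last first.
    by rewrite big1 // => i _; rewrite !mxE (negPf kb) mulr0.
  rewrite !inE; case: ifPn => [/andP[lb lJ]|lJb].
    rewrite (bigD1 l) ?lJ //= big1 => [|i /andP[_ il]].
      by rewrite !mxE !eqxx mulr1 addr0.
    by rewrite !mxE [l == i]eq_sym (negPf il) andbF mulr0.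
  rewrite big1 // => i iJ; rewrite !mxE eqxx /=; case: eqP => [li|_]; last by rewrite mulr0.
  by move: lJb; rewrite li [(i != b) && _]andbC iJ.
exists (A - X) => //; split.
  have := congr1 determinant AE; rewrite detA det_mulmx.
  have [-> _] := transvection_product_SL (row_operation (fun i => A b i) bJ sP).
  by rewrite mulr1.
move=> i j ij; rewrite !mxE XE.
have [ib|ib] := eqVneq i b; last first.
  rewrite subr0; have [jb|jb] := eqVneq j b; first by rewrite jb AbE.
  by apply: AJ; move: ij; rewrite !inE ib jb.
rewrite ib /=; case: ifP => jJb; first by rewrite subrr; move: jJb; rewrite !inE eq_sym => /andP[/negPf -> _].
rewrite subr0; have [bj|jb] := eqVneq b j; first by rewrite -bj AbE eqxx.
by rewrite AJ ?(negPf jb) //; move: jJb; rewrite !inE eq_sym jb /= => ->; rewrite orbT.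
Qed.

Theorem SL_on_transvection_product J A : SL_on J A -> transvection_product J A.
Proof.
move: {2}#|J| (erefl #|J|) => k; elim: k J A => [|k IH] J A Jk AJ.
  have J0 : J = finset.set0 by apply: cards0_eq.
  suff -> : A = 1%:M by exact: transvection_product1.
  by apply/matrixP => i j; rewrite mxE; case: AJ => _ ->; rewrite // J0 inE.
have [b bJ] : exists b, b \in J by apply/card_gt0P; rewrite Jk.
have bk : #|J :\ b| = k by move: Jk; rewrite (cardsD1 b) bJ => -[].
have [vJ v0] := SL_on_column bJ AJ.
case: k IH Jk bk => [|k] IH Jk bk.
  have Jb i : i \in J -> i = b.
    move=> iJ; apply/eqP; apply: contraT => ib.
    by have := cards0_eq bk; move=> /setP/(_ i); rewrite !inE iJ ib.
  have [detA AE] := AJ.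
  have off i j : i != j -> A i j = 0.
    move=> ij; rewrite AE ?(negPf ij) // -negb_and; apply: contra ij => /andP[/Jb-> /Jb->].
    by rewrite eqxx.
  have Abb : A b b = 1.
    rewrite -detA det_trig; last by apply/is_trig_mxP => i j ij; rewrite off // -val_eqE /= ltn_eqF.
    rewrite (bigD1 b) //= big1 ?mulr1 // => i ib; rewrite AE ?eqxx // orbb.
    by apply: contra ib => /Jb ->.
  suff -> : A = 1%:M by exact: transvection_product1.
  apply/matrixP => i j; rewrite mxE; have [<-|/off//] := eqVneq i j.
  have [/Jb->//|iJ] := boolP (i \in J); by rewrite AE ?iJ // eqxx.
have [|t tJ tv] := transvection_transitive _ bJ vJ v0; first by rewrite Jk.
have [t' [t'J t't _]] := transvection_product_inv tJ.
have tAJ := SL_on_mul (transvection_product_SL tJ) AJ.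
rewrite mulmxA in tv; have [A' A'J tAE] := SL_on_clear_row tAJ bJ erefl tv.
have -> : A = t' *m (t *m A) by rewrite mulmxA t't mul1mx.
rewrite tAE; apply: transvection_product_mul => //; apply: transvection_product_mul.
  by apply: transvection_product_sub (IH _ _ bk A'J); exact: subD1set.
by apply: row_operation => // i; rewrite mem_filter mem_enum => /andP[].
Qed.

(** Two multiplications on the left, avoiding the coordinates [b] and [a] in turn,
    bring the column [b] to standard form; clearing the row [b] then leaves a matrix
    avoiding [b], and takes an operation avoiding [a] and one avoiding [c]. *)
Lemma SL_on_five_factors J A a b c : uniq [:: a; b; c] ->
  a \in J -> b \in J -> c \in J -> SL_on J A ->
  exists A1 A2 A3 A4 A5, A = A1 *m (A2 *m (A3 *m (A4 *m A5))) /\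
    [/\ SL_on (J :\ b) A1, SL_on (J :\ a) A2, SL_on (J :\ b) A3,
        SL_on (J :\ a) A4 & SL_on (J :\ c) A5].
Proof.
rewrite /= !inE !negb_or => /andP[/andP[ab ac] /andP[bc _]] aJ bJ cJ AJ.
have ba : b != a by rewrite eq_sym.
have ca : c != a by rewrite eq_sym.
have cb : c != b by rewrite eq_sym.
have two x y z : x != y -> x != z -> y != z -> x \in J -> y \in J -> (1 < #|J :\ z|)%N.
  move=> xy xz yz xJ yJ; rewrite (cardsD1 x) !inE xz xJ (cardsD1 y) !inE [y == x]eq_sym xy yz yJ.
  by [].
have [vJ v0] := SL_on_column bJ AJ; set v := A *m _ in vJ v0.
have [t1 t1J t1v] : exists2 t1, transvection_product (J :\ b) t1 &
    supported (J :\ a) (t1 *m v).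
  pose v1 := v - v b 0 *: delta_mx b 0.
  have v1E k : v1 k 0 = if k == b then 0 else v k 0.
    by rewrite !mxE; case: eqP => [->|_]; rewrite ?mulr1 ?subrr // mulr0 subr0.
  have [v10|v1_neq0] := eqVneq v1 0.
    exists 1%:M; first exact: transvection_product1.
    move=> i; rewrite mul1mx !inE negb_and negbK => iaJ.
    have [ib|ib] := eqVneq i b.
      by move: iaJ; rewrite ib (negPf ba) bJ.
    by have /matrixP/(_ i 0) := v10; rewrite v1E (negPf ib) => ->; rewrite mxE.
  have v1J : supported (J :\ b) v1.
    move=> i; rewrite !inE negb_and negbK v1E; case: eqP => //= _; exact: vJ.
  have cJb : c \in J :\ b by rewrite !inE cb.
  have [t1 t1J t1v1] := transvection_transitive (two a c b ac ab cb aJ cJ) cJb v1J v1_neq0.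
  exists t1 => // i; rewrite !inE negb_and negbK => iaJ.
  have -> : v = v1 + v b 0 *: delta_mx b 0 by rewrite /v1 subrK.
  have t1b : t1 *m delta_mx b 0 = delta_mx b 0 :> 'cV_n.
    apply/matrixP => k l; rewrite ord1 !mxE (bigD1 b) //= big1 => [|j jb].
      have [_ ->] := transvection_product_SL t1J; last by rewrite !inE eqxx orbT.
      by rewrite !mxE !eqxx mulr1 addr0 andbT.
    by rewrite !mxE (negPf jb) mulr0.
  rewrite mulmxDr t1v1 -scalemxAr t1b !mxE.
  have [iE|_] := eqVneq i c; first by move: iaJ; rewrite iE (negPf ca) cJ.
  have [iE|_] := eqVneq i b; first by move: iaJ; rewrite iE (negPf ba) bJ.
  by rewrite mulr0 addr0.
have [t1' [t1'J t1't1 _]] := transvection_product_inv t1J.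
have t1v0 : t1 *m v != 0.
  apply: contraNneq v0 => t1v0; by rewrite -[v]mul1mx -t1't1 -mulmxA t1v0 mulmx0.
have bJa : b \in J :\ a by rewrite !inE ba.
have [t2 t2J t2v] := transvection_transitive (two b c a bc ba ca bJ cJ) bJa t1v t1v0.
have [t2' [t2'J t2't2 _]] := transvection_product_inv t2J.
have subJ x : J :\ x \subset J by exact: subD1set.
have t1SL := SL_on_sub (subJ b) (transvection_product_SL t1J).
have t2SL := SL_on_sub (subJ a) (transvection_product_SL t2J).
have tAJ := SL_on_mul t2SL (SL_on_mul t1SL AJ).
rewrite /v !mulmxA in t2v; rewrite !mulmxA in tAJ.
have [A' A'J tAE] := SL_on_clear_row tAJ bJ erefl t2v.
set w := fun i => (t2 *m t1 *m A) b i in tAE.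
pose s := [seq i <- [seq i <- enum J | i != b] | i != a].
have sP : {in s, forall i, i \in J :\ a /\ i != b}.
  by move=> i; rewrite mem_filter mem_filter mem_enum !inE => /and3P[-> -> ->].
exists t1', t2', A', (1%:M + \sum_(i <- s) w i *: delta_mx b i), (transvection b a (w a)).
split; last first.
  split=> //; try exact: transvection_product_SL.
    exact: transvection_product_SL (row_operation w bJa sP).
  by apply: transvection_product_SL; apply: transvection_single; rewrite ?inE ?bc ?ac.
have -> : A = t1' *m (t2' *m (t2 *m t1 *m A)).
  by rewrite -!mulmxA [t2' *m (t2 *m _)]mulmxA t2't2 mul1mx mulmxA t1't1 mul1mx.
rewrite tAE; congr (_ *m (_ *m (_ *m _))).
rewrite [X in _ + X](bigD1_seq a) /=; last by rewrite filter_uniq // enum_uniq.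
  rewrite /transvection mulmxDr mulmx1 mulmxDl mul1mx mulmx_suml.
  rewrite [X in _ = _ + (_ + X)]big1_seq ?addr0; last first.
    by move=> i /andP[_ /sP[_ ib]]; rewrite mul_delta (negPf ib).
  by rewrite [s]lock -lock /s -big_filter addrAC addrA.
by rewrite mem_filter mem_enum ab aJ.
Qed.

(** Each step removes one of three coordinates and multiplies the number of factors
    by 5. *)
Theorem SL_on_bounded_generation (d : nat) J : (d + 3 <= #|J|)%N ->
  exists Js : seq {set 'I_n}, [/\ (size Js <= 3 ^ d)%N,
    forall J', J' \in Js -> #|J'| = (#|J| - d)%N &
    forall A, SL_on J A -> exists As : seq M, [/\ (size As <= 5 ^ d)%N,
      A = foldr (fun B C => B *m C) 1%:M As &
      forall B, B \in As -> exists2 J', J' \in Js & SL_on J' B]].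
Proof.
elim: d J => [|d IH] J dJ.
  exists [:: J]; split=> // [J'|A AJ]; first by rewrite inE subn0 => /eqP ->.
  exists [:: A]; split=> //; first by rewrite /= mulmx1.
  by move=> B; rewrite inE => /eqP ->; exists J; rewrite ?inE.
have [a aJ] : exists a, a \in J by apply/card_gt0P; lia.
have Ja : #|J :\ a| = #|J|.-1 by rewrite (cardsD1 a J) aJ.
have [b] : exists b, b \in J :\ a by apply/card_gt0P; rewrite Ja; lia.
rewrite !inE => /andP[ba bJ].
have Jab : #|J :\ a :\ b| = #|J|.-2.
  by have := cardsD1 b (J :\ a); rewrite !inE ba bJ Ja => /= ->.
have [c] : exists c, c \in J :\ a :\ b by apply/card_gt0P; rewrite Jab; lia.
rewrite !inE => /and3P[cb ca cJ].
have uq : uniq [:: a; b; c].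
  by rewrite /= !inE negb_or [a == b]eq_sym ba [a == c]eq_sym ca [b == c]eq_sym cb.
have dJx x : x \in J -> (d + 3 <= #|J :\ x|)%N.
  by move=> xJ; have := cardsD1 x J; rewrite xJ add1n; lia.
have sJx x : x \in J -> (#|J :\ x| - d = #|J| - d.+1)%N.
  by move=> xJ; have := cardsD1 x J; rewrite xJ add1n; lia.
have [Ka [Ka3 Kacard KaP]] := IH _ (dJx a aJ).
have [Kb [Kb3 Kbcard KbP]] := IH _ (dJx b bJ).
have [Kc [Kc3 Kccard KcP]] := IH _ (dJx c cJ).
exists (Ka ++ Kb ++ Kc); split.
- by rewrite !size_cat expnS; lia.
- move=> J'; rewrite !mem_cat => /or3P[/Kacard->|/Kbcard->|/Kccard->]; exact: sJx.
move=> A AJ.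
have [A1 [A2 [A3 [A4 [A5 [-> [S1 S2 S3 S4 S5]]]]]]] := SL_on_five_factors uq aJ bJ cJ AJ.
have [l1 [s1 -> P1]] := KbP _ S1; have [l2 [s2 -> P2]] := KaP _ S2.
have [l3 [s3 -> P3]] := KbP _ S3; have [l4 [s4 -> P4]] := KaP _ S4.
have [l5 [s5 -> P5]] := KcP _ S5.
exists (l1 ++ l2 ++ l3 ++ l4 ++ l5); split.
- by rewrite !size_cat expnS; lia.
- have catE (s s' : seq M) : foldr (fun B C => B *m C) 1%:M (s ++ s') =
      foldr (fun B C => B *m C) 1%:M s *m foldr (fun B C => B *m C) 1%:M s'.
    by elim: s => [|B s IHs] /=; rewrite ?mul1mx // IHs mulmxA.
  by rewrite !catE.
move=> B; rewrite !mem_cat => /or4P[/P1|/P2|/P3|/orP[/P4|/P5]] [J' J'K BJ'];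
  by exists J' => //; rewrite !mem_cat J'K ?orbT.
Qed.

End Transvections.

(** * Special linear groups as quotients of elementary groups *)

Section BlockEmbedding.
Variables (A : nzRingType) (F : fieldType) (n m : nat).
Variables (phi : {rmorphism A -> 'M[F]_m.+1}) (J : {set 'I_n}).
Variable pos : 'I_4 -> 'I_m.+1 -> 'I_n.
Hypothesis pos_inj : forall i a l b, pos i a = pos l b -> i = l /\ a = b.
Hypothesis posJ : forall x, x \in J -> exists i a, x = pos i a.
Local Notation E := (elementary_group A 4).

Definition block_in (i : 'I_4) : 'M[F]_(n, m.+1) := \matrix_(x, a) (x == pos i a)%:R.
Definition block_out (i : 'I_4) : 'M[F]_(m.+1, n) := \matrix_(a, x) (x == pos i a)%:R.

Lemma block_out_in i l : block_out i *m block_in l = (i == l)%:R%:M.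
Proof.
apply/matrixP => a b; rewrite !mxE (bigD1 (pos i a)) //= big1 => [|x xa].
  rewrite !mxE eqxx mul1r addr0; have [<-|il] := eqVneq i l.
    rewrite mulr1n; case: (eqVneq a b) => [->|ab]; first by rewrite eqxx.
    by case: eqP => // /pos_inj[_ E]; rewrite E eqxx in ab.
  by rewrite mul0rn; case: eqP => // /pos_inj[E]; rewrite E eqxx in il.
by rewrite !mxE (negPf xa) mul0r.
Qed.

Definition block_sum_mx (X : 'M[A]_4) : 'M[F]_n :=
  \sum_i \sum_l block_in i *m phi (X i l) *m block_out l.

Lemma block_sum_mxD X Y : block_sum_mx (X + Y) = block_sum_mx X + block_sum_mx Y.
Proof.
rewrite /block_sum_mx -big_split /=; apply: eq_bigr => i _.
rewrite -big_split /=; apply: eq_bigr => l _.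
by rewrite mxE rmorphD mulmxDr mulmxDl.
Qed.

Lemma block_out_sum l Y : block_out l *m block_sum_mx Y = \sum_p phi (Y l p) *m block_out p.
Proof.
rewrite mulmx_sumr (bigD1 l) //= [X in _ + X]big1 ?addr0 => [|i il].
  rewrite mulmx_sumr; apply: eq_bigr => p _.
  by rewrite !mulmxA block_out_in eqxx mul1mx.
rewrite mulmx_sumr big1 // => p _.
by rewrite !mulmxA block_out_in eq_sym (negPf il) !mul_scalar_mx !scale0r mul0mx.
Qed.

Lemma block_sum_mxM X Y : block_sum_mx X *m block_sum_mx Y = block_sum_mx (X *m Y).
Proof.
rewrite {1}/block_sum_mx mulmx_suml; apply: eq_bigr => i _.
rewrite mulmx_suml.
under eq_bigr => l _ do rewrite -mulmxA block_out_sum mulmx_sumr.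
rewrite exchange_big /=; apply: eq_bigr => p _.
rewrite mxE rmorph_sum mulmx_sumr mulmx_suml; apply: eq_bigr => l _.
by rewrite rmorphM !mulmxA.
Qed.

Definition block_mx_of (g : 'M[A]_4) : 'M[F]_n := 1%:M + block_sum_mx (g - 1%:M).

Lemma block_mx_of1 : block_mx_of 1%:M = 1%:M.
Proof.
rewrite /block_mx_of subrr /block_sum_mx big1 ?addr0 // => i _.
by rewrite big1 // => l _; rewrite mxE rmorph0 mulmx0 mul0mx.
Qed.

Lemma block_mx_ofM g h : block_mx_of (g *m h) = block_mx_of g *m block_mx_of h.
Proof.
rewrite /block_mx_of.
have [x ->] : exists x, g = x + 1%:M by exists (g - 1%:M); rewrite subrK.
have [y ->] : exists y, h = y + 1%:M by exists (h - 1%:M); rewrite subrK.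
have -> : (x + 1%:M) *m (y + 1%:M) - 1%:M = x *m y + x + y.
  by rewrite mulmxDr mulmx1 mulmxDl mul1mx [_ + (x + _)]addrA addrK addrAC.
rewrite !addrK !block_sum_mxD mulmxDr mulmx1 mulmxDl mul1mx block_sum_mxM.
by rewrite !addrA [LHS](+%R.[ACl 1*3*4*2]).
Qed.

Definition block_mx (g : E) : 'M[F]_n := block_mx_of (E_mx g).

Lemma block_mx1 : block_mx 1%g = 1%:M.
Proof. by rewrite /block_mx E_mx1 block_mx_of1. Qed.

Lemma block_mxM g h : block_mx (g * h)%g = block_mx g *m block_mx h.
Proof. by rewrite /block_mx E_mxM block_mx_ofM. Qed.

(** Root elements are commutators, so any homomorphism to a commutative group kills
    them. *)
Lemma block_mx_det (g : E) : \det (block_mx g) = 1.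
Proof.
pose D h := \det (block_mx h).
have DM h h' : D (h * h')%g = D h * D h' by rewrite /D block_mxM det_mulmx.
have D1 : D 1%g = 1 by rewrite /D block_mx1 det1.
have DV h : D h * D h^-1%g = 1 by rewrite -DM mulgV.
suff : [set h | D h = 1] g by [].
move: g; apply: root_elem_generate; first split=> //.
  by move=> x y /= Dx Dy; rewrite DM Dx mul1r; have := DV y; rewrite Dy mul1r.
move=> i j r ij /=; have [|k] := @exists_notin _ [:: i; j]; first by rewrite card_ord.
rewrite !inE !negb_or => /andP[ki kj].
have ik : i != k by rewrite eq_sym.
have -> : root_elem i j r =
    (root_elem i k (1 : A) * root_elem k j r * (root_elem i k (1 : A))^-1
     * (root_elem k j r)^-1)%g.
  by rewrite (elem_commutator (root_elem_family A 4)) // mul1r !mulgK.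
by rewrite !DM [D _ * D _ * _]mulrAC DV mul1r DV.
Qed.

Hypothesis phi_surj : forall B, exists r, phi r = B.

Definition in_block_image (B : 'M[F]_n) := exists g : E, block_mx g = B.

Lemma in_block_imageM B C : in_block_image B -> in_block_image C ->
  in_block_image (B *m C).
Proof. by move=> [g <-] [h <-]; exists (g * h)%g; rewrite block_mxM. Qed.

Lemma block_mx_root i l r : i != l ->
  block_mx (root_elem i l r) = 1%:M + block_in i *m phi r *m block_out l.
Proof.
move=> il; rewrite /block_mx root_elem_mx // /block_mx_of addrAC subrr add0r.
congr (_ + _); rewrite /block_sum_mx (bigD1 i) //= [X in _ + X]big1 ?addr0 => [|j ji].
  rewrite (bigD1 l) //= [X in _ + X]big1 ?addr0 => [|j jl].
    by rewrite !mxE !eqxx mulr1.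
  by rewrite !mxE (negPf jl) andbF mulr0 rmorph0 mulmx0 mul0mx.
by rewrite big1 // => p _; rewrite !mxE (negPf ji) mulr0 rmorph0 mulmx0 mul0mx.
Qed.

Lemma block_delta i l a b (c : F) :
  block_in i *m (c *: delta_mx a b) *m block_out l = c *: delta_mx (pos i a) (pos l b).
Proof.
rewrite -scalemxAr -scalemxAl; congr (_ *: _); apply/matrixP => x y.
rewrite !mxE (bigD1 b) //= big1 => [|b' b'b].
  rewrite !mxE (bigD1 a) //= big1 => [|a' a'a].
    by rewrite !mxE !eqxx mulr1 !addr0 -natrM mulnb.
  by rewrite !mxE (negPf a'a) mulr0.
by rewrite !mxE big1 ?mul0r // => a' _; rewrite !mxE (negPf b'b) andbF mulr0.
Qed.

(** A transvection between two blocks comes from one elementary matrix over [A]; inside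
    a block it is the commutator of two transvections through another block. *)
Lemma transvection_in_block_image x y c : x \in J -> y \in J -> x != y ->
  in_block_image (transvection x y c).
Proof.
have different i a l b c' : i != l -> in_block_image (transvection (pos i a) (pos l b) c').
  move=> il; have [r rE] := phi_surj (c' *: delta_mx a b).
  by exists (root_elem i l r); rewrite block_mx_root // rE block_delta.
move=> /posJ[i [a ->]] /posJ[l [b ->]] xy.
have [il|] := eqVneq i l; last exact: different.
have [|k] := @exists_notin _ [:: i]; first by rewrite card_ord.
rewrite inE => ki; have ik : i != k by rewrite eq_sym.
have kl : k != l by rewrite -il.
pose z := pos k a.
have xz : pos i a != z by apply: contraNneq ik => /pos_inj[-> _].
have zy : z != pos l b by apply: contraNneq kl => /pos_inj[-> _].
have FE x' y' r : x' != y' -> transvection x' y' r = E_mx (root_elem x' y' r : elementary_group F n).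
  by move=> xy'; rewrite root_elem_mx.
have -> : transvection (pos i a) (pos l b) c =
    transvection (pos i a) z c *m transvection z (pos l b) 1 *m
      transvection (pos i a) z (- c) *m transvection z (pos l b) (- 1).
  rewrite !FE // -!E_mxM; congr E_mx.
  have eP := root_elem_family F n.
  by rewrite !(elem_opp eP) // (elem_commutator eP) // mulr1 !mulgK.
by do 3?apply: in_block_imageM; exact: different.
Qed.

Lemma SL_on_in_block_image B : SL_on J B -> in_block_image B.
Proof.
move=> /SL_on_transvection_product; elim=> [|x y c C xJ yJ xy _ IH].
  by exists 1%g; exact: block_mx1.
by apply: in_block_imageM IH; exact: transvection_in_block_image.
Qed.
End BlockEmbedding.

Lemma block_positions n m (J : {set 'I_n}) : #|J| = (4 * m)%N ->
  exists pos : 'I_4 -> 'I_m -> 'I_n,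
    (forall i a l b, pos i a = pos l b -> i = l /\ a = b) /\
    (forall x, x \in J -> exists i a, x = pos i a).
Proof.
move=> Jm; exists (fun i a => enum_val (cast_ord (esym Jm) (mxvec_index i a))); split.
  move=> i a l b /enum_val_inj/cast_ord_inj E.
  have [g gK _] := curry_mxvec_bij 4 m; have := congr1 g E.
  have /= -> := gK (i, a) isT; have /= -> := gK (l, b) isT.
  by case.
move=> x xJ; have := enum_rankK_in xJ xJ; move: (enum_rank_in xJ x) => r <-.
have : exists i a, cast_ord Jm r = mxvec_index i a.
  by case/mxvec_indexP: (cast_ord Jm r) => i a; exists i, a.
move=> [i [a E]]; exists i, a; congr enum_val; rewrite -E; exact: esym (cast_ordK _ _).
Qed.

Section SpecialLinearCover.
Variables (F : finFieldType) (k : nat).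
Local Notation G := [subg SL k.+4 F].

Definition SL_mx (x : G) : 'M[F]_k.+4 := GLval (sgval x).

Lemma SL_mx_inj : injective SL_mx.
Proof. by move=> x y xy; apply: subg_inj; apply: val_inj. Qed.

Lemma SL_mxM x y : SL_mx (x * y)%g = SL_mx x *m SL_mx y.
Proof. by []. Qed.

Lemma SL_mx1 : SL_mx 1%g = 1%:M.
Proof. by []. Qed.

Lemma SL_mx_det x : \det (SL_mx x) = 1.
Proof. by have := subgP x; rewrite inE => /eqP. Qed.

Lemma SL_mx_exists (B : 'M[F]_k.+4) : \det B = 1 -> exists x, SL_mx x = B.
Proof.
move=> detB; have Bunit : B \is a GRing.unit by rewrite -[_ \is a _]/(B \in unitmx) unitmxE detB unitr1.
pose g : {'GL_k.+4[F]} := FinRing.Unit Bunit.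
have gSL : g \in SL k.+4 F by rewrite inE; apply/eqP.
by exists (subg (SL k.+4 F) g); rewrite /SL_mx subgK.
Qed.

Variables (A : nzRingType) (m : nat) (phi : {rmorphism A -> 'M[F]_m.+1}).
Hypothesis phi_surj : forall B, exists r, phi r = B.

Lemma SL_on_cover (J : {set 'I_k.+4}) : #|J| = (4 * m.+1)%N ->
  exists psi : elementary_group A 4 -> G, group_hom psi /\
    forall B, SL_on J B -> exists g, SL_mx (psi g) = B.
Proof.
move=> Jm; have [pos [pos_inj posJ]] := block_positions Jm.
have psiP g := SL_mx_exists (block_mx_det phi pos_inj g).
pose psi g := projT1 (cid (psiP g)).
have psiE g : SL_mx (psi g) = block_mx phi pos g by rewrite /psi; case: cid.
exists psi; split=> [g h|B BJ].
  by apply: SL_mx_inj; rewrite SL_mxM !psiE block_mxM.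
have [g gB] := SL_on_in_block_image pos_inj posJ phi_surj BJ.
by exists g; rewrite psiE.
Qed.

Lemma SL_cover : m.+1 = (k.+4 %/ 4)%N ->
  exists psis : seq (elementary_group A 4 -> G), [/\ (size psis <= 3 ^ 3)%N,
     (forall j, (j < size psis)%N -> group_hom (nth (fun=> 1%g) psis j)) &
     forall g : G, exists gs : seq G, [/\ (size gs <= 5 ^ 3)%N,
       g = (\prod_(x <- gs) x)%g &
       forall x, x \in gs -> exists j gamma, (j < size psis)%N /\
         x = nth (fun=> 1%g) psis j gamma]].
Proof.
move=> mE; set d := (k.+4 %% 4)%N.
have d3 : (d <= 3)%N by rewrite -ltnS ltn_mod.
have dn : (k.+4 = 4 * m.+1 + d)%N by rewrite mE mulnC -divn_eq.
have cardT : #|[set: 'I_k.+4]%SET| = k.+4 by rewrite cardsT card_ord.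
have [|Js [Js3 Jcard JsP]] := @SL_on_bounded_generation F k.+4 d [set: 'I_k.+4]%SET.
  by rewrite cardT; lia.
have /choice[psi psiP] : forall J : {set 'I_k.+4}, exists psi : elementary_group A 4 -> G,
    #|J| = (4 * m.+1)%N -> group_hom psi /\
    forall B, SL_on J B -> exists g, SL_mx (psi g) = B.
  move=> J; have [Jm|/eqP nJm] := eqVneq #|J| (4 * m.+1)%N; last by exists (fun=> 1%g) => /nJm.
  by have [psi psiP] := SL_on_cover Jm; exists psi.
have Jm J : J \in Js -> #|J| = (4 * m.+1)%N by move=> /Jcard ->; rewrite cardT; lia.
exists [seq psi J | J <- Js]; rewrite size_map; split.
- by apply: leq_trans Js3 _; rewrite leq_exp2l.
- move=> j jJs; rewrite (nth_map finset.set0) //.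
  by have [] := psiP _ (Jm _ (mem_nth finset.set0 jJs)).
move=> g; have [|As [As5 gE AsP]] := JsP (SL_mx g).
  by split=> [|i j]; [exact: SL_mx_det | rewrite !inE].
have [gs [sgs gsE gsP]] : exists gs : seq G, [/\ size gs = size As,
    SL_mx (\prod_(x <- gs) x)%g = foldr (fun B C => B *m C) 1%:M As &
    forall x, x \in gs -> exists j gamma, (j < size Js)%N /\
         x = nth (fun=> 1%g) [seq psi J | J <- Js] j gamma].
  elim: As {As5 gE} AsP => [|B As IH] AsP; first by exists [::]; rewrite big_nil SL_mx1.
  have [|gs [sgs gsE gsP]] := IH; first by move=> C CAs; apply: AsP; rewrite inE CAs orbT.
  have [J JJs BJ] := AsP B (mem_head _ _).
  have [_ /(_ B BJ)[gamma gB]] := psiP J (Jm J JJs).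
  exists (psi J gamma :: gs); split; first by rewrite /= sgs.
    by rewrite big_cons SL_mxM gsE gB.
  move=> x; rewrite inE => /orP[/eqP ->|/gsP//].
  exists (index J Js), gamma; rewrite index_mem; split=> //.
  by rewrite (nth_map finset.set0) ?index_mem // nth_index.
exists gs; split=> //.
  by rewrite sgs; apply: leq_trans As5 _; rewrite leq_exp2l.
by apply: SL_mx_inj; rewrite gsE.
Qed.

Lemma SL_card : (k <= #|G|)%N.
Proof.
have /choice[x xE] : forall j : 'I_k, exists x : G,
    SL_mx x = transvection ord0 (lift ord0 (inord j)) 1.
  by move=> j; apply: SL_mx_exists; exact: transvection_det.
rewrite -[X in (X <= _)%N]card_ord; apply: (leq_card x) => i j xij.
have := xE i; rewrite xij xE => /matrixP/(_ ord0 (lift ord0 (inord i))).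
rewrite !mxE !eqxx /= mulr1 !mul1r; case: eqP => [/lift_inj/(congr1 val) /=|_].
  rewrite !inordK //; last 2 first.
  - by rewrite (leq_trans (ltn_ord j)) // -addn3 leq_addr.
  - by rewrite (leq_trans (ltn_ord i)) // -addn3 leq_addr.
  by move=> E _; apply: val_inj.
by move=> /addrI/eqP; rewrite eq_sym oner_eq0.
Qed.
End SpecialLinearCover.

(** * Super-expanders from special linear groups *)

Section MatrixRingGenerators.
Variables (q m : nat).
Local Notation Mat := 'M['F_q]_m.+1.

Definition shift_up : Mat := \matrix_(i, j) (j == i.+1 :> nat)%:R.

(** The corner idempotent is [1 - s t] for the two shifts [s] and [t = s^T], and the
    shifts move it to all the matrix units. *)
Lemma shifts_generate : ring_generated [:: shift_up; shift_up^T].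
Proof.
move=> S S1 SB SM Sgen B.
have S0 : S 0 by rewrite -(subrr 1); exact: SB.
have SN y : S y -> S (- y) by move=> Sy; rewrite -[- y]add0r; exact: SB.
have SD y z : S y -> S z -> S (y + z).
  by move=> Sy Sz; rewrite -[z]opprK; apply: SB => //; exact: SN.
have SMn y j : S y -> S (y *+ j).
  by move=> Sy; elim: j => [|j IH]; rewrite ?mulr0n // mulrS; exact: SD.
have Ss : S shift_up by apply: Sgen; rewrite mem_head.
have St : S shift_up^T by apply: Sgen; rewrite !inE eqxx orbT.
have Scorner : S (delta_mx ord_max ord_max).
  have -> : delta_mx ord_max ord_max = 1 - shift_up * shift_up^T :> Mat.
    apply/matrixP => i j; rewrite !mxE.
    have [im|im] := eqVneq i ord_max.
      rewrite big1 ?subr0 => [|l _]; first by rewrite im eq_sym.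
      by rewrite !mxE im /= ltn_eqF ?mul0r.
    have i1 : (i.+1 < m.+1)%N.
      by rewrite ltnS ltn_neqAle -ltnS ltn_ord andbT; apply: contra im => /eqP im; apply/eqP/val_inj.
    rewrite (bigD1 (Ordinal i1)) //= big1 ?addr0 => [|l li]; last first.
      rewrite !mxE; case: eqP => [E|]; last by rewrite mul0r.
      by case/eqP: li; apply: val_inj.
    rewrite !mxE eqxx mul1r eqSS; have [->|ij] := eqVneq i j; first by rewrite eqxx subrr.
    by rewrite -val_eqE /= in ij; rewrite (negPf ij) subrr.
  by apply: SB => //; exact: SM.
have Scol d : (d <= m)%N -> forall i : 'I_m.+1, (i + d = m)%N -> S (delta_mx i ord_max).
  elim: d => [_ i|d IH dm i id].
    by rewrite addn0 => im; have -> : i = ord_max by exact: val_inj.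
  have i1 : (i.+1 < m.+1)%N by move: id; lia.
  have -> : delta_mx i ord_max = shift_up * delta_mx (Ordinal i1) ord_max :> Mat.
    apply/matrixP => x y; rewrite !mxE (bigD1 (Ordinal i1)) //= big1 ?addr0 => [|l li].
      rewrite !mxE eqxx /= eqSS; have [->|ix] := eqVneq i x.
        by rewrite eqxx mul1r.
      by rewrite -val_eqE /= in ix; rewrite (negPf ix) mul0r.
    by rewrite !mxE (negPf li) mulr0.
  by apply: SM => //; apply: IH; [exact: ltnW | rewrite /= addSnnS].
have Sall d : (d <= m)%N -> forall i j : 'I_m.+1, (j + d = m)%N -> S (delta_mx i j).
  elim: d => [_ i j|d IH dm i j jd].
    rewrite addn0 => jm; have -> : j = ord_max by exact: val_inj.
    have im : (i <= m)%N by rewrite -ltnS.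
    by apply: (Scol (m - i)%N); rewrite ?leq_subr // subnKC.
  have j1 : (j.+1 < m.+1)%N by move: jd; lia.
  have -> : delta_mx i j = delta_mx i (Ordinal j1) * shift_up^T :> Mat.
    apply/matrixP => x y; rewrite !mxE (bigD1 (Ordinal j1)) //= big1 ?addr0 => [|l lj].
      rewrite !mxE eqxx andbT eqSS; have [->|jy] := eqVneq j y.
        by rewrite eqxx mulr1 andbT.
      by rewrite -val_eqE /= in jy; rewrite (negPf jy) mulr0 andbF.
    by rewrite !mxE (negPf lj) andbF mul0r.
  by apply: SM => //; apply: IH; [exact: ltnW | rewrite /= addSnnS].
have Sdelta i j : S (delta_mx i j).
  have jm : (j <= m)%N by rewrite -ltnS.
  by apply: (Sall (m - j)%N); rewrite ?leq_subr // subnKC.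
rewrite (matrix_sum_delta B); elim/big_ind: _ => // i _; elim/big_ind: _ => // j _.
by rewrite -[B i j]natr_Zp scaler_nat; exact: SMn.
Qed.

Lemma free_alg_onto_matrices (k : nzRingType) (f : {rmorphism k -> Mat}) :
  (forall c x, GRing.comm (f c) x) ->
  exists phi : {rmorphism free_alg k 2 -> Mat}, forall B, exists r, phi r = B.
Proof.
move=> f_central.
have [phi phiE] := free_alg_morphism
  (fun i : 'I_2 => if i == 0 then shift_up else shift_up^T) f_central.
exists phi => B; move: B; apply: shifts_generate.
- by exists 1; rewrite rmorph1.
- by move=> _ _ [r <-] [s <-]; exists (r - s); rewrite rmorphB.
- by move=> _ _ [r <-] [s <-]; exists (r * s); rewrite rmorphM.
- move=> t; rewrite !inE => /orP[]/eqP ->.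
    by exists (free_var k 0); rewrite phiE.
  by exists (free_var k 1); rewrite phiE.
Qed.
End MatrixRingGenerators.

Theorem SL_super_expanders (R : realType) (k : nzRingType) (q : nat -> nat) :
  (forall n m, exists2 f : {rmorphism k -> 'M['F_(q n)]_m.+1},
     True & forall c x, GRing.comm (f c) x) ->
  property_F (uniformly_convex R) (elementary_group (free_alg k 2) 4) ->
  can_form_super_expanders R (fun n => [subg SL n.+4 'F_(q n.+4)]).
Proof.
move=> kq propF.
apply: (@covered_super_expanders R _ _ (3 ^ 3) (5 ^ 3) propF) => [n|].
  have [f _ f_central] := kq n.+4 (n.+4 %/ 4).-1.
  have [phi phi_surj] := free_alg_onto_matrices f_central.
  by apply: (SL_cover phi_surj); rewrite prednK // divn_gt0.
apply/cvgnyPge => N; exists N => // n /= Nn.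
exact: leq_trans Nn (SL_card _ _).
Qed.

Theorem corollary2p12 (R : realType) :
  (forall p : nat, prime p ->
     let A_p := free_alg 'F_p 2 in
     relative_T (uniformly_convex R) (Rm_subgroup A_p 2)
       (standard_subset 2 (free_vars 'F_p 2)) ->
     (forall n : nat, (4 <= n)%N ->
        property_F (uniformly_convex R) (elementary_group A_p n)) /\
     can_form_super_expanders R (fun k => [subg SL k.+4 'F_p])) /\
  (let A := free_alg int 2 in
   relative_T (uniformly_convex R) (Rm_subgroup A 2)
     (standard_subset 2 (free_vars int 2)) ->
   (forall n : nat, (4 <= n)%N ->
      property_F (uniformly_convex R) (elementary_group A n)) /\
   (forall p : nat -> nat, (forall n, (4 <= n)%N -> prime (p n)) ->
      can_form_super_expanders R (fun k => [subg SL k.+4 'F_(p k.+4)]))).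
Proof.
split=> [p _ A_p relT|A relT].
  have F_Z (c : 'F_p) : exists z : int, c = z%:~R.
    by exists (nat_of_ord c); rewrite -[LHS]natr_Zp.
  have propF := relative_T_property_F (free_vars_generate F_Z) relT.
  split=> //; apply: (@SL_super_expanders R 'F_p (fun=> p)); last exact: propF.
  move=> n m; exists (@scalar_mx 'F_p m.+1) => // c x.
  exact/esym/scalar_mxC.
have int_Z (c : int) : exists z : int, c = z%:~R by exists c; rewrite intz.
have propF := relative_T_property_F (free_vars_generate int_Z) relT.
split=> // p _; apply: (@SL_super_expanders R int p); last exact: propF.
move=> n m; exists intr => // c x.
exact/commr_sym/commr_int.
Qed.
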